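(* Let $A$ and $B$ be JBW algebras such that $A$ has no direct summand of Type $I_2$. Let $\varphi: AS(A)\to AS(B)$ be a bijection such that for all $C,D\in AS(A)$: $C\subseteq D$ iff $\varphi(C)\subseteq\varphi(D)$, and $C\perp D$ iff $\varphi(C)\perp\varphi(D)$. Then there is a unique Jordan isomorphism $\psi: A\to B$ such that $\varphi(C)=\psi(C)$ for all $C\in AS(A)$.
   Context: A JB algebra is a real Banach algebra $(A,\circ)$ with a commutative product satisfying $a\circ(b\circ a^2)=(a\circ b)\circ a^2$, $\|a^2\|\le\|a^2+b^2\|$, $\|a\|^2=\|a^2\|$; a JBW algebra is a JB algebra that is a dual Banach space. $AS(A)$ denotes the set of all associative JB subalgebras (norm-closed subalgebras with associative product, not required to contain the unit, including $\{0\}$) of $A$, ordered by inclusion. Two elements $C,D\in AS(A)$ are orthogonal, $C\perp D$, if $x\circ y=0$ for all $x\in C$, $y\in D$. A Jordan isomorphism is a bijective linear map preserving $\circ$. ''Type $I_2$'' refers to the standard type decomposition of JBW algebras; the Type $I_2$ factors are the spin factors $V_n=H_n\oplus\mathbb{R}$, $\dim H_n\ge 2$. *)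

(* Defs.v *)
From HB Require Import structures.
From mathcomp Require Import all_boot all_order all_algebra.
From mathcomp Require Import all_classical all_reals all_analysis.
Set Implicit Arguments. Unset Strict Implicit. Unset Printing Implicit Defensive.
Import Order.TTheory GRing.Theory Num.Theory.
Import numFieldNormedType.Exports.
Local Open Scope classical_set_scope.
Local Open Scope ring_scope.

Section JB.
Variable R : realType.

Section Alg.
Variable A : completeNormedModType R.
Variable mul : A -> A -> A.

Definition jsq (a : A) : A := mul a a.

Definition is_JB : Prop :=
  [/\ (forall (k : R) (a b c : A), mul (k *: a + b) c = k *: mul a c + mul b c),
      (forall a b : A, mul a b = mul b a),
      (forall a b : A, `|mul a b| <= `|a| * `|b|),
      (forall a b : A, mul a (mul b (jsq a)) = mul (mul a b) (jsq a)) &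
      ((forall a b : A, `|jsq a| <= `|jsq a + jsq b|) /\
       (forall a : A, `|a| ^+ 2 = `|jsq a|))].

(* A is a dual Banach space: isometrically isomorphic to the (norm) dual of
   some real normed space E, via T (T a is the functional e |-> T a e). *)
Definition dual_Banach : Prop :=
  exists (E : normedModType R) (T : A -> E -> R),
    [/\ (forall (k : R) (a b : A) (e : E), T (k *: a + b) e = k * T a e + T b e),
        (forall (a : A) (k : R) (e f : E), T a (k *: e + f) = k * T a e + T a f),
        (forall a : A, `|a| = sup [set `|T a e| | e in [set e : E | `|e| <= 1]]) &
        (forall f : E -> R,
           (forall (k : R) (e g : E), f (k *: e + g) = k * f e + f g) ->
           (exists M : R, forall e, `|f e| <= M * `|e|) ->
           exists a : A, T a = f)].

Definition is_JBW : Prop := is_JB /\ dual_Banach.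

Definition is_AS (C : set A) : Prop :=
  [/\ C 0,
      (forall (k : R) (x y : A), C x -> C y -> C (k *: x + y)),
      (forall x y : A, C x -> C y -> C (mul x y)),
      closed C &
      (forall x y z : A, C x -> C y -> C z -> mul (mul x y) z = mul x (mul y z))].

Definition orth (C D : set A) : Prop :=
  forall x y : A, C x -> D y -> mul x y = 0.

Definition Uop (p x : A) : A := 2%:R *: mul p (mul p x) - mul (jsq p) x.

Definition projection (p : A) : Prop := jsq p = p.

Definition opcomm (a b : A) : Prop :=
  forall c : A, mul (mul a c) b = mul a (mul c b).

Definition central_projection (z : A) : Prop :=
  projection z /\ forall x : A, opcomm z x.

Definition summand (z : A) : set A := range (Uop z).

Definition central_in (M : set A) (w : A) : Prop :=
  [/\ M w, projection w & forall x, M x -> opcomm w x].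

Definition abelian_in (M : set A) (p : A) : Prop :=
  [/\ M p, projection p &
      forall x y w : A, (Uop p @` M) x -> (Uop p @` M) y -> (Uop p @` M) w ->
        mul (mul x y) w = mul x (mul y w)].

(* e is the central support of p in M: the smallest central projection of M
   dominating p (order on projections: p <= q iff q o p = p) *)
Definition central_support_in (M : set A) (p e : A) : Prop :=
  [/\ central_in M e, mul e p = p &
      forall w, central_in M w -> mul w p = p -> mul w e = e].

(* the summand U_z A (with unit z) is of type I_2: 1 = z is the sum of two
   orthogonal abelian projections each with central support z *)
Definition typeI2_summand (z : A) : Prop :=
  exists p q : A,
    [/\ abelian_in (summand z) p, abelian_in (summand z) q,
        mul p q = 0, p + q = z &
        (central_support_in (summand z) p z /\
         central_support_in (summand z) q z)].

Definition no_typeI2_summand : Prop :=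
  forall z : A, central_projection z -> z <> 0 -> ~ typeI2_summand z.

End Alg.

Definition Jordan_iso (A B : completeNormedModType R)
  (mA : A -> A -> A) (mB : B -> B -> B) (psi : A -> B) : Prop :=
  [/\ bijective psi,
      (forall (k : R) (a b : A), psi (k *: a + b) = k *: psi a + psi b) &
      (forall a b : A, psi (mA a b) = mB (psi a) (psi b))].

End JB.

(* Main.v *)
(* The atoms of the poset of associative subalgebras are the lines [R p] with [p] a nonzero
   projection, so [phi] induces an orthogonality preserving bijection [theta] of projections.

   The main point is that [theta] extends to a linear isometry, which replaces the generalized
   Gleason theorem.  Let [p], [q] be projections and let [f] be a finitely additive probability
   on projections with [f q1 = 1] for some [q1 <= q] on which the corner [U_q1 p] is nearly a
   scalar [mu].  If [p] and [q1] are in generic position, the absence of type I2 summands leaves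
   room for a third projection exchanged with a part of [q1].  Together with [q1] and its partner
   in the two-projection algebra of [p] and [q1] it spans a copy of the symmetric real three by
   three matrices, with coefficients in the algebra generated by the squared sine of the angle.
   Restricted to suitable rotated copies of the unit sphere, [f] is a frame function that equals
   1 at a pole, hence is at least the squared first coordinate (monotonicity along great circles
   and additivity).  This bounds [f p] by [mu], and applying it to [1 - p] gives [f p ~ mu].
   So both [sum l_i p_i] and [sum l_i theta(p_i)] are close to the same scalar on a common
   nonzero projection chosen where the norm of either is nearly attained.

   The isometric extension [psi] is multiplicative because commuting projections are.  Finally
   [phi C] is [psi C] when [C] is generated by projections, and for [x >= 0] the subalgebra
   generated by [x] is the intersection of two such algebras, whose projections are spectral
   projections of [x] at two disjoint grids of thresholds: the elements of the intersection have
   no jumps.  These subalgebras generate every associative subalgebra. *)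

(* The obstacle is that a state of [B] composed with [theta] is only finitely additive on
   projections, with no continuity of any kind, and that there need be no minimal projections, so
   its values cannot be computed vector by vector on a Hilbert space. Hence a bound is sought only
   for an [f] concentrated on a small projection: a frame function that is 1 at the pole vanishes on
   the equator, is therefore monotone in the latitude, and needs no regularity. A lower bound
   suffices because it is applied to a vector orthogonal to the one representing [p]. Duality enters
   only twice: an extreme point of the unit ball gives the unit, which the axioms do not provide,
   and weak-star compactness gives suprema of bounded increasing sequences. Everything else is
   derived from the order, Peirce decompositions and the linearized Jordan identity; no
   representation on a Hilbert space and no theorem on algebras with two generators is invoked. *)
Require Import Defs.
From HB Require Import structures.
From mathcomp Require Import all_boot all_order all_algebra.
From mathcomp Require Import all_classical all_reals all_analysis.
From mathcomp Require Import ring lra.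
Set Implicit Arguments. Unset Strict Implicit. Unset Printing Implicit Defensive.
Import Order.TTheory GRing.Theory Num.Theory.
Import numFieldNormedType.Exports.
Local Open Scope classical_set_scope.
Local Open Scope ring_scope.

(* A reflexive decision procedure for equations between linear combinations in
   a module: compare the coefficients of each atom. *)
Inductive lexp (R : Type) :=
  LVar of nat | LZero | LAdd of lexp R & lexp R | LOpp of lexp R
| LScale of R & lexp R.
Arguments LZero {R}. Arguments LVar {R}.

Section LinearReflection.
Variables (R : nzRingType) (V : lmodType R).

Fixpoint leval (s : seq V) (e : lexp R) : V :=
  match e with
  | LVar n => nth 0 s n
  | LZero => 0
  | LAdd a b => leval s a + leval s b
  | LOpp a => - leval s a
  | LScale k a => k *: leval s a
  end.

Fixpoint lcoef (e : lexp R) (n : nat) : R :=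
  match e with
  | LVar m => if PeanoNat.Nat.eqb m n then 1 else 0
  | LZero => 0
  | LAdd a b => lcoef a n + lcoef b n
  | LOpp a => - lcoef a n
  | LScale k a => k * lcoef a n
  end.

Fixpoint lwf (k : nat) (e : lexp R) : bool :=
  match e with
  | LVar m => PeanoNat.Nat.ltb m k
  | LZero => true
  | LAdd a b => lwf k a && lwf k b
  | LOpp a => lwf k a
  | LScale _ a => lwf k a
  end.

Fixpoint lall (P : nat -> Prop) (n : nat) : Prop :=
  if n is m.+1 then lall P m /\ P m else True.

Lemma leval_coef s e : lwf (size s) e ->
  leval s e = \sum_(i < size s) lcoef e i *: s`_i.
Proof.
elim: e => [m|_|a IHa b IHb|a IHa|k a IHa] /=.
- move=> /PeanoNat.Nat.ltb_lt/ssrnat.ltP ms; rewrite (bigD1 (Ordinal ms)) //=.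
  rewrite PeanoNat.Nat.eqb_refl scale1r big1 ?addr0 // => i im.
  case: (PeanoNat.Nat.eqb_spec m i) => [mi|]; last by rewrite scale0r.
  by case/eqP: im; apply: val_inj => /=.
- by rewrite big1 // => i _; rewrite scale0r.
- move=> /andP[wa wb]; rewrite IHa // IHb // -big_split /=.
  by apply: eq_bigr => i _; rewrite scalerDl.
- by move=> wa; rewrite IHa // -sumrN; apply: eq_bigr => i _; rewrite scaleNr.
- by move=> wa; rewrite IHa // scaler_sumr; apply: eq_bigr => i _; rewrite scalerA.
Qed.

Lemma lallP (P : nat -> Prop) n : lall P n -> forall m, (m < n)%N -> P m.
Proof.
elim: n => //= n IH [/IH h Pn] m; rewrite ltnS leq_eqVlt => /orP[/eqP->//|]; exact: h.
Qed.

Lemma leval_eq s a b : lwf (size s) a && lwf (size s) b ->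
  lall (fun n => lcoef a n = lcoef b n) (size s) -> leval s a = leval s b.
Proof.
move=> /andP[wa wb] h; rewrite !leval_coef //; apply: eq_bigr => i _.
by rewrite (lallP h).
Qed.

End LinearReflection.

Ltac lmem x s :=
  match s with
  | nil => constr:(false)
  | x :: _ => constr:(true)
  | _ :: ?t => lmem x t
  end.
Ltac lcollect t s :=
  match t with
  | GRing.zero => s
  | @GRing.add _ ?a ?b => let s1 := lcollect a s in lcollect b s1
  | @GRing.opp _ ?a => lcollect a s
  | @GRing.scale _ _ _ ?a => lcollect a s
  | _ => let b := lmem t s in
         match b with true => s | false => constr:(t :: s) end
  end.
Ltac lindex x s :=
  match s with
  | x :: _ => constr:(O)
  | _ :: ?t => let n := lindex x t in constr:(S n)
  end.
Ltac lreify R t s :=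
  match t with
  | GRing.zero => constr:(@LZero R)
  | @GRing.add _ ?a ?b =>
      let a' := lreify R a s in let b' := lreify R b s in constr:(@LAdd R a' b')
  | @GRing.opp _ ?a => let a' := lreify R a s in constr:(@LOpp R a')
  | @GRing.scale _ _ ?k ?a => let a' := lreify R a s in constr:(@LScale R k a')
  | _ => let n := lindex t s in constr:(@LVar R n)
  end.
Ltac linear_eq_by R tac :=
  lazymatch goal with
  | |- @eq ?T ?l ?r =>
    let s0 := lcollect l (@nil T) in
    let s := lcollect r s0 in
    let l' := lreify (R : Type) l s in
    let r' := lreify (R : Type) r s in
    refine (@leval_eq R _ s l' r' (erefl true) _);
    cbn [lall lcoef PeanoNat.Nat.eqb size];
    repeat split; (try reflexivity); (tac tt)
  end.
Ltac linear_eq R := linear_eq_by R ltac:(fun _ => solve [lra | ring | field]).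

Lemma eq_of_scaled_diff (R : nzRingType) (V : lmodType R) (c : R) (l r x y : V) :
  x = y -> l = r + c *: (x - y) -> l = r.
Proof. by move=> ->; rewrite subrr scaler0 addr0. Qed.

(* Proves an equation that is a small multiple of the equation [h]. *)
Ltac linear_from R h :=
  let go c := (apply: (eq_of_scaled_diff (c := c) h);
               linear_eq_by R ltac:(fun _ => solve [lra])) in
  first [ go (1 : R) | go (-1 : R) | go (2 : R) | go (-2 : R) | go (2^-1 : R)
        | go (- 2^-1 : R) | go (4 : R) | go (-4 : R) | go (4^-1 : R) | go (- 4^-1 : R)
        | go (8^-1 : R) | go (- 8^-1 : R) | go (4/3 : R) | go (-4/3 : R) ].

(** * JB algebras and the linearized Jordan identity *)

Record jbAlg (R : realType) := JbAlg {
  jb_sort :> completeNormedModType R;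
  jb_op : jb_sort -> jb_sort -> jb_sort;
  jb_ax : is_JB jb_op }.
Arguments jb_op {R} _ _ _.
Notation "x ** y" := (jb_op _ x y) (at level 40, left associativity).

Section JordanIdentities.
Variables (R : realType) (A : jbAlg R).
Implicit Types (a b c d x y z p q : A) (k : R).

Lemma opC a b : a ** b = b ** a.
Proof. by case: (jb_ax A) => _ -> . Qed.
Lemma opDl a b c : (a + b) ** c = a ** c + b ** c.
Proof. by case: (jb_ax A) => h _ _ _ _; have := h 1 a b c; rewrite !scale1r. Qed.
Lemma opDr a b c : c ** (a + b) = c ** a + c ** b.
Proof. by rewrite opC opDl !(opC c). Qed.
Lemma op0l a : 0 ** a = 0.
Proof. by apply: (@addrI _ (0 ** a)); rewrite -opDl !addr0. Qed.
Lemma op0r a : a ** 0 = 0.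
Proof. by rewrite opC op0l. Qed.
Lemma opZl k a c : (k *: a) ** c = k *: (a ** c).
Proof.
by case: (jb_ax A) => h _ _ _ _; have := h k a 0 c; rewrite op0l !addr0.
Qed.
Lemma opZr k a c : c ** (k *: a) = k *: (c ** a).
Proof. by rewrite opC opZl opC. Qed.
Lemma opNl a b : (- a) ** b = - (a ** b).
Proof. by rewrite -scaleN1r opZl scaleN1r. Qed.
Lemma opNr a b : a ** (- b) = - (a ** b).
Proof. by rewrite opC opNl opC. Qed.
Lemma opBl a b c : (a - b) ** c = a ** c - b ** c.
Proof. by rewrite opDl opNl. Qed.
Lemma opBr a b c : c ** (a - b) = c ** a - c ** b.
Proof. by rewrite opDr opNr. Qed.
Definition opE := (opDl, opDr, opNl, opNr, opZl, opZr, op0l, op0r).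

Lemma op_norm a b : `|a ** b| <= `|a| * `|b|.
Proof. by case: (jb_ax A). Qed.
Lemma norm_sq a : `|a ** a| = `|a| ^+ 2.
Proof. by case: (jb_ax A) => _ _ _ _ [_ h]; rewrite h. Qed.
Lemma norm_sqD a b : `|a ** a| <= `|a ** a + b ** b|.
Proof. by case: (jb_ax A) => _ _ _ _ [h _]; exact: h. Qed.
Lemma sq_eq0 a : a ** a = 0 -> a = 0.
Proof.
move=> h; have /eqP : `|a| ^+ 2 = 0 by rewrite -norm_sq h normr0.
by rewrite sqrf_eq0 normr_eq0 => /eqP.
Qed.

Lemma jordan a b : a ** (b ** (a ** a)) = (a ** b) ** (a ** a).
Proof. by case: (jb_ax A) => _ _ _ h _; exact: h. Qed.

Let F a x := a ** ((a ** a) ** x) - (a ** a) ** (a ** x).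
Let F0 a x : F a x = 0.
Proof. by rewrite /F (opC _ x) jordan (opC (a ** x)) subrr. Qed.

(** Full polarization of [F a x = 0]: the alternating sum over subsets of {a, b, c} isolates the
    part linear in each variable. Commutativity makes every term occur twice, whence the factor
    1/2. *)
Lemma jordan_lin a b c x :
  a ** ((b ** c) ** x) + b ** ((c ** a) ** x) + c ** ((a ** b) ** x) =
  (b ** c) ** (a ** x) + (c ** a) ** (b ** x) + (a ** b) ** (c ** x).
Proof.
have h : F (a + b + c) x - F (a + b) x - F (b + c) x - F (a + c) x
       + F a x + F b x + F c x = 0 by rewrite !F0; linear_eq R.
apply: (eq_of_scaled_diff (c := 2^-1) h); rewrite /F !opE (opC b a) (opC c a) (opC c b).
linear_eq R.
Qed.

(** Exchanging [c] and [x] in [jordan_lin] leaves its right-hand side unchanged, so the two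
    left-hand sides agree. The result writes multiplication by [(a ** b) ** c] as a polynomial in
    multiplications by [a], [b], [c] and their pairwise products. *)
Lemma op_triple a b c x :
  ((a ** b) ** c) ** x =
  a ** ((b ** c) ** x) + b ** ((c ** a) ** x) + c ** ((a ** b) ** x)
  - a ** (c ** (b ** x)) - b ** (c ** (a ** x)).
Proof.
have h := jordan_lin a b x c.
rewrite (opC (b ** x) c) (opC x a) (opC (a ** x) c) (opC x (_ ** c)) in h.
rewrite (opC (b ** x)) (opC (a ** x)) (opC x c) (opC a c) in h.
have h1 := jordan_lin a b c x.
have h2 := etrans h1 (etrans (_ : _ = _) (esym h)).
by apply: (eq_of_scaled_diff (c := -1) (h2 _)); linear_eq R.
Qed.

End JordanIdentities.

(** * Powers, closures and generated associative subalgebras *)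

Section Powers.
Variables (R : realType) (A : jbAlg R).
Implicit Types (a b c d x y z p q : A) (k : R).

Definition lcomm a b := forall x, a ** (b ** x) = b ** (a ** x).

Lemma lcommC a b : lcomm a b -> lcomm b a.
Proof. by move=> h x; rewrite h. Qed.

Lemma lcomm_sq a : lcomm a (a ** a).
Proof. by move=> x; rewrite (opC _ x) jordan opC. Qed.

Lemma lcommD a b c : lcomm a b -> lcomm a c -> lcomm a (b + c).
Proof. by move=> h1 h2 x; rewrite !opE h1 h2. Qed.
Lemma lcommZ a k b : lcomm a b -> lcomm a (k *: b).
Proof. by move=> h x; rewrite !opE h. Qed.
Lemma lcomm0 a : lcomm a 0.
Proof. by move=> x; rewrite !opE. Qed.

(* [pw a n] is the power [a^(n+1)]: the algebra need not have a unit. *)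
Fixpoint pw a n := if n is m.+1 then a ** pw a m else a.

(** By [op_triple], multiplication by the next power is a polynomial in those of [a], [a ** a] and
    the two preceding powers; so the induction carries two consecutive powers. *)
Lemma lcomm_pw b a : lcomm b a -> lcomm b (a ** a) -> forall n, lcomm b (pw a n).
Proof.
move=> h1 h2 n; suff [] : lcomm b (pw a n) /\ lcomm b (pw a n.+1) by [].
elim: n => [|n [IH0 IH1]]; first by [].
split => // x /=; move: IH1; rewrite /= => IH1.
rewrite (opC a (a ** pw a n)) !op_triple !opE (opC (pw a n) a).
by rewrite !(h1, IH0, IH1, h2).
Qed.

Lemma lcomm_pw2 a m n : lcomm (pw a m) (pw a n).
Proof.
apply: lcomm_pw; apply: lcommC; apply: lcomm_pw => //.
- exact: lcomm_sq.
- exact/lcommC/lcomm_sq.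
Qed.

Lemma pwM a m n : pw a m ** pw a n = pw a (m + n).+1.
Proof.
elim: n => [|n IH]; first by rewrite opC addn0.
by rewrite /= (lcommC (lcomm_pw2 a 0 m)) /= IH addnS.
Qed.

End Powers.

Section NormClosure.
Variables (R : realType) (V : normedModType R).

Lemma closure_normP (S : set V) x :
  closure S x <-> forall e, 0 < e -> exists2 y, S y & `|x - y| < e.
Proof.
split=> [cS e e0|h B /nbhs_ballP[e /= e0 eB]].
  by have [y [Sy]] := cS _ (nbhsx_ballx x e e0); rewrite -ball_normE; exists y.
by have [y Sy xy] := h e e0; exists y; split => //; apply: eB; rewrite -ball_normE.
Qed.

Lemma closed_normP (S : set V) :
  closed S <-> forall x, (forall e, 0 < e -> exists2 y, S y & `|x - y| < e) -> S x.
Proof.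
split=> [cS x /closure_normP|h]; first exact: cS.
by move=> x /closure_normP; apply: h.
Qed.

(** The device for passing identities from a span to its closure: [L] is taken to be the difference
    of the two sides as a function of one variable. *)
Lemma closure_ker (W : normedModType R) (L : V -> W) (K : R) (S : set V) :
  (forall x y, L (x - y) = L x - L y) -> (forall x, `|L x| <= K * `|x|) ->
  (forall x, S x -> L x = 0) -> forall x, closure S x -> L x = 0.
Proof.
move=> LB LK LS x /closure_normP h; apply/eqP; rewrite -normr_le0.
apply/ler_addgt0Pr => e e0; rewrite add0r.
have K0 : 0 < `|K| + 1 by rewrite ltr_wpDl.
have [y Sy xy] := h (e / (`|K| + 1)) (divr_gt0 e0 K0).
rewrite -(subr0 (L x)) -(LS y Sy) -LB (le_trans (LK _)) //.
apply: (@le_trans _ _ ((`|K| + 1) * `|x - y|)).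
  by rewrite ler_wpM2r // (le_trans (ler_norm K)) // lerDl.
by rewrite mulrC -ler_pdivlMr // ltW.
Qed.

Lemma le_of_le_addeps (x y : R) (C : R) :
  (forall e, 0 < e -> x <= y + C * e) -> x <= y.
Proof.
move=> h; apply/ler_addgt0Pr => e e0.
have K0 : 0 < `|C| + 1 by rewrite ltr_wpDl.
apply: (le_trans (h _ (divr_gt0 e0 K0))); rewrite lerD2l mulrCA -[leRHS]mulr1.
apply: ler_wpM2l; first exact: ltW.
by rewrite ler_pdivrMr // mul1r (le_trans (ler_norm C)) // lerDl.
Qed.

End NormClosure.

Section GeneratedSubalgebra.
Variables (R : realType) (A : jbAlg R).
Implicit Types (F S : set A) (a b c x y z : A).

Inductive lspan F : A -> Prop :=
| lspan0 : lspan F 0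
| lspanS k x y : F x -> lspan F y -> lspan F (k *: x + y).

Lemma lspan_gen F x : F x -> lspan F x.
Proof. by move=> Fx; rewrite -[x]addr0 -[x]scale1r; apply: lspanS => //; exact: lspan0. Qed.

Lemma lspanD F x y : lspan F x -> lspan F y -> lspan F (x + y).
Proof.
move=> hx hy; elim: hx => [|k u v Fu _ IH]; first by rewrite add0r.
by rewrite -addrA; apply: lspanS.
Qed.

Lemma lspanZ F k x : lspan F x -> lspan F (k *: x).
Proof.
elim=> [|l u v Fu _ IH]; first by rewrite scaler0; exact: lspan0.
by rewrite scalerDr scalerA; apply: lspanS.
Qed.

Lemma lspanM F : (forall x y, F x -> F y -> F (x ** y)) ->
  forall x y, lspan F x -> lspan F y -> lspan F (x ** y).
Proof.
move=> FM x y hx hy; elim: hx => [|k u v Fu _ IH]; first by rewrite op0l; exact: lspan0.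
rewrite opDl opZl; apply: lspanD => //; apply: lspanZ.
elim: hy => [|l w t Fw _ IH2]; first by rewrite op0r; exact: lspan0.
by rewrite opDr opZr; apply: lspanS => //; exact: FM.
Qed.

Lemma lspan_lcomm F a : (forall x, F x -> lcomm a x) -> forall x, lspan F x -> lcomm a x.
Proof.
move=> h x; elim=> [|k u v Fu _ IH]; first exact: lcomm0.
by apply: lcommD => //; apply: lcommZ; exact: h.
Qed.

Lemma closure_lspan_lin F k x y : closure (lspan F) x -> closure (lspan F) y ->
  closure (lspan F) (k *: x + y).
Proof.
move=> /closure_normP hx /closure_normP hy; apply/closure_normP => e e0.
have K0 : 0 < `|k| + 1 by rewrite ltr_wpDl.
have e20 : 0 < e / 2 by rewrite divr_gt0.
have [u Su xu] := hx _ (divr_gt0 e20 K0).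
have [v Sv yv] := hy _ e20.
exists (k *: u + v); first by apply: lspanD => //; exact: lspanZ.
rewrite opprD addrACA -scalerBr (le_lt_trans (ler_normD _ _)) // normrZ.
rewrite (splitr e) ler_ltD //.
apply: (@le_trans _ _ ((`|k| + 1) * `|x - u|)); first by rewrite ler_wpM2r // lerDl.
by rewrite mulrC -ler_pdivlMr // ltW.
Qed.

Lemma closureM_gen S x y : (forall x y, S x -> S y -> S (x ** y)) ->
  closure S x -> closure S y -> closure S (x ** y).
Proof.
move=> SM /closure_normP hx /closure_normP hy; apply/closure_normP => e e0.
have e20 : 0 < e / 2 by rewrite divr_gt0.
have K0 : 0 < `|y| + 1 by rewrite ltr_wpDl.
have [u Su xu] := hx _ (divr_gt0 e20 K0).
have K1 : 0 < `|u| + 1 by rewrite ltr_wpDl.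
have [v Sv yv] := hy _ (divr_gt0 e20 K1).
exists (u ** v); first exact: SM.
have -> : x ** y - u ** v = (x - u) ** y + u ** (y - v) by rewrite !opE; linear_eq R.
rewrite (le_lt_trans (ler_normD _ _)) // (splitr e) ler_ltD //.
  rewrite (le_trans (op_norm _ _)) //.
  apply: (@le_trans _ _ (`|x - u| * (`|y| + 1))); first by rewrite ler_wpM2l // lerDl.
  by rewrite -ler_pdivlMr // ltW.
rewrite (le_lt_trans (op_norm _ _)) //.
apply: (@le_lt_trans _ _ (`|y - v| * (`|u| + 1))).
  by rewrite mulrC ler_wpM2l // lerDl.
by rewrite -ltr_pdivlMr.
Qed.

Lemma op_normB x y z w : `|x ** y - z ** w| <= `|x - z| * `|y| + `|z| * `|y - w|.
Proof.
have -> : x ** y - z ** w = (x - z) ** y + z ** (y - w) by rewrite !opE; linear_eq R.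
by rewrite (le_trans (ler_normD _ _)) // lerD // op_norm.
Qed.

(** Associativity of [x], [y], [z] says that multiplications by [x] and [z] commute at [y].
    Commutation of the generators passes to the span, and then to the closure by continuity in one
    variable at a time. *)
Lemma AS_closure_lspan F : (forall x y, F x -> F y -> F (x ** y)) ->
  (forall x y, F x -> F y -> lcomm x y) -> is_AS (jb_op A) (closure (lspan F)).
Proof.
move=> FM FC; split.
- by apply: subset_closure; exact: lspan0.
- exact: closure_lspan_lin.
- by move=> x y; apply: closureM_gen; exact: lspanM.
- exact: closed_closure.
- have base x y z : lspan F x -> lspan F y -> lspan F z -> x ** y ** z = x ** (y ** z).
    move=> Sx Sy Sz; rewrite opC.
    have zx : lcomm z x.
      apply: lspan_lcomm Sx => u Fu; apply/lcommC.
      by apply: lspan_lcomm Sz => v Fv; exact: FC.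
    by rewrite zx (opC z).
  move=> x y z hx hy hz; apply/eqP; rewrite -subr_eq0; apply/eqP.
  have bd (u v w : A) : `|u ** v ** w - u ** (v ** w)| <= (`|u| * `|v| * `|w|) *+ 2.
    rewrite mulr2n (le_trans (ler_normB _ _)) // lerD // (le_trans (op_norm _ _)) //.
      by rewrite ler_wpM2r // op_norm.
    by rewrite -mulrA ler_wpM2l // op_norm.
  apply: (@closure_ker _ _ _ (fun x => x ** y ** z - x ** (y ** z)) (`|y| * `|z| *+ 2) (lspan F)) => //.
  + by move=> u v; rewrite !opE; linear_eq R.
  + by move=> u; rewrite (le_trans (bd _ _ _)) // mulrnAl -mulrA mulrC.
  move=> {hx}x hx.
  apply: (@closure_ker _ _ _ (fun y => x ** y ** z - x ** (y ** z)) (`|x| * `|z| *+ 2) (lspan F)) => //.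
  + by move=> u v; rewrite !opE; linear_eq R.
  + by move=> u; rewrite (le_trans (bd _ _ _)) // mulrnAl mulrAC.
  move=> {hy}y hy.
  apply: (@closure_ker _ _ _ (fun z => x ** y ** z - x ** (y ** z)) (`|x| * `|y| *+ 2) (lspan F)) => //.
  + by move=> u v; rewrite !opE; linear_eq R.
  + by move=> u; rewrite (le_trans (bd _ _ _)) // mulrnAl.
  by move=> {hz}z hz; rewrite base // subrr.
Qed.

Definition gen x : set A := closure (lspan (range (pw x))).

Lemma gen_AS x : is_AS (jb_op A) (gen x).
Proof.
apply: AS_closure_lspan.
- by move=> _ _ [m _ <-] [n _ <-]; exists (m + n).+1; rewrite ?pwM.
- by move=> _ _ [m _ <-] [n _ <-]; exact: lcomm_pw2.
Qed.

Lemma gen_pw x n : gen x (pw x n).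
Proof. by apply: subset_closure; apply: lspan_gen; exists n. Qed.

Lemma gen_id x : gen x x. Proof. exact: (@gen_pw x 0%N). Qed.

Lemma gen_min (C : set A) x : is_AS (jb_op A) C -> C x -> gen x `<=` C.
Proof.
case=> C0 Cl CM Cc _ Cx y /closure_normP h; apply: Cc; apply/closure_normP => e e0.
have [z Sz yz] := h e e0; exists z => //.
elim: Sz => // k u v [n _ <-] _ IH; apply: Cl => //.
by elim: n => //= n IHn; apply: CM.
Qed.

End GeneratedSubalgebra.

Arguments gen_id {R A} x.
Arguments gen_pw {R A} x n.

(** * Peirce decomposition *)

(* The Peirce reflection [U_(2p-1)], written without reference to a unit. *)
HB.lock Definition refl (R : realType) (A : jbAlg R) (p x : A) : A :=
  x - 8 *: (p ** x) + 8 *: (p ** (p ** x)).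

Section Peirce.
Variables (R : realType) (A : jbAlg R).
Implicit Types (a b c d x y z p q : A) (k : R).

Definition proj p := p ** p = p.

Definition peirce1 p x := 2 *: (p ** (p ** x)) - p ** x.
Definition peirceh p x := 4 *: (p ** x) - 4 *: (p ** (p ** x)).
Definition peirce0 p x := x - 3 *: (p ** x) + 2 *: (p ** (p ** x)).

Lemma peirce_sum p x : x = peirce1 p x + peirceh p x + peirce0 p x.
Proof. rewrite /peirce1 /peirceh /peirce0; linear_eq R. Qed.

Lemma proj_cube p x : proj p -> p ** x = 3 *: (p ** (p ** x)) - 2 *: (p ** (p ** (p ** x))).
Proof.
move=> pp; have h := op_triple p p p x; rewrite !pp in h.
by apply: (eq_of_scaled_diff (c := 1) h); linear_eq R.
Qed.

Lemma peirce1P p x : proj p -> p ** peirce1 p x = peirce1 p x.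
Proof.
move=> /(proj_cube x) h; rewrite /peirce1 !opE.
linear_from R h.
Qed.
Lemma peircehP p x : proj p -> p ** peirceh p x = 2^-1 *: peirceh p x.
Proof.
move=> /(proj_cube x) h; rewrite /peirceh !opE.
linear_from R h.
Qed.
Lemma peirce0P p x : proj p -> p ** peirce0 p x = 0.
Proof.
move=> /(proj_cube x) h; rewrite /peirce0 !opE.
by apply: (eq_of_scaled_diff (c := 1) h); linear_eq R.
Qed.

Lemma peirce_uniq p x1 xh x0 : p ** x1 = x1 -> p ** xh = 2^-1 *: xh -> p ** x0 = 0 ->
  [/\ peirce1 p (x1 + xh + x0) = x1, peirceh p (x1 + xh + x0) = xh
    & peirce0 p (x1 + xh + x0) = x0].
Proof.
move=> h1 hh h0; rewrite /peirce1 /peirceh /peirce0 !(opE, h1, hh, h0).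
by split; linear_eq R.
Qed.

Lemma lcomm_peirce1 p b : proj p -> p ** b = b -> lcomm p b.
Proof.
move=> pp pb x; have h := jordan_lin p p b x; rewrite (opC b p) pp pb in h.
by apply: (eq_of_scaled_diff (c := 1) h); linear_eq R.
Qed.
Lemma lcomm_peirce0 p b : proj p -> p ** b = 0 -> lcomm p b.
Proof.
move=> pp pb x; have h := jordan_lin p p b x; rewrite (opC b p) pp pb !opE in h.
by apply: (eq_of_scaled_diff (c := -1) h); linear_eq R.
Qed.

(** Equivalent to commutation of the multiplication operators ([lcomm_proj]), but expressed by a
    single equation on [x] ([pcommE]). *)
Definition pcomm p x := peirceh p x = 0.

Lemma lcomm_proj p x : proj p -> lcomm p x <-> pcomm p x.
Proof.
move=> pp; split=> h.
  by rewrite /pcomm /peirceh; have := h p; rewrite pp (opC x p) => ->; rewrite subrr.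
rewrite (peirce_sum p x) h addr0; apply: lcommD.
  by apply: lcomm_peirce1 => //; exact: peirce1P.
by apply: lcomm_peirce0 => //; exact: peirce0P.
Qed.

Lemma pcommE p x : pcomm p x <-> p ** (p ** x) = p ** x.
Proof.
rewrite /pcomm /peirceh; split=> h; last by rewrite h subrr.
by apply: (eq_of_scaled_diff (c := - 4^-1) h); linear_eq R.
Qed.

Lemma pcomm1 p x : p ** x = x -> pcomm p x.
Proof. by move=> h; apply/pcommE; rewrite !h. Qed.
Lemma pcomm0 p x : p ** x = 0 -> pcomm p x.
Proof. by move=> h; apply/pcommE; rewrite h op0r. Qed.
Lemma pcommD p x y : pcomm p x -> pcomm p y -> pcomm p (x + y).
Proof. by move=> /pcommE h1 /pcommE h2; apply/pcommE; rewrite !opE h1 h2. Qed.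
Lemma pcommZ p k x : pcomm p x -> pcomm p (k *: x).
Proof. by move=> /pcommE h1; apply/pcommE; rewrite !opE h1. Qed.
Lemma pcommN p x : pcomm p x -> pcomm p (- x).
Proof. by rewrite -scaleN1r; exact: pcommZ. Qed.
Lemma pcommB p x y : pcomm p x -> pcomm p y -> pcomm p (x - y).
Proof. by move=> h1 h2; apply: pcommD => //; exact: pcommN. Qed.

Lemma pcomm_mulA p x y : proj p -> pcomm p x -> p ** (x ** y) = x ** (p ** y).
Proof. by move=> pp /(lcomm_proj _ pp) h; exact: h. Qed.

Lemma pcommM p x y : proj p -> pcomm p x -> pcomm p y -> pcomm p (x ** y).
Proof.
move=> pp hx hy; apply/pcommE; rewrite !(pcomm_mulA _ pp hx).
by move/pcommE: hy => ->.
Qed.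

Section Symmetry.
Variable p : A.
Hypothesis pp : proj p.

Lemma peirce11 x y : p ** x = x -> p ** y = y -> p ** (x ** y) = x ** y.
Proof. by move=> hx hy; rewrite (lcomm_peirce1 pp hx) hy. Qed.
Lemma peirce00 x y : p ** x = 0 -> p ** y = 0 -> p ** (x ** y) = 0.
Proof. by move=> hx hy; rewrite (lcomm_peirce0 pp hx) hy op0r. Qed.
Lemma peirce10 x y : p ** x = x -> p ** y = 0 -> x ** y = 0.
Proof.
move=> hx hy; have h1 := lcomm_peirce1 pp hx y; have h0 := lcomm_peirce0 pp hy x.
by move: h0; rewrite hx (opC y x) h1 hy op0r => <-.
Qed.
Lemma peirce1h x y : p ** x = x -> p ** y = 2^-1 *: y -> p ** (x ** y) = 2^-1 *: (x ** y).
Proof. by move=> hx hy; rewrite (lcomm_peirce1 pp hx) hy opE. Qed.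
Lemma peirce0h x y : p ** x = 0 -> p ** y = 2^-1 *: y -> p ** (x ** y) = 2^-1 *: (x ** y).
Proof. by move=> hx hy; rewrite (lcomm_peirce0 pp hx) hy opE. Qed.
Lemma peircehh x y : p ** x = 2^-1 *: x -> p ** y = 2^-1 *: y -> pcomm p (x ** y).
Proof.
move=> hx hy; apply/(lcomm_proj _ pp) => z.
have h := jordan_lin p x y z; rewrite (opC y p) hx hy !opE in h.
by apply: (eq_of_scaled_diff (c := 1) h); linear_eq R.
Qed.
Lemma pcomm_peirceh x y : pcomm p x -> p ** y = 2^-1 *: y -> p ** (x ** y) = 2^-1 *: (x ** y).
Proof. by move=> hx hy; rewrite pcomm_mulA // hy opE. Qed.

Lemma reflE x : refl p x = x - 8 *: (p ** x) + 8 *: (p ** (p ** x)).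
Proof. by rewrite refl.unlock. Qed.
Lemma reflD x y : refl p (x + y) = refl p x + refl p y.
Proof. rewrite !reflE !opE; linear_eq R. Qed.
Lemma reflZ k x : refl p (k *: x) = k *: refl p x.
Proof. rewrite !reflE !opE; linear_eq R. Qed.
Lemma reflN x : refl p (- x) = - refl p x.
Proof. by rewrite -scaleN1r reflZ scaleN1r. Qed.
Lemma reflB x y : refl p (x - y) = refl p x - refl p y.
Proof. by rewrite reflD reflN. Qed.
Lemma refl_comm x : pcomm p x -> refl p x = x.
Proof. by move=> /pcommE h; rewrite reflE h -addrA -addrC; linear_eq R. Qed.
Lemma refl_half x : p ** x = 2^-1 *: x -> refl p x = - x.
Proof. move=> h; rewrite reflE h !opE h; linear_eq R. Qed.
Lemma refl_fix x : refl p x = x -> pcomm p x.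
Proof. by rewrite reflE => h; apply/pcommE; linear_from R h. Qed.
Lemma refl_anti x : refl p x = - x -> p ** x = 2^-1 *: x.
Proof.
move=> h; have e1 : x = peirceh p x.
  by move: h; rewrite reflE /peirceh => h; linear_from R h.
by rewrite e1 peircehP.
Qed.

Lemma pcomm_split x : exists y z, [/\ x = y + z, pcomm p y & p ** z = 2^-1 *: z].
Proof.
exists (peirce1 p x + peirce0 p x), (peirceh p x); split; last exact: peircehP.
  by rewrite {1}(peirce_sum p x) addrAC.
apply: pcommD; first by apply: pcomm1; exact: peirce1P.
by apply: pcomm0; exact: peirce0P.
Qed.

(** The Peirce rules form a grading modulo 2, with the commutant of [p] as even part and the half
    space as odd part; [refl p] is its grading automorphism. *)
Lemma reflM x y : refl p (x ** y) = refl p x ** refl p y.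
Proof.
have [a [b [-> ha hb]]] := pcomm_split x; have [c [d [-> hc hd]]] := pcomm_split y.
rewrite !opE !reflD (refl_comm ha) (refl_comm hc) (refl_half hb) (refl_half hd) !opE.
rewrite (refl_comm (pcommM pp ha hc)) (refl_comm (peircehh hb hd)).
rewrite (refl_half (pcomm_peirceh ha hd)) (opC b c).
rewrite (refl_half (pcomm_peirceh hc hb)); linear_eq R.
Qed.
Lemma reflK x : refl p (refl p x) = x.
Proof.
have [a [b [-> ha hb]]] := pcomm_split x.
by rewrite !reflD (refl_comm ha) (refl_half hb) reflN (refl_comm ha) (refl_half hb) opprK.
Qed.
End Symmetry.

(** Evaluating the commutation of [x] and [x ** x] at [p] gives that the cube of [x] equals half of
    itself; so the cube, the fourth power and finally [x] vanish. *)
Lemma half_sq1_eq0 p x : proj p -> p ** x = 2^-1 *: x -> p ** (x ** x) = x ** x -> x = 0.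
Proof.
move=> pp hx hxx; have h := lcomm_sq x p.
rewrite (opC _ p) hxx (opC x p) hx !opE in h.
have x3 : x ** (x ** x) = 0.
  by apply: (eq_of_scaled_diff (c := 2) h); rewrite (opC (x ** x)); linear_eq R.
apply: sq_eq0; apply: sq_eq0; rewrite -[X in X ** X]/(pw x 1) pwM /= x3 op0r //.
Qed.
Lemma half_sq0_eq0 p x : proj p -> p ** x = 2^-1 *: x -> p ** (x ** x) = 0 -> x = 0.
Proof.
move=> pp hx hxx; have h := lcomm_sq x p.
rewrite (opC _ p) hxx (opC x p) hx !opE in h.
have x3 : x ** (x ** x) = 0.
  by apply: (eq_of_scaled_diff (c := -2) h); rewrite (opC (x ** x)); linear_eq R.
apply: sq_eq0; apply: sq_eq0; rewrite -[X in X ** X]/(pw x 1) pwM /= x3 op0r //.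
Qed.

(** If [m < t], the powers of [t / m] outgrow [C] by the Bernoulli inequality. This removes the
    constant from estimates of iterated squares. *)
Lemma le_of_pow2 (t m C : R) : 0 <= t -> 0 <= m ->
  (forall n, t ^+ (2 ^ n) <= C * m ^+ (2 ^ n)) -> t <= m.
Proof.
move=> t0 m0 h; rewrite leNgt; apply/negP => mt.
have tp : 0 < t by exact: le_lt_trans mt.
have [me|mn] := eqVneq m 0.
  by have := h 0%N; rewrite expn0 !expr1 me mulr0 leNgt tp.
have mp : 0 < m by rewrite lt_neqAle eq_sym mn.
set d := t / m - 1; have d0 : 0 < d by rewrite subr_gt0 ltr_pdivlMr // mul1r.
have C0 : 0 <= C.
  have := h 0%N; rewrite expn0 !expr1 => h0.
  by rewrite -(pmulr_lge0 _ mp) (le_trans _ h0) // ltW.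
have bern n : 1 + n%:R * d <= (t / m) ^+ n.
  elim: n => [|n IH]; first by rewrite mul0r addr0 expr0.
  rewrite exprS; have -> : t / m = 1 + d by rewrite /d addrC subrK.
  apply: (@le_trans _ _ ((1 + d) * (1 + n%:R * d))); last first.
    apply: ler_wpM2l; first by rewrite addr_ge0 // ltW.
    by move: IH; have -> : t / m = 1 + d by rewrite /d addrC subrK.
  have n0 : 0 <= n%:R :> R by [].
  have : 0 <= n%:R * d * d by rewrite !mulr_ge0 // ltW.
  rewrite -natr1; nra.
have [n hn] : exists n : nat, C < n%:R * d.
  exists (Num.truncn (C / d)).+1; rewrite -ltr_pdivrMr //.
  exact: truncnS_gt.
have := h n; rewrite -ler_pdivrMr ?exprn_gt0 // -expr_div_n => h1.
have h2 := bern (2 ^ n)%N.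
have n2 : (n <= 2 ^ n)%N by exact/ltnW/ltn_expl.
have : n%:R * d <= (2 ^ n)%:R * d by apply: ler_wpM2r; [exact: ltW|rewrite ler_nat].
move: hn h1 h2; lra.
Qed.

Fixpoint sqiter x n := if n is m.+1 then sqiter x m ** sqiter x m else x.
Lemma norm_sqiter x n : `|sqiter x n| = `|x| ^+ (2 ^ n).
Proof.
elim: n => [|n IH]; first by rewrite expn0 expr1.
by rewrite /= norm_sq IH -exprM expnSr.
Qed.

(** Orthogonality makes iterated squaring additive on [x + y], so the norm to the power 2^n is at
    most twice that power of the maximum. The other inequality is the axiom bounding a square by a
    sum of squares. *)
Lemma norm_orth_max p x y : proj p -> p ** x = x -> p ** y = 0 ->
  `|x + y| = Num.max `|x| `|y|.
Proof.
move=> pp hx hy; apply/eqP; rewrite eq_le; apply/andP; split.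
  have m0 : 0 <= Num.max `|x| `|y| by rewrite le_max normr_ge0.
  apply: (@le_of_pow2 _ _ 2) => // n; rewrite -norm_sqiter.
  have : [/\ sqiter (x + y) n = sqiter x n + sqiter y n, p ** sqiter x n = sqiter x n
       & p ** sqiter y n = 0].
    elim: n => [//|n [IH h1 h0]] /=; split; [|exact: peirce11|exact: peirce00].
    rewrite IH !opE (opC (sqiter y n)) (peirce10 pp h1 h0); linear_eq R.
  case=> -> _ _; rewrite (le_trans (ler_normD _ _)) // !norm_sqiter mulr_natl mulr2n.
  by apply: lerD; rewrite lerXn2r ?nnegrE // ?normr_ge0 // le_max lexx ?orbT.
have e : (x + y) ** (x + y) = x ** x + y ** y.
  rewrite !opE (opC y x) (peirce10 pp hx hy); linear_eq R.
rewrite ge_max; apply/andP; split; rewrite -(@ler_pXn2r _ 2%N) ?nnegrE // -!norm_sq e.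
  exact: norm_sqD.
by rewrite addrC; exact: norm_sqD.
Qed.

End Peirce.

(** * Weak-star compactness of the ball of a dual space *)

Section DualBanach.
Variables (R : realType) (A : completeNormedModType R).
Variables (E : normedModType R) (T : A -> E -> R).
Hypothesis Tlin : forall (k : R) (a b : A) (e : E), T (k *: a + b) e = k * T a e + T b e.
Hypothesis Tlin2 : forall (a : A) (k : R) (e f : E), T a (k *: e + f) = k * T a e + T a f.
Hypothesis Tnorm : forall a : A, `|a| = sup [set `|T a e| | e in [set e : E | `|e| <= 1]].
Hypothesis Tsurj : forall f : E -> R,
  (forall (k : R) (e g : E), f (k *: e + g) = k * f e + f g) ->
  (exists M : R, forall e, `|f e| <= M * `|e|) -> exists a : A, T a = f.

(** Functionals on [E] with pointwise convergence: the weak-star topology, transported along [T]. *)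
Let X : topologicalType := prod_topology (fun _ : E => (R : topologicalType)).

Let T0 e : T 0 e = 0.
Proof. by have := Tlin 1 0 0 e; rewrite scaler0 addr0 mul1r => h; apply: (@addrI _ (T 0 e)); rewrite addr0. Qed.
Let T02 a : T a 0 = 0.
Proof. by have := Tlin2 a 1 0 0; rewrite scaler0 addr0 mul1r => h; apply: (@addrI _ (T a 0)); rewrite addr0. Qed.
Let TZ2 a k e : T a (k *: e) = k * T a e.
Proof. by have := Tlin2 a k e 0; rewrite T02 !addr0. Qed.
Let TB a b e : T (a - b) e = T a e - T b e.
Proof. by rewrite addrC -scaleN1r Tlin mulN1r addrC. Qed.

Let Tbound a e : `|T a e| <= `|a| * `|e|.
Proof.
have hs : has_sup [set `|T a e| | e in [set e : E | `|e| <= 1]].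
  (* [sup] is 0 by default on a set without supremum. Then [a] would be 0 and the set would be {0},
     which has one. *)
  apply: contrapT => ns; move: (Tnorm a); rewrite (sup_out ns) => /normr0_eq0 a0.
  apply: ns; rewrite a0; split; first by exists `|T 0 0|, 0 => //=; rewrite normr0.
  by exists 0 => _ [f _ <-]; rewrite T0 normr0.
have [->|e0] := eqVneq e 0; first by rewrite T02 !normr0 mulr0.
have ne : 0 < `|e| by rewrite normr_gt0.
have : `|T a (`|e|^-1 *: e)| <= `|a|.
  rewrite Tnorm; apply: sup_upper_bound => //; exists (`|e|^-1 *: e) => //=.
  by rewrite normrZ normfV normr_id mulVf ?gt_eqF.
by rewrite TZ2 normrM normfV normr_id ler_pdivrMl // mulrC.
Qed.

Let Tnorm_le a r : 0 <= r -> (forall e, `|T a e| <= r * `|e|) -> `|a| <= r.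
Proof.
move=> r0 h; rewrite Tnorm; apply: ge_sup; first by exists `|T a 0|, 0 => //=; rewrite normr0.
by move=> _ [e /= e1 <-]; rewrite (le_trans (h e)) // ler_piMr.
Qed.

Let Tinj a b : T a = T b -> a = b.
Proof.
move=> h; apply/eqP; rewrite -subr_eq0 -normr_le0; apply: Tnorm_le => // e.
by rewrite TB h subrr normr0 mul0r.
Qed.

Let ev_continuous (e : E) : continuous (fun f : X => f e : R).
Proof. exact: (@proj_continuous E (fun=> R)). Qed.

Let closed_ev_le (e : E) (c r : R) : closed [set f : X | `|f e - c| <= r].
Proof.
have -> : [set f : X | `|f e - c| <= r] = (fun f : X => f e : R) @^-1` [set` `[c - r, c + r]].
  by apply/seteqP; split=> f /=; rewrite in_itv /= ler_distl.
apply: closed_comp; last exact: itv_closed.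
by move=> f _; exact: ev_continuous.
Qed.

(** Banach-Alaoglu: the ball is the closed set of linear functions in a product of segments, which
    is compact by Tychonoff. *)
Lemma dual_ball_compact (r : R) : 0 <= r -> compact [set f : X | exists2 a, `|a| <= r & f = T a].
Proof.
move=> r0.
have -> : [set f : X | exists2 a, `|a| <= r & f = T a] =
  [set f : X | forall e, (f e : R) \in `[- (r * `|e|), r * `|e|]] `&`
  \bigcap_(i : R * E * E) [set f : X | f (i.1.1 *: i.1.2 + i.2) = i.1.1 * f i.1.2 + f i.2].
  apply/seteqP; split=> [f [a ar ->]|f [fb fl]].
    split=> [e|[[k e] g] _] /=; last exact: Tlin2.
    by rewrite in_itv /= -ler_norml (le_trans (Tbound _ _)) // ler_wpM2r.
  have [a Ta] : exists a, T a = f.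
    apply: Tsurj; first by move=> k e g; exact: (fl (k, e, g)).
    by exists r => e; have := fb e; rewrite /= in_itv /= -ler_norml.
  exists a => //; apply: Tnorm_le => // e; rewrite Ta.
  by have := fb e; rewrite /= in_itv /= -ler_norml.
apply: (@subclosed_compact _ _ [set f : X | forall e, (f e : R) \in `[- (r * `|e|), r * `|e|]]).
- apply: closedI.
    have -> : [set f : X | forall e, (f e : R) \in `[- (r * `|e|), r * `|e|]] =
      \bigcap_(e : E) [set f : X | `|f e - 0| <= r * `|e|].
      apply/seteqP; split=> f h e /=.
        by move=> _; have := h e; rewrite /= in_itv /= -ler_norml subr0.
      by rewrite in_itv /= -ler_norml; have := h e I; rewrite /= subr0.
    by apply: closed_bigI => e _; exact: closed_ev_le.
  apply: closed_bigI => -[[k e] g] _ /=.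
  move=> f clf /=; apply/eqP; rewrite -subr_eq0 -normr_le0.
  apply: (@le_of_le_addeps _ _ _ (2 + `|k|)) => d d0; rewrite add0r.
  have nb z : nbhs f [set h : X | `|(f z : R) - h z| < d].
    by have := @ev_continuous z f _ (nbhsx_ballx (f z : R) d d0); rewrite -ball_normE.
  have [h [/= hl [[h1 h2] h3]]] := clf _ (filterI (filterI (nb (k *: e + g)) (nb e)) (nb g)).
  have -> : f (k *: e + g) - (k * f e + f g) =
    (f (k *: e + g) - h (k *: e + g)) - k * (f e - h e) - (f g - h g) by rewrite hl; ring.
  rewrite (le_trans (ler_normB _ _)) // (_ : _ * d = (d + `|k| * d) + d); last by ring.
  apply: lerD; last exact: ltW.
  rewrite (le_trans (ler_normB _ _)) // lerD ?(ltW h1) // normrM ler_wpM2l //; exact: ltW.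
- exact: (@tychonoff E (fun _ => (R : topologicalType))
    (fun e x => x \in `[- (r * `|e|), r * `|e|]) (fun e => @segment_compact R _ _)).
- by move=> f [].
Qed.

Lemma dual_fip (I : eqType) (D : set I) (G : I -> set X) (r : R) : 0 <= r ->
  (forall i, D i -> closed (G i)) ->
  (forall s : seq I, (forall i, i \in s -> D i) ->
     exists2 a, `|a| <= r & forall i, i \in s -> G i (T a)) ->
  exists2 a, `|a| <= r & forall i, D i -> G i (T a).
Proof.
move=> r0 Gc h.
pose F : set_system X := fun S => exists2 s : seq I, (forall i, i \in s -> D i) &
  forall a, `|a| <= r -> (forall i, i \in s -> G i (T a)) -> S (T a).
have PF : ProperFilter F.
  split; first by case=> s /h[a ar sa] /(_ a ar sa).
  split.
  - by exists [::].
  - move=> S1 S2 [s1 D1 h1] [s2 D2 h2]; exists (s1 ++ s2).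
      by move=> i; rewrite mem_cat => /orP[/D1|/D2].
    move=> a ar ha; split; [apply: h1|apply: h2] => // i ii; apply: ha;
      by rewrite mem_cat ii ?orbT.
  - by move=> S1 S2 S12 [s D1 h1]; exists s => // a ar ha; exact/S12/h1.
have FK : F [set f : X | exists2 a, `|a| <= r & f = T a] by exists [::] => // a ar _; exists a.
have [f [[a ar fa] clf]] := dual_ball_compact r0 PF FK.
exists a => // i Di; rewrite -fa; apply: (Gc i Di) => N NN.
apply: clf => //; exists [:: i] => [j|b _ hb]; first by rewrite inE => /eqP ->.
by apply: hb; rewrite inE.
Qed.

(** Closed norm balls are weak-star closed, hence have the finite intersection property. In
    [dual_sup] the balls are order intervals. *)
Lemma dual_ball_fip (D : set (A * R)) : D !=set0 ->
  (forall s : seq (A * R), (forall i, i \in s -> D i) ->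
     exists a, forall i, i \in s -> `|a - i.1| <= i.2) ->
  exists a, forall i, D i -> `|a - i.1| <= i.2.
Proof.
move=> [i0 D0] h.
have bd a i : `|a - i.1| <= i.2 -> forall e, `|T a e - T i.1 e| <= i.2 * `|e|.
  by move=> ai e; rewrite -TB (le_trans (Tbound _ _)) // ler_wpM2r.
have r0 : 0 <= `|i0.1| + i0.2.
  have [|a ha] := h [:: i0]; first by move=> i; rewrite inE => /eqP ->.
  by rewrite addr_ge0 // (le_trans _ (ha i0 _)) // inE.
have [|s sD|a ar ha] := @dual_fip _ D
  (fun i => \bigcap_(e : E) [set f : X | `|f e - T i.1 e| <= i.2 * `|e|]) _ r0.
- by move=> i _; apply: closed_bigI => e _; exact: closed_ev_le.
- have [|a ha] := h (i0 :: s).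
    by move=> i; rewrite inE => /orP[/eqP ->//|/sD].
  exists a.
    rewrite -[a](subrK i0.1) addrC (le_trans (ler_normD _ _)) // lerD2l ha //.
    by rewrite inE eqxx.
  by move=> i si e _ /=; apply: bd; apply: ha; rewrite inE si orbT.
exists a => i Di; apply: Tnorm_le; last by move=> e; rewrite TB; exact: (ha i Di e I).
have [|b hb] := h [:: i]; first by move=> j; rewrite inE => /eqP ->.
by rewrite (le_trans _ (hb i _)) // inE.
Qed.

Let wclosed (S : set A) := exists2 G : set X, closed G & S = T @^-1` G.

Let face (F : set A) := [/\ F !=set0, F `<=` [set a | `|a| <= 1], wclosed F
  & forall x y, `|x| <= 1 -> `|y| <= 1 -> F (2^-1 *: (x + y)) -> F x /\ F y].

Let minimal_face : exists F, face F /\ forall G, face G -> G `<=` F -> G = F.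
Proof.
pose fT := {F : set A | face F}.
pose Rel (F G : fT) := `[< sval G `<=` sval F >].
have ball_face : face [set a | `|a| <= 1].
  split=> //; first by exists 0 => /=; rewrite normr0.
  exists (\bigcap_(e : E) [set f : X | `|f e - 0| <= 1 * `|e|]).
    by apply: closed_bigI => e _; exact: closed_ev_le.
  apply/seteqP; split=> a /=.
    by move=> a1 e _ /=; rewrite subr0 (le_trans (Tbound _ _)) // ler_wpM2r.
  by move=> h; apply: Tnorm_le => // e; have := h e I; rewrite /= subr0.
have [F hF] : exists F : fT, forall G, Rel F G -> G = F.
  apply: Zorn.
  - by move=> F; apply/asboolP.
  - by move=> F G H /asboolP h1 /asboolP h2; apply/asboolP; exact: subset_trans h1.
  - move=> [F hF] [G hG] /asboolP /= h1 /asboolP /= h2.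
    have e : F = G by apply/seteqP.
    by subst G; congr exist; exact: Prop_irrelevance.
  move=> C totC.
  have [C0|nC] := pselect (C !=set0); last first.
    by exists (exist _ _ ball_face) => F CF; case: nC; exists F.
  have fI : face (\bigcap_(F in C) sval F).
    split.
    - have wG (F : fT) : exists G : set X, closed G /\ sval F = T @^-1` G.
        by case: F => F /= [_ _ [G Gc FG] _]; exists G.
      pose G F := sval (cid (wG F)).
      have GE F : sval F = T @^-1` G F by rewrite /G; case: cid => /= ? [].
      have Gc F : closed (G F) by rewrite /G; case: cid => /= ? [].
      pose fE : eqType := {classic fT}.
      have [|s sC|a a1 ha] := @dual_fip fE C G 1 ler01.
      + by move=> F _; exact: Gc.
      + have [F CF hF] : exists2 F, C F & forall H, H \in s -> sval F `<=` sval H.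
          elim: s sC => [|H s IH] sC; first by case: C0 => F CF; exists F.
          have [|F CF hF] := IH; first by move=> i si; apply: sC; rewrite inE si orbT.
          have CH : C H by apply: sC; rewrite inE eqxx.
          have [/asboolP HF|/asboolP FH] := totC _ _ CH CF.
            by exists F => // K; rewrite inE => /orP[/eqP -> //|/hF].
          exists H => // K; rewrite inE => /orP[/eqP -> //|/hF]; exact: subset_trans.
        have [[a Fa] F1 _ _] := svalP F; exists a; first exact: F1.
        by move=> H /hF h; have := h _ Fa; rewrite GE.
      by exists a => F CF; rewrite GE; exact: ha.
    - by move=> a ha; case: C0 => F CF; have [_ F1 _ _] := svalP F; apply: F1; exact: (ha _ CF).
    - have wG (F : fT) : exists G : set X, closed G /\ sval F = T @^-1` G.
        by case: F => F /= [_ _ [G Gc FG] _]; exists G.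
      pose G F := sval (cid (wG F)).
      have GE F : sval F = T @^-1` G F by rewrite /G; case: cid => /= ? [].
      have Gc F : closed (G F) by rewrite /G; case: cid => /= ? [].
      exists (\bigcap_(F in C) G F); first by apply: closed_bigI => F _; exact: Gc.
      apply/seteqP; split=> a h F CF; first by have := h _ CF; rewrite GE.
      by rewrite GE; exact: h.
    - move=> x y x1 y1 h; split=> F CF; have := h F CF; have [_ _ _ hF] := svalP F;
      by move=> /(hF _ _ x1 y1)[].
  exists (exist _ _ fI) => F CF; apply/asboolP => /= a ha; exact: ha.
exists (sval F); split; first by case: F {hF}.
move=> G fG GF; exact: (congr1 sval (hF (exist _ G fG) (asboolT GF))).
Qed.

(** Krein-Milman: in a minimal weak-star closed face, the points where the evaluation at [z] is
    maximal form a face again, hence everything; so all evaluations are constant and the face is a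
    point. *)
Lemma dual_extreme_point : exists2 e : A, `|e| <= 1 &
  forall x, `|e + x| <= 1 -> `|e - x| <= 1 -> x = 0.
Proof.
have [F [[[e Fe] F1 [G Gc FG] hF] Fmin]] := minimal_face.
exists e; first exact: F1.
suff sing y : F y -> y = e.
  move=> x h1 h2; have [|Fex _] := hF _ _ h1 h2.
    have -> : 2^-1 *: (e + x + (e - x)) = e by linear_eq R.
    by [].
  by have /eqP := sing _ Fex; rewrite -subr_eq0 addrAC subrr add0r => /eqP.
move=> Fy; apply: Tinj; apply/funext => z.
pose V := [set T a z | a in F].
have Vb : has_sup V.
  split; first by exists (T e z), e.
  exists `|z| => _ [a Fa <-]; rewrite (le_trans (ler_norm _)) // (le_trans (Tbound _ _)) //.
  by rewrite ler_piMl // F1.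
pose F' := F `&` [set a | T a z = sup V].
suff F'F : F' = F.
  by move: Fy Fe; rewrite -F'F => -[_ ->] [_ ->].
apply: Fmin; last by move=> a [].
split.
(* The maximum is attained, as near-maximizers form closed sets with the finite intersection
   property. *)
- pose S (n : nat) : set X := [set f : X | `|f z - sup V| <= n.+1%:R^-1].
  have [|s _|a a1 ha] := @dual_fip nat setT (fun n => G `&` S n) 1 ler01.
  + by move=> n _; apply: closedI => //; exact: closed_ev_le.
  + pose m := \max_(i <- s) i.
    have [|_ [a Fa <-] ha] := @sup_adherent _ V m.+1%:R^-1 _ Vb; first by rewrite invr_gt0.
    exists a; first exact: F1.
    move=> n ns; split; first by move: Fa; rewrite FG.
    have aV : T a z <= sup V by apply: sup_upper_bound => //; exists a.
    rewrite /S /= distrC ger0_norm ?subr_ge0 // lerBlDr -lerBlDl (le_trans _ (ltW ha)) //.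
    rewrite lerB // lef_pV2 ?posrE // ler_nat ltnS.
    by rewrite /m; exact: leq_bigmax_seq.
  exists a; split; first by rewrite FG; case: (ha 0%N I).
  apply/eqP; rewrite -subr_eq0 -normr_le0; apply/ler_addgt0Pr => d d0; rewrite add0r.
  have [n hn] : exists n : nat, n.+1%:R^-1 <= d.
    exists (Num.truncn d^-1); rewrite -[leRHS]invrK lef_pV2 ?posrE ?invr_gt0 // ltW //.
    exact: truncnS_gt.
  by have [_ /=] := ha n I; move/le_trans; apply.
- by move=> a [/F1].
- exists (G `&` [set f : X | `|f z - sup V| <= 0]).
    by apply: closedI => //; exact: closed_ev_le.
  rewrite /F' FG; apply/seteqP; split=> a [Fa /=].
    by move=> h; split => //=; rewrite h subrr normr0.
  by rewrite normr_le0 subr_eq0 => /eqP h; split.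
- move=> u v u1 v1 [Fuv] /=; have -> : T (2^-1 *: (u + v)) z = 2^-1 * (T u z + T v z).
    by rewrite -[2^-1 *: _]addr0 Tlin T0 addr0 -{1}[u]scale1r Tlin mul1r.
  move=> huv.
  have [Fu Fv] := hF _ _ u1 v1 Fuv.
  have hu : T u z <= sup V by apply: sup_upper_bound => //; exists u.
  have hv : T v z <= sup V by apply: sup_upper_bound => //; exists v.
  by split; split => //=; lra.
Qed.

End DualBanach.

(** * Existence of the unit *)

Lemma cauchy_limit (R : realType) (V : completeNormedModType R) (u : nat -> V) (b : nat -> R) :
  (forall e, 0 < e -> exists n, b n < e) ->
  (forall n m, (n <= m)%N -> `|u m - u n| <= b n) -> exists l, forall n, `|l - u n| <= b n.
Proof.
move=> b0 ub; have cu : cvg (u @ \oo).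
  apply: cauchy_cvg; apply: cauchy_exP => e e0; have [n bn] := b0 _ e0.
  exists (u n); exists n => // k /= nk; rewrite -ball_normE /= distrC.
  exact: le_lt_trans (ub _ _ nk) bn.
exists (lim (u @ \oo)) => n; apply/ler_addgt0Pr => e e0.
have /cvgrPdist_lt/(_ _ e0) [N _ hN] := cu.
have := hN (maxn N n) (leq_maxl _ _) => /= h.
have -> : lim (u @ \oo) - u n = (u (maxn N n) - u n) + (lim (u @ \oo) - u (maxn N n)).
  by linear_eq R.
rewrite (le_trans (ler_normD _ _)) //.
by apply: lerD; [apply: ub; exact: leq_maxr|exact: ltW].
Qed.

(* An associative subalgebra with a formal unit adjoined, as a commutative ring:
   this makes [ring] available for computations inside the subalgebra. *)
Record asr (R : realType) (A : jbAlg R) (C : set A) (hC : is_AS (jb_op A) C) :=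
  Asr { ask : R; asc : A; ascP : C asc }.

Section AssociativeRing.
Variables (R : realType) (A : jbAlg R) (C : set A) (hC : is_AS (jb_op A) C).
Local Notation T := (asr hC).
Implicit Types X Y Z : T.

Lemma AS0 : C 0. Proof. by case: hC. Qed.
Lemma ASD x y : C x -> C y -> C (x + y).
Proof. by case: hC => _ h _ _ _ Cx Cy; rewrite -[x]scale1r; exact: h. Qed.
Lemma ASZ k x : C x -> C (k *: x).
Proof. by case: hC => h0 h _ _ _ Cx; rewrite -[_ *: _]addr0; exact: h. Qed.
Lemma ASN x : C x -> C (- x).
Proof. by rewrite -scaleN1r; exact: ASZ. Qed.
Lemma ASB x y : C x -> C y -> C (x - y).
Proof. by move=> Cx Cy; apply: ASD => //; exact: ASN. Qed.
Lemma ASM x y : C x -> C y -> C (x ** y).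
Proof. by case: hC => _ _ h _ _; exact: h. Qed.
Lemma ASA x y z : C x -> C y -> C z -> x ** y ** z = x ** (y ** z).
Proof. by case: hC => _ _ _ _ h; exact: h. Qed.
Lemma ASclosed : closed C. Proof. by case: hC. Qed.
Lemma ASlim x : (forall e, 0 < e -> exists2 y, C y & `|x - y| < e) -> C x.
Proof. by have := ASclosed => /closed_normP h; exact: h. Qed.

HB.instance Definition _ := gen_eqMixin T.
HB.instance Definition _ := gen_choiceMixin T.

Lemma asr_eq X Y : ask X = ask Y -> asc X = asc Y -> X = Y.
Proof.
case: X Y => [k x Cx] [l y Cy] /= kl xy; subst l y; congr Asr; exact: Prop_irrelevance.
Qed.

Definition asr0 : T := Asr hC 0 AS0.
Definition asr1 : T := Asr hC 1 AS0.
Definition asrD X Y : T := Asr hC (ask X + ask Y) (ASD (ascP X) (ascP Y)).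
Definition asrN X : T := Asr hC (- ask X) (ASN (ascP X)).
Definition asrM X Y : T := Asr hC (ask X * ask Y)
  (ASD (ASD (ASZ (ask X) (ascP Y)) (ASZ (ask Y) (ascP X))) (ASM (ascP X) (ascP Y))).

Fact asrDA : associative asrD.
Proof. by move=> X Y Z; apply: asr_eq => /=; rewrite addrA. Qed.
Fact asrDC : commutative asrD.
Proof. by move=> X Y; apply: asr_eq => /=; rewrite addrC. Qed.
Fact asr0D : left_id asr0 asrD.
Proof. by move=> X; apply: asr_eq => /=; rewrite add0r. Qed.
Fact asrND : left_inverse asr0 asrN asrD.
Proof. by move=> X; apply: asr_eq => /=; rewrite addNr. Qed.
HB.instance Definition _ := GRing.isZmodule.Build T asrDA asrDC asr0D asrND.

Fact asrMA : associative asrM.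
Proof.
move=> X Y Z; apply: asr_eq => /=; first by rewrite mulrA.
rewrite !opE (ASA (ascP X) (ascP Y) (ascP Z)); linear_eq R.
Qed.
Fact asrMC : commutative asrM.
Proof.
by move=> X Y; apply: asr_eq => /=; [rewrite mulrC|rewrite (opC (asc X)) [_ *: _ + _]addrC].
Qed.
Fact asr1M : left_id asr1 asrM.
Proof. by move=> X; apply: asr_eq => /=; rewrite ?mul1r // !opE; linear_eq R. Qed.
Fact asrMDl : left_distributive asrM asrD.
Proof.
by move=> X Y Z; apply: asr_eq => /=; [rewrite mulrDl|rewrite !opE; linear_eq R].
Qed.
Fact asr10 : asr1 != asr0.
Proof. by apply/eqP => /(congr1 (@ask _ _ _ _)) /eqP; rewrite /= oner_eq0. Qed.
HB.instance Definition _ := GRing.Zmodule_isComNzRing.Build T asrMA asrMC asr1M asrMDl asr10.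

Definition asin x (Cx : C x) : T := Asr hC 0 Cx.
Definition asscal (k : R) : T := Asr hC k AS0.

Lemma asc_asin x (Cx : C x) : asc (asin Cx) = x. Proof. by []. Qed.
Lemma asc0 : asc (0 : T) = 0. Proof. by []. Qed.
Lemma asc1 : asc (1 : T) = 0. Proof. by []. Qed.
Lemma ascD X Y : asc (X + Y) = asc X + asc Y. Proof. by []. Qed.
Lemma ascN X : asc (- X) = - asc X. Proof. by []. Qed.
Lemma ascM X Y : asc (X * Y) = ask X *: asc Y + ask Y *: asc X + asc X ** asc Y.
Proof. by []. Qed.
Lemma ask_asin x (Cx : C x) : ask (asin Cx) = 0. Proof. by []. Qed.
Lemma ask0 : ask (0 : T) = 0. Proof. by []. Qed.
Lemma ask1 : ask (1 : T) = 1. Proof. by []. Qed.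
Lemma askD X Y : ask (X + Y) = ask X + ask Y. Proof. by []. Qed.
Lemma askN X : ask (- X) = - ask X. Proof. by []. Qed.
Lemma askM X Y : ask (X * Y) = ask X * ask Y. Proof. by []. Qed.
Lemma asinE X : ask X = 0 -> X = asin (ascP X).
Proof. by move=> h; apply: asr_eq. Qed.
Lemma asscalD k l : asscal (k + l) = asscal k + asscal l.
Proof. by apply: asr_eq => //=; rewrite addr0. Qed.
Lemma asscalM k l : asscal (k * l) = asscal k * asscal l.
Proof. by apply: asr_eq => //=; rewrite !opE; linear_eq R. Qed.
Lemma asscal1 : asscal 1 = 1. Proof. exact: asr_eq. Qed.
Lemma asscalN k : asscal (- k) = - asscal k.
Proof. by apply: asr_eq => //=; rewrite oppr0. Qed.
Lemma asc_asscal k : asc (asscal k) = 0. Proof. by []. Qed.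
Lemma ask_asscal k : ask (asscal k) = k. Proof. by []. Qed.

End AssociativeRing.

Definition ascE := (ascD, ascN, ascM, asc_asin, asc0, asc1, asc_asscal, askD, askN, askM,
  ask_asin, ask0, ask1, ask_asscal).

Lemma expr_small (R : realType) (s e : R) : 0 <= s -> s < 1 -> 0 < e -> exists n, s ^+ n < e.
Proof.
move=> s0 s1 e0; have /cvgrPdist_lt/(_ _ e0) [N _ hN] : (fun n => s ^+ n) @ \oo --> (0 : R).
  by apply: cvg_expr; rewrite ger0_norm.
exists N; have := hN N (leqnn N) => /=.
by rewrite sub0r normrN ger0_norm // exprn_ge0.
Qed.

(** Two consecutive terms are controlled together so that a recursion for [u n.+1] in terms of [u n]
    passes to the limit. *)
Lemma geometric_limit (R : realType) (V : completeNormedModType R) (u : nat -> V) (s : R) :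
  0 <= s -> s < 1 -> (forall n, `|u n.+1 - u n| <= s ^+ n) ->
  exists y, forall e, 0 < e -> exists2 n, `|y - u n| < e & `|y - u n.+1| < e.
Proof.
move=> s0 s1 du.
have du2 n m : (n <= m)%N -> `|u m - u n| <= s ^+ n / (1 - s).
  move=> nm; rewrite ler_pdivlMr ?subr_gt0 //.
  suff : `|u m - u n| * (1 - s) <= s ^+ n - s ^+ m.
    by move=> h; rewrite (le_trans h) // lerBlDr lerDl exprn_ge0.
  elim: m nm => [|m IH]; first by rewrite leqn0 => /eqP ->; rewrite subrr normr0 mul0r subrr.
  rewrite leq_eqVlt => /orP[/eqP ->|nm]; first by rewrite subrr normr0 mul0r subrr.
  have h := IH nm; have e : u m.+1 - u n = (u m.+1 - u m) + (u m - u n) by linear_eq R.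
  apply: (@le_trans _ _ ((`|u m.+1 - u m| + `|u m - u n|) * (1 - s))).
    by rewrite ler_wpM2r ?subr_ge0 ?(ltW s1) // e ler_normD.
  have h2 : `|u m.+1 - u m| * (1 - s) <= s ^+ m * (1 - s).
    by rewrite ler_wpM2r ?subr_ge0 ?(ltW s1).
  rewrite exprS; move: h h2; set a := `|_|; set b := `|_|; nra.
have b0 e : 0 < e -> exists n, s ^+ n / (1 - s) < e.
  move=> e0; have [|n hn] := @expr_small R s (e * (1 - s)) s0 s1.
    by rewrite mulr_gt0 // subr_gt0.
  by exists n; rewrite ltr_pdivrMr // subr_gt0.
have [y hy] := cauchy_limit b0 du2.
exists y => e e0; have [n hn] := b0 _ e0; exists n; first exact: le_lt_trans (hy n) hn.
apply: le_lt_trans (hy _) _; apply: le_lt_trans hn.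
by rewrite ler_wpM2r ?invr_ge0 ?subr_ge0 ?(ltW s1) // exprS ler_piMl ?exprn_ge0 // ltW.
Qed.

Section QuasiSquareRoot.
Variables (R : realType) (A : jbAlg R).
Implicit Types (x y z : A).

(* [(1-y)^2 = 1-x], stated without a unit; [y] is the fixed point of [y |-> (x+y^2)/2]. *)
Lemma quasi_sqrt (C : set A) x : is_AS (jb_op A) C -> C x -> `|x| < 1 ->
  exists y, [/\ C y, 2 *: y - y ** y = x & `|y| <= (1 + `|x|) / 2].
Proof.
move=> hC Cx x1.
have [u [u0 uS]] : exists u : nat -> A, u 0%N = 0 /\ forall n, u n.+1 = 2^-1 *: (x + u n ** u n).
  by exists (fun n => iter n (fun y => 2^-1 *: (x + y ** y)) 0).
(* As s ^+ 2 <= 1, the iteration maps the ball of radius [s] into itself; there it contracts with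
   factor [s]. *)
pose s := (1 + `|x|) / 2; have s0 : 0 <= s by rewrite divr_ge0 // addr_ge0.
have s1 : s < 1 by rewrite /s; lra.
have us n : `|u n| <= s.
  elim: n => [|n IH]; first by rewrite u0 normr0.
  rewrite uS normrZ ger0_norm ?invr_ge0 //.
  have h : `|x + u n ** u n| <= `|x| + s ^+ 2.
    rewrite (le_trans (ler_normD _ _)) // lerD2l norm_sq lerXn2r ?nnegrE //.
  have x0 : 0 <= `|x| by [].
  have : s ^+ 2 <= 1 by rewrite expr_le1 // ltW.
  move: h; rewrite /s; set t := `|x + _|; lra.
have Cu n : C (u n).
  elim: n => [|n IH]; first by rewrite u0; exact: AS0 hC.
  by rewrite uS; apply: ASZ => //; apply: ASD => //; exact: ASM.
have du n : `|u n.+1 - u n| <= s ^+ n.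
  elim: n => [|n IH]; first by rewrite u0 subr0 expr0 (le_trans (us 1%N)) // ltW.
  have -> : u n.+2 - u n.+1 = 2^-1 *: ((u n.+1 - u n) ** (u n.+1 + u n)).
    have h := uS n; rewrite (uS n.+1) !opE (opC (u n) (u n.+1)); linear_from R h.
  rewrite normrZ ger0_norm ?invr_ge0 // ler_pdivrMl // (le_trans (op_norm _ _)) //.
  rewrite mulrC exprS mulrA ler_pM // (le_trans (ler_normD _ _)) // mulrDl mul1r lerD //.
have [y hy] := geometric_limit s0 s1 du.
have Cy : C y.
  by apply: (ASlim hC) => e e0; have [n hn _] := hy _ e0; exists (u n).
exists y; split => //; last first.
  apply/ler_addgt0Pr => e e0; have [n hn _] := hy _ e0.
  by rewrite -(subrK (u n) y) addrC (le_trans (ler_normD _ _)) // lerD // ltW.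
apply/eqP; rewrite -subr_eq0 -normr_le0.
apply: (@le_of_le_addeps _ _ _ (4 + `|y|)) => e e0; rewrite add0r.
have [n /ltW hn1 /ltW hn2] := hy _ e0.
have -> : 2 *: y - y ** y - x = 2 *: (y - u n.+1) - (y ** y - u n ** u n).
  by rewrite uS; linear_eq R.
rewrite (le_trans (ler_normB _ _)) // normrZ ger0_norm //.
have := op_normB y y (u n) (u n); have := us n.
move: (normr_ge0 y) (normr_ge0 (u n)) (normr_ge0 (y - u n)); nra.
Qed.
End QuasiSquareRoot.

Section QuasiInverse.
Variables (R : realType) (A : jbAlg R).

(* [(1-x)(1+y) = 1], stated without a unit. *)
Lemma quasi_inv (C : set A) x : is_AS (jb_op A) C -> C x -> `|x| < 1 ->
  exists2 y, C y & y = x + x ** y.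
Proof.
move=> hC Cx x1.
have [u [u0 uS]] : exists u : nat -> A, u 0%N = x /\ forall n, u n.+1 = x + x ** u n.
  by exists (fun n => iter n (fun y => x + x ** y) x).
set s := `|x|; have s0 : 0 <= s by exact: normr_ge0.
have Cu n : C (u n).
  by elim: n => [|n IH]; rewrite ?u0 ?uS //; apply: (ASD hC) => //; apply: (ASM hC).
have du n : `|u n.+1 - u n| <= s ^+ n.
  elim: n => [|n IH].
    rewrite uS u0 addrAC subrr add0r norm_sq expr0 expr_le1 //; exact: ltW.
  have -> : u n.+2 - u n.+1 = x ** (u n.+1 - u n).
    by have h := uS n; rewrite (uS n.+1) !opE; linear_from R h.
  by rewrite (le_trans (op_norm _ _)) // exprS ler_wpM2l.
have [y hy] := geometric_limit s0 x1 du.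
have Cy : C y.
  by apply: (ASlim hC) => e e0; have [n hn _] := hy _ e0; exists (u n).
exists y => //; apply/eqP; rewrite -subr_eq0 -normr_le0.
apply: (@le_of_le_addeps _ _ _ 2) => e e0; rewrite add0r.
have [n /ltW hn1 /ltW hn2] := hy _ e0.
have -> : y - (x + x ** y) = (y - u n.+1) - x ** (y - u n).
  by rewrite uS !opE; linear_eq R.
rewrite (le_trans (ler_normB _ _)) //.
have h1 : `|x ** (y - u n)| <= e.
  by rewrite (le_trans (op_norm _ _)) // (le_trans _ hn1) // ler_piMl // ltW.
by rewrite mulr_natl mulr2n lerD.
Qed.
End QuasiInverse.

Section Unit.
Variables (R : realType) (A : jbAlg R).
Implicit Types (x y z e p : A).

(* With [r = (3e - e^3)/2] one has [1 - r^2 = ((1 - e^2)(1 - y))^2] when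
   [(1-y)^2 = 1 - e^2/4], so multiplication by [r] is contractive near [e]. *)
Lemma norm_cubic e : `|e| <= 1 -> `|3/2 *: e - 2^-1 *: (e ** (e ** e))| <= 1.
Proof.
move=> e1; have hC := gen_AS e; have Ce := gen_id e.
have Ce2 : gen e (e ** e) by apply: (ASM hC).
have Cx : gen e (4^-1 *: (e ** e)) by apply: (ASZ hC).
have [|y [Cy hy _]] := quasi_sqrt hC Cx.
  rewrite normrZ ger0_norm ?invr_ge0 // norm_sq.
  have : `|e| ^+ 2 <= 1 by rewrite expr_le1.
  lra.
pose r := 3/2 *: e - 2^-1 *: (e ** (e ** e)).
have Cr : gen e r by apply: (ASB hC); apply: (ASZ hC) => //; apply: (ASM hC).
have key z : gen e z -> `|r ** z| <= `|z|.
  move=> Cz; pose E := asin hC Ce; pose Y := asin hC Cy; pose Z := asin hC Cz.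
  pose Rr := asin hC Cr; pose H := asscal hC 2^-1.
  have H2 : H + H = 1 by rewrite -asscalD (_ : 2^-1 + 2^-1 = 1) ?asscal1 //; lra.
  have hY : 2%:R * Y - Y * Y = H * H * E * E.
    apply: asr_eq; rewrite !ascE /=; first by ring.
    by move: hy; rewrite !opE => hy; linear_from R hy.
  have hR : Rr = H * (3%:R * E - E * (E * E)).
    by apply: asr_eq; rewrite !ascE /=; [ring|rewrite !opE /r; linear_eq R].
  pose U := (1 - E * E) * (1 - Y) * Z.
  have hU : Rr * Z * (Rr * Z) + U * U = Z * Z.
    rewrite hR /U.
    have -> : (1 - E * E) * (1 - Y) * Z * ((1 - E * E) * (1 - Y) * Z) =
       (1 - E * E) * (1 - E * E) * (1 - (2%:R * Y - Y * Y)) * Z * Z by ring.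
    rewrite hY.
    have H4 : 4%:R * (H * H) - 1 = 0.
      have -> : 4%:R * (H * H) = (H + H) * (H + H) by ring.
      by rewrite H2 mulr1 subrr.
    transitivity (Z * Z + (4%:R * (H * H) - 1) * (2%:R * E * E - E * E * E * E) * Z * Z); first by ring.
    by rewrite H4 !mul0r addr0.
  have := congr1 (@asc _ _ _ _) hU; rewrite (asinE (X := U)) ?ascE; last by rewrite /= !(mulr0, mul0r).
  rewrite /= !(mulr0, mul0r, scale0r, add0r) => h.
  rewrite -(@ler_pXn2r _ 2%N) ?nnegrE // -!norm_sq -h; exact: norm_sqD.
have h := key r Cr; rewrite norm_sq in h.
rewrite -/r; have [->//|r0] := eqVneq `|r| 0.
have rp : 0 < `|r| by rewrite lt_neqAle eq_sym r0 normr_ge0.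
by move: h; rewrite expr2 ger_pMl.
Qed.

(** Let [e] be an extreme point of the ball. By [norm_cubic] it is the midpoint of two points of the
    ball that differ by the multiple 1 of e - e^3, so e^3 = e and p = e^2 is a projection. A small
    [y] in the Peirce 0-space of [p] has both [e + y] and [e - y] in the ball by [norm_orth_max], so
    that space is 0; then the half space is 0 by [half_sq1_eq0]. *)
Lemma jb_unit : dual_Banach A -> exists e, forall x, e ** x = x.
Proof.
move=> [E [T [Tl Tl2 Tn Ts]]].
have [e e1 ext] := dual_extreme_point Tl Tl2 Tn Ts.
have e3 : e ** (e ** e) = e.
  have h := ext (2^-1 *: (e - e ** (e ** e))).
  suff x0 : 2^-1 *: (e - e ** (e ** e)) = 0 by linear_from R x0.
  apply: h.
    have -> : e + 2^-1 *: (e - e ** (e ** e)) = 3/2 *: e - 2^-1 *: (e ** (e ** e)) by linear_eq R.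
    exact: norm_cubic.
  have -> : e - 2^-1 *: (e - e ** (e ** e)) = 2^-1 *: e + 2^-1 *: (e ** (e ** e)) by linear_eq R.
  rewrite (le_trans (ler_normD _ _)) // !normrZ ger0_norm ?invr_ge0 //.
  have h2 : `|e ** (e ** e)| <= 1.
    by rewrite (le_trans (op_norm _ _)) // norm_sq mulr_ile1 // expr_le1.
  lra.
pose p := e ** e; have pp : proj p.
  by rewrite /proj /p; have := pwM e 1 1 => /= ->; rewrite e3.
have pe : p ** e = e by rewrite opC.
have A0 y : p ** y = 0 -> y = 0.
  move=> py; have c0 : 0 < 1 + `|y| by rewrite ltr_pwDl.
  suff h : (1 + `|y|)^-1 *: y = 0.
    by move/eqP: h; rewrite scaler_eq0 invr_eq0 gt_eqF // => /eqP.
  have n1 : `|(1 + `|y|)^-1 *: y| <= 1.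
    by rewrite normrZ normfV gtr0_norm // ler_pdivrMl // mulr1 lerDr.
  apply: ext; rewrite (norm_orth_max pp) ?opE ?py ?scaler0 ?oppr0 //.
    by rewrite ge_max e1.
  by rewrite normrN ge_max e1.
have Ah x : p ** x = 2^-1 *: x -> x = 0.
  move=> hx; apply: (half_sq1_eq0 pp hx).
  have h0 : peirce0 p (x ** x) = 0 by apply: A0; exact: peirce0P.
  have hh : peirceh p (x ** x) = 0 by exact: (peircehh pp hx hx).
  by rewrite (peirce_sum p (x ** x)) h0 hh !addr0 peirce1P.
exists p => x; rewrite (peirce_sum p x).
rewrite (A0 (peirce0 p x)) ?peirce0P // (Ah (peirceh p x)) ?peircehP // !addr0.
exact: peirce1P.
Qed.

End Unit.


(** * The order *)

Record jbuAlg (R : realType) := JbuAlg {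
  jbu_jb :> jbAlg R;
  jbu_one : jbu_jb;
  jbu_oneP : forall x, jbu_one ** x = x }.
Notation "\one" := (jbu_one _).

Section Order.
Variables (R : realType) (A : jbuAlg R).
Implicit Types (a b c x y z p q : A) (k l : R) (C : set A).

Lemma op1l x : \one ** x = x. Proof. exact: jbu_oneP. Qed.
Lemma op1r x : x ** \one = x. Proof. by rewrite opC op1l. Qed.

Lemma norm_one : `|\one : A| <= 1.
Proof.
have := norm_sq (\one : A); rewrite op1l => h.
have [->//|n0] := eqVneq `|\one : A| 0.
have p0 : 0 < `|\one : A| by rewrite lt_neqAle eq_sym n0 normr_ge0.
by move: h; rewrite expr2 => h; rewrite -(ger_pMl _ p0) -h.
Qed.

(** Positivity in terms of the norm, which makes the set visibly a convex cone; [pos_sq] and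
    [pos_sqrt] identify it with the set of squares. *)
Definition pos a := exists l, `|l *: \one - a| <= l.
Definition jle a b := pos (b - a).
Local Notation "x <== y" := (jle x y) (at level 70).

Lemma posD a b : pos a -> pos b -> pos (a + b).
Proof.
move=> [k ka] [l lb]; exists (k + l).
have -> : (k + l) *: \one - (a + b) = (k *: \one - a) + (l *: \one - b) by linear_eq R.
by rewrite (le_trans (ler_normD _ _)) // lerD.
Qed.
Lemma posZ k a : 0 <= k -> pos a -> pos (k *: a).
Proof.
move=> k0 [l la]; exists (k * l); rewrite -scalerA -scalerBr normrZ ger0_norm //.
exact: ler_wpM2l.
Qed.
Lemma pos0 : pos 0.
Proof. by exists 0; rewrite scale0r subrr normr0. Qed.
Lemma pos1 : pos \one.
Proof. by exists 1; rewrite scale1r subrr normr0. Qed.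
Lemma posk k : 0 <= k -> pos (k *: \one).
Proof. by move=> k0; apply: posZ => //; exact: pos1. Qed.
Lemma pos_norm k a : `|a| <= k -> pos (k *: \one - a).
Proof. by exists k; rewrite (_ : _ - _ = a) //; linear_eq R. Qed.
Lemma jle_refl a : a <== a. Proof. by rewrite /jle subrr; exact: pos0. Qed.
Lemma jle_trans b a c : a <== b -> b <== c -> a <== c.
Proof. by move=> h1 h2; have := posD h2 h1; rewrite addrA subrK. Qed.
Lemma jleD a b c d : a <== b -> c <== d -> a + c <== b + d.
Proof.
move=> h1 h2; have := posD h1 h2; rewrite /jle.
by have -> : b - a + (d - c) = b + d - (a + c) by linear_eq R.
Qed.
Lemma jleZ k a b : 0 <= k -> a <== b -> k *: a <== k *: b.
Proof. by move=> k0 /(posZ k0); rewrite scalerBr. Qed.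
Lemma jleN a b : a <== b -> - b <== - a.
Proof. by rewrite /jle; have -> : - a - - b = b - a by linear_eq R. Qed.
Lemma jle0 a : 0 <== a <-> pos a. Proof. by rewrite /jle subr0. Qed.
Lemma jle_norm a : a <== `|a| *: \one.
Proof. exact: pos_norm. Qed.
Lemma jle_normN a : - (`|a| *: \one) <== a.
Proof. by have := jleN (jle_norm (- a)); rewrite normrN opprK. Qed.
Lemma pos_eps_sqrt C a e : is_AS (jb_op A) C -> C \one -> C a -> pos a -> 0 < e ->
  exists2 w, C w /\ pos w & w ** w = a + e *: \one.
Proof.
move=> hC C1 Ca [l la] e0; have l0 : 0 <= l by rewrite (le_trans _ la).
have le0 : 0 < l + e by rewrite ltr_wpDl.
have Cx : C ((l + e)^-1 *: (l *: \one - a)).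
  by apply: (ASZ hC); apply: (ASB hC) => //; apply: (ASZ hC).
have x1 : `|(l + e)^-1 *: (l *: \one - a)| < 1.
  rewrite normrZ gtr0_norm ?invr_gt0 // ltr_pdivrMl // mulr1.
  by rewrite (le_lt_trans la) // ltrDl.
have [y [Cy hy ny]] := quasi_sqrt hC Cx x1.
have y1 : `|y| <= 1 by move: x1 ny; set t := `|_ *: _|; lra.
exists (Num.sqrt (l + e) *: (\one - y)).
  split; first by apply: (ASZ hC); apply: (ASB hC).
  by apply: posZ; [exact: sqrtr_ge0|rewrite -[\one]scale1r; exact: pos_norm].
rewrite opZl opZr scalerA -expr2 sqr_sqrtr ?ltW //.
have -> : (\one - y) ** (\one - y) = \one - (2 *: y - y ** y) by rewrite !(opE, op1l, op1r); linear_eq R.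
rewrite hy scalerBr scalerA mulfV ?gt_eqF // ; linear_eq R.
Qed.

(** For b^2 of norm below 1 write 1 - b^2 = (1 - y)^2. The axiom on sums of squares bounds the norm
    of (1 - y)^2 by that of (1 - y)^2 + b^2 = 1. *)
Lemma pos_sq a : pos (a ** a).
Proof.
pose k := `|a| + 1; have k0 : 0 < k by rewrite ltr_wpDl.
pose b := k^-1 *: a.
have ab : a ** a = (k * k) *: (b ** b).
  rewrite /b opZl opZr !scalerA -[LHS]scale1r; congr (_ *: _); field; by rewrite gt_eqF.
have b1 : `|b ** b| < 1.
  rewrite norm_sq expr_lt1 // /b normrZ gtr0_norm ?invr_gt0 // ltr_pdivrMl // mulr1.
  by rewrite /k ltrDl.
rewrite ab; apply: posZ; first by rewrite mulr_ge0 // ltW.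
move: b ab b1 => b _ b1.
have [y [_ hy _]] := quasi_sqrt (gen_AS (b ** b)) (gen_id (b ** b)) b1.
have e : (\one - y) ** (\one - y) + b ** b = \one.
  by rewrite !(opBl, opBr, op1l, op1r); linear_from R hy.
exists 1; rewrite scale1r -e addrK (le_trans (norm_sqD _ b)) // e; exact: norm_one.
Qed.

(* Contains the unit, unlike [gen a]. *)
Definition geno a : set A := closure (lspan ([set \one] `|` range (pw a))).

Lemma geno_AS a : is_AS (jb_op A) (geno a).
Proof.
apply: AS_closure_lspan.
- move=> x y [->|[m _ <-]] [->|[n _ <-]]; rewrite ?op1l ?op1r; first by left.
  + by right; exists n.
  + by right; exists m.
  + by right; exists (m + n).+1; rewrite ?pwM.
- move=> x y [->|[m _ <-]] [->|[n _ <-]] z; rewrite ?op1l //.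
  exact: lcomm_pw2.
Qed.
Lemma geno1 a : geno a \one.
Proof. by apply: subset_closure; apply: lspan_gen; left. Qed.
Lemma geno_id a : geno a a.
Proof. by apply: subset_closure; apply: lspan_gen; right; exists 0%N. Qed.
Arguments geno1 : clear implicits.
Arguments geno_id : clear implicits.
Arguments geno_AS : clear implicits.

Lemma geno_min C a : is_AS (jb_op A) C -> C \one -> C a -> geno a `<=` C.
Proof.
move=> hC C1 Ca y /closure_normP h; apply: (ASlim hC) => e e0.
have [z Sz yz] := h e e0; exists z => //.
elim: Sz => [|k u v [->|[n _ <-]] _ IH]; first exact: AS0 hC.
  by apply: (ASD hC) => //; apply: (ASZ hC).
apply: (ASD hC) => //; apply: (ASZ hC).
by elim: n => //= n IHn; apply: (ASM hC).
Qed.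

Lemma ASACA C x y z w : is_AS (jb_op A) C -> C x -> C y -> C z -> C w ->
  (x ** y) ** (z ** w) = (x ** z) ** (y ** w).
Proof.
move=> hC Cx Cy Cz Cw; rewrite (ASA hC) //; last exact: (ASM hC).
rewrite -(ASA hC Cy) // (opC y z) (ASA hC Cz) // -(ASA hC Cx) //; exact: (ASM hC).
Qed.

Lemma pos_eps_mul C a b e d : is_AS (jb_op A) C -> C \one -> C a -> C b -> pos a -> pos b ->
  0 < e -> 0 < d ->
  exists2 w, C w & w ** w = (a + e *: \one) ** (b + d *: \one).
Proof.
move=> hC C1 Ca Cb pa pb e0 d0.
have [u [Cu _] <-] := pos_eps_sqrt hC C1 Ca pa e0.
have [v [Cv _] <-] := pos_eps_sqrt hC C1 Cb pb d0.
by exists (u ** v); [exact: (ASM hC)|rewrite (ASACA hC)].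
Qed.

(** The product (1 - a + e)(1 + a + e) = (1 + e)^2 - a^2 is a square, so the axiom on sums of
    squares bounds the norm of a^2 by (1 + e)^2. *)
Lemma norm_le_one a : - \one <== a -> a <== \one -> `|a| <= 1.
Proof.
move=> h1 h2; apply/ler_addgt0Pr => e e0.
have hC := geno_AS a; have C1 := geno1 a; have Ca := geno_id a.
have h3 : pos (a + \one) by move: h1; rewrite /jle opprK.
have [w _ hw] := pos_eps_mul hC C1 (ASB hC C1 Ca) (ASD hC Ca C1) h2 h3 e0 e0.
have e1 : 0 <= 1 + e by rewrite addr_ge0 // ltW.
rewrite -(@ler_pXn2r _ 2%N) ?nnegrE // -norm_sq.
rewrite (le_trans (norm_sqD _ w)) //.
have -> : a ** a + w ** w = ((1 + e) ^+ 2) *: \one.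
  by rewrite hw !(opE, op1l, op1r); linear_eq R.
by rewrite normrZ ger0_norm ?sqr_ge0 // ler_piMr ?sqr_ge0 // norm_one.
Qed.

Lemma norm_le k a : 0 <= k -> - (k *: \one) <== a -> a <== k *: \one -> `|a| <= k.
Proof.
move=> k0 h1 h2; apply/ler_addgt0Pr => e e0.
have ke : 0 < k + e by rewrite ltr_wpDl.
rewrite -[k + e]mulr1 -ler_pdivrMl //.
have -> : (k + e)^-1 * `|a| = `|(k + e)^-1 *: a| by rewrite normrZ gtr0_norm ?invr_gt0.
have kk : k *: (\one : A) <== (k + e) *: \one.
  by rewrite /jle -scalerBl (_ : k + e - k = e); [exact/posk/ltW|lra].
apply: norm_le_one.
  have := jleZ (ltW (_ : 0 < (k + e)^-1)) (jle_trans (jleN kk) h1).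
  by rewrite invr_gt0 => /(_ ke); rewrite scalerN scalerA mulVf ?gt_eqF // scale1r.
have := jleZ (ltW (_ : 0 < (k + e)^-1)) (jle_trans h2 kk).
by rewrite invr_gt0 => /(_ ke); rewrite scalerA mulVf ?gt_eqF // scale1r.
Qed.

(** One witness fits all elements of bounded norm, which makes the cone closed ([pos_lim]). *)
Lemma pos_normP k a : `|a| <= k -> pos a <-> `|k *: \one - a| <= k.
Proof.
move=> ak; split=> [pa|]; last by exists k.
have k0 : 0 <= k by exact: le_trans ak.
apply: norm_le => //; rewrite /jle.
  by have := posD (pos_norm ak) (posk k0); congr pos; linear_eq R.
by have := pa; congr pos; linear_eq R.
Qed.

Lemma pos_lim a : (forall e, 0 < e -> exists2 b, pos b & `|a - b| <= e) -> pos a.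
Proof.
move=> h; exists (`|a| + 1); apply/(@le_of_le_addeps _ _ _ 1) => e e0.
have [b pb ab] : exists2 b, pos b & `|a - b| <= Num.min e 1.
  by apply: h; rewrite lt_min e0 ltr01.
have /andP[abe ab1] : (`|a - b| <= e) && (`|a - b| <= 1) by rewrite -le_min.
have bk : `|b| <= `|a| + 1.
  rewrite -[b](subrK a) addrC (le_trans (ler_normD _ _)) // lerD2l.
  by rewrite -normrN opprB.
have -> : (`|a| + 1) *: \one - a = ((`|a| + 1) *: \one - b) - (a - b) by linear_eq R.
rewrite (le_trans (ler_normB _ _)) // mul1r lerD //; exact/(pos_normP bk).
Qed.

Lemma pos_eps a : (forall e, 0 < e -> pos (a + e *: \one)) -> pos a.
Proof.
move=> h; apply: pos_lim => e e0; exists (a + e *: \one); first exact: h.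
have -> : a - (a + e *: \one) = - e *: \one by linear_eq R.
by rewrite normrZ normrN gtr0_norm // ler_piMr ?norm_one // ltW.
Qed.

Lemma posM C a b : is_AS (jb_op A) C -> C \one -> C a -> C b -> pos a -> pos b -> pos (a ** b).
Proof.
move=> hC C1 Ca Cb pa pb; apply: pos_lim => e e0.
pose m := `|a| + `|b| + 1; have m0 : 0 < m by rewrite ltr_wpDl // addr_ge0.
pose d := Num.min (e / m) 1; have d0 : 0 < d by rewrite lt_min ltr01 divr_gt0.
have [w _ hw] := pos_eps_mul hC C1 Ca Cb pa pb d0 d0.
exists ((a + d *: \one) ** (b + d *: \one)); first by rewrite -hw; exact: pos_sq.
have -> : a ** b - (a + d *: \one) ** (b + d *: \one) = - d *: (a + b + d *: \one).
  by rewrite !(opE, op1l, op1r); linear_eq R.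
rewrite normrZ normrN gtr0_norm //.
have d1 : d <= 1 by rewrite ge_min lexx orbT.
have : d <= e / m by rewrite ge_min lexx.
rewrite ler_pdivlMr // => h; rewrite (le_trans _ h) //; apply: ler_wpM2l; first exact: ltW.
rewrite (le_trans (ler_normD _ _)) // lerD ?ler_normD // normrZ gtr0_norm //.
by rewrite mulr_ile1 ?norm_one // ltW.
Qed.

Lemma pos_antisym a : pos a -> pos (- a) -> a = 0.
Proof.
move=> pa pN; apply/eqP; rewrite -normr_le0; apply: norm_le => //.
  by rewrite scale0r oppr0; apply/jle0.
by rewrite scale0r /jle add0r.
Qed.
Lemma jle_antisym a b : a <== b -> b <== a -> a = b.
Proof.
move=> h1 h2; apply/eqP; rewrite -subr_eq0; apply/eqP; apply: pos_antisym => //.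
by rewrite opprB.
Qed.

Lemma norm_mono a b : pos a -> a <== b -> `|a| <= `|b|.
Proof.
move=> pa ab; apply: norm_le => //.
  apply: (@jle_trans 0); last by apply/jle0.
  by rewrite /jle sub0r opprK; exact: posk.
exact: jle_trans ab (jle_norm b).
Qed.

(* The difference of two positive square roots is controlled by
   [(u-v)^4 <= (u-v)^2 (u+v)^2 = (u^2-v^2)^2]. *)
Lemma sqrt_norm C u v : is_AS (jb_op A) C -> C \one -> C u -> C v -> pos u -> pos v ->
  `|u - v| ^+ 2 <= `|u ** u - v ** v|.
Proof.
move=> hC C1 Cu Cv pu pv.
have Cm := ASB hC Cu Cv; have Cp := ASD hC Cu Cv.
have h : pos ((u - v) ** (u - v) ** (4 *: (u ** v))).
  apply: (posM hC) => //; try exact: pos_sq.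
  - exact: (ASM hC).
  - by apply: (ASZ hC); exact: (ASM hC).
  - by apply: posZ => //; apply: (posM hC).
rewrite -(@ler_pXn2r _ 2%N) ?nnegrE ?exprn_ge0 // -!norm_sq.
apply: norm_mono; first exact: pos_sq.
have e1 : (u + v) ** (u - v) = u ** u - v ** v by rewrite !opE (opC v u); linear_eq R.
have e2 : (u - v) ** (u - v) + 4 *: (u ** v) = (u + v) ** (u + v).
  by rewrite !opE (opC v u); linear_eq R.
rewrite -e1 (ASACA hC) // -e2 /jle opDl (opC (4 *: _)).
by have -> : forall x y : A, x + y - x = y by move=> x y; linear_eq R.
Qed.

Lemma pos_sqrt C a : is_AS (jb_op A) C -> C \one -> C a -> pos a ->
  exists w, [/\ C w, pos w & w ** w = a].
Proof.
move=> hC C1 Ca pa.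
(* The perturbation is the square of 2^-n, so that [sqrt_norm] puts the roots within 2^-n of each
   other. *)
have H (n : nat) : exists w, [/\ C w, pos w & w ** w = a + (2^-1 ^+ n) ^+ 2 *: \one].
  have [|w [Cw pw] hw] := @pos_eps_sqrt C a ((2^-1 ^+ n) ^+ 2) hC C1 Ca pa.
    by rewrite !exprn_gt0.
  by exists w.
have [w hw] := choice H; have wC n := let: And3 h _ _ := hw n in h.
have wp n := let: And3 _ h _ := hw n in h; have ww n := let: And3 _ _ h := hw n in h.
have bs e : 0 < e -> exists n : nat, 2^-1 ^+ n < e :> R.
  by apply: expr_small; [rewrite invr_ge0|rewrite invf_lt1 // ltr1n].
have [|l hl] := @cauchy_limit R A w (fun n => 2^-1 ^+ n) bs.
  move=> n m nm; rewrite -(@ler_pXn2r _ 2%N) ?nnegrE ?exprn_ge0 ?invr_ge0 //.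
  rewrite (le_trans (sqrt_norm hC C1 (wC m) (wC n) (wp m) (wp n))) // !ww.
  have -> : a + (2^-1 ^+ m) ^+ 2 *: \one - (a + (2^-1 ^+ n) ^+ 2 *: \one) =
    ((2^-1 ^+ m) ^+ 2 - (2^-1 ^+ n) ^+ 2) *: (\one : A) by linear_eq R.
  rewrite normrZ ler0_norm; last first.
    by rewrite subr_le0 lerXn2r ?nnegrE ?exprn_ge0 ?invr_ge0 // ler_wiXn2l ?invr_ge0 // invf_le1 // ler1n.
  rewrite opprB; apply: le_trans (ler_piMr _ norm_one) _.
    by rewrite subr_ge0 lerXn2r ?nnegrE ?exprn_ge0 ?invr_ge0 // ler_wiXn2l ?invr_ge0 // invf_le1 // ler1n.
  by rewrite lerBlDr lerDl sqr_ge0.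
exists l; split.
- by apply: (ASlim hC) => e /bs [n hn]; exists (w n) => //; exact: le_lt_trans (hl n) hn.
- by apply: pos_lim => e /bs [n hn]; exists (w n) => //; rewrite (le_trans (hl n)) // ltW.
apply/eqP; rewrite -subr_eq0 -normr_le0; apply: (@le_of_le_addeps _ _ _ (2 * `|l| + 2)) => e e0.
have [|n hn] := bs (Num.min e 1); first by rewrite lt_min e0 ltr01.
move: hn; rewrite lt_min => /andP[ne n1]; rewrite add0r.
have ln : `|l - w n| <= e by rewrite (le_trans (hl n)) // ltW.
have ln1 : `|l - w n| <= 1 by rewrite (le_trans (hl n)) // ltW.
have wn : `|w n| <= `|l| + 1.
  rewrite -[w n](subrK l) addrC (le_trans (ler_normD _ _)) // lerD2l.
  by rewrite -normrN opprB.
have -> : l ** l - a = (l ** l - w n ** w n) + (2^-1 ^+ n) ^+ 2 *: \one.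
  by rewrite ww; linear_eq R.
rewrite (le_trans (ler_normD _ _)) //.
have h2 : `|(2^-1 ^+ n) ^+ 2 *: (\one : A)| <= e.
  rewrite normrZ ger0_norm ?sqr_ge0 // (le_trans (ler_piMr _ norm_one)) ?sqr_ge0 //.
  rewrite expr2 (@le_trans _ _ (2^-1 ^+ n * 1)) ?ler_wpM2l ?exprn_ge0 ?invr_ge0 ?(ltW n1) //.
  by rewrite mulr1 ltW.
have h1 : `|l ** l - w n ** w n| <= e * `|l| + (`|l| + 1) * e.
  by rewrite (le_trans (op_normB _ _ _ _)) // lerD // ler_pM.
rewrite (_ : (2 * `|l| + 2) * e = (e * `|l| + (`|l| + 1) * e) + e) ?lerD //; ring.
Qed.

End Order.
Notation "x <== y" := (jle x y) (at level 70).
Arguments geno1 {R A} a.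
Arguments pos0 {R A}.
Arguments posk {R A k}.
Arguments pos1 {R A}.
Arguments norm_one {R A}.
Arguments geno_id {R A} a.
Arguments geno_AS {R A} a.

(** * Inverses, absolute values, positive and negative parts *)

Section FunctionalCalculus.
Variables (R : realType) (A : jbuAlg R).
Implicit Types (a b c x y z u v w : A) (k l : R) (C : set A).

Lemma pos_inv C a e : is_AS (jb_op A) C -> C \one -> C a -> 0 < e -> e *: \one <== a ->
  exists z, [/\ C z, pos z & a ** z = \one].
Proof.
move=> hC C1 Ca e0 ea; pose l := `|a| + e; have l0 : 0 < l by rewrite ltr_wpDl.
have li0 : 0 <= l^-1 by rewrite invr_ge0 ltW.
pose x := \one - l^-1 *: a.
have Cx : C x by apply: (ASB hC) => //; apply: (ASZ hC).
have nx : `|x| < 1.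
  apply: (@le_lt_trans _ _ (1 - e / l)); last by rewrite gtrBl divr_gt0.
  apply: norm_le; rewrite /jle.
  - by rewrite subr_ge0 ler_pdivrMr // mul1r /l lerDr.
  - have -> : 1 - e / l = l^-1 * `|a| by rewrite /l; field; rewrite gt_eqF.
    by have := posD pos1 (posZ li0 (pos_norm (lexx `|a|))); congr pos; rewrite /x; linear_eq R.
  - by have := posZ li0 ea; congr pos; rewrite /x; linear_eq R.
have e1 : l^-1 *: a = \one - x by rewrite /x; linear_eq R.
clearbody x.
have [y Cy hy] := quasi_inv hC Cx nx.
have inv : a ** (l^-1 *: (\one + y)) = \one.
  by rewrite opZr -opZl e1 !(opE, op1l, op1r); linear_from R hy.
have Cz : C (l^-1 *: (\one + y)) by apply: (ASZ hC); apply: (ASD hC).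
move: Cz inv; set z := l^-1 *: _ => Cz inv; exists z; split => //.
have -> : z = (z ** z) ** a by rewrite (ASA hC) // (opC z a) inv op1r.
apply: (posM hC) => //; [exact: (ASM hC)|exact: pos_sq|].
have pe : pos (e *: (\one : A)) by apply: posk; exact: ltW.
by have := posD ea pe; rewrite subrK.
Qed.

(** Divide by the invertible y = b + e: the square of x / y is at most 1, so x / y has norm at most
    1, and y - x is the product of the positive elements y and 1 - x / y. *)
Lemma le_of_sq_le C x b : is_AS (jb_op A) C -> C \one -> C x -> C b -> pos b ->
  x ** x <== b ** b -> x <== b.
Proof.
move=> hC C1 Cx Cb pb h; apply: pos_eps => e e0.
have Cbe : C (b + e *: \one) by apply: (ASD hC) => //; apply: (ASZ hC).
have be : e *: \one <== b + e *: \one.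
  by move: pb; rewrite /jle; congr pos; linear_eq R.
have [z [Cz pz hz]] := pos_inv hC C1 Cbe e0 be.
pose y := b + e *: \one; have Cy : C y by apply: (ASD hC) => //; apply: (ASZ hC).
have py : pos y by apply: posD => //; apply: posk; exact: ltW.
have Cxz : C (x ** z) by apply: (ASM hC).
have h1 : pos (\one - (x ** z) ** (x ** z)).
  have -> : \one - (x ** z) ** (x ** z) = (y ** y - x ** x) ** (z ** z).
    by rewrite opBl !(@ASACA _ _ C _ _ z z hC) // hz op1l.
  apply: (posM hC) => //; try by [apply: (ASM hC)|exact: pos_sq].
    by apply: (ASB hC); apply: (ASM hC).
  have -> : y ** y - x ** x = (b ** b - x ** x) + ((2 * e) *: b + (e * e) *: \one).
    by rewrite /y !(opE, op1l, op1r); linear_eq R.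
  apply: posD => //; apply: posD; last by apply: posk; rewrite mulr_ge0 // ltW.
  by apply: posZ => //; rewrite mulr_ge0 // ltW.
have nz : `|x ** z| <= 1.
  rewrite -(@ler_pXn2r _ 2%N) ?nnegrE // -norm_sq expr1n.
  by rewrite (le_trans (norm_mono (pos_sq _) h1)) // norm_one.
have -> : b - x + e *: \one = y ** (\one - x ** z).
  rewrite opBr op1r (opC x z) -(ASA hC) // hz op1l /y; linear_eq R.
apply: (posM hC) => //; first by apply: (ASB hC).
by have := pos_norm nz; rewrite scale1r.
Qed.

(** [u] and [v] need not lie in a common associative subalgebra. A third root [w] taken in
    [geno (v ** v)] lies both in [geno u] and in [geno v], where [sqrt_norm] compares it with
    each. *)
Lemma sqrt_uniq u v : pos u -> pos v -> u ** u = v ** v -> u = v.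
Proof.
move=> pu pv uv; have hC := geno_AS v; have C1 := geno1 v; have Cv := geno_id v.
have [w [Cw pw ww]] := pos_sqrt (geno_AS (v ** v)) (geno1 _) (geno_id _) (pos_sq v).
have eq_w t : pos t -> t ** t = v ** v -> t = w.
  move=> pt tt; have hT := geno_AS t; have T1 := geno1 t; have Tt := geno_id t.
  have Tw : geno t w by apply: (geno_min hT T1 _ Cw); rewrite -tt; exact: (ASM hT).
  have := sqrt_norm hT T1 Tt Tw pt pw; rewrite tt ww subrr normr0 => h.
  apply/eqP; rewrite -subr_eq0 -normr_eq0 -sqrf_eq0; apply/eqP/le_anti.
  by rewrite h sqr_ge0.
by rewrite (eq_w u) // (eq_w v).
Qed.

Lemma abs_ex x : exists w, [/\ geno (x ** x) w, pos w & w ** w = x ** x].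
Proof. exact: pos_sqrt (geno_AS _) (geno1 _) (geno_id _) (pos_sq x). Qed.
Definition jabs x := xget 0 [set w | [/\ geno (x ** x) w, pos w & w ** w = x ** x]].
Lemma jabsP x : [/\ geno (x ** x) (jabs x), pos (jabs x) & jabs x ** jabs x = x ** x].
Proof. by rewrite /jabs; case: xgetP => [w -> []//|h]; case: (abs_ex x) => w /h. Qed.
Definition jplus x := 2^-1 *: (jabs x + x).
Definition jminus x := 2^-1 *: (jabs x - x).

Lemma jabs_geno x : geno x (jabs x).
Proof.
case: (jabsP x) => h _ _; apply: (geno_min (geno_AS x) (geno1 x) _ h).
by apply: (ASM (geno_AS x)); exact: geno_id.
Qed.
Lemma jplus_geno x : geno x (jplus x).
Proof.
apply: (ASZ (geno_AS x)); apply: (ASD (geno_AS x)); [exact: jabs_geno|exact: geno_id].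
Qed.
Lemma jminus_geno x : geno x (jminus x).
Proof.
apply: (ASZ (geno_AS x)); apply: (ASB (geno_AS x)); [exact: jabs_geno|exact: geno_id].
Qed.
Lemma jplus_pos x : pos (jplus x).
Proof.
case: (jabsP x) => _ pa h; apply: posZ; first by rewrite invr_ge0.
suff : - x <== jabs x by rewrite /jle opprK addrC.
apply: (@le_of_sq_le (geno x) _ _ (geno_AS x) (geno1 x)) => //.
- by apply: (ASN (geno_AS x)); exact: geno_id.
- exact: jabs_geno.
by rewrite h opNl opNr opprK; exact: jle_refl.
Qed.
Lemma jminus_pos x : pos (jminus x).
Proof.
case: (jabsP x) => _ pa h; apply: posZ; first by rewrite invr_ge0.
apply: (@le_of_sq_le (geno x) x (jabs x) (geno_AS x) (geno1 x)) => //.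
- exact: geno_id.
- exact: jabs_geno.
by rewrite h; exact: jle_refl.
Qed.
Lemma jplusB x : jplus x - jminus x = x.
Proof. rewrite /jplus /jminus; linear_eq R. Qed.
Lemma jplusM x : jplus x ** jminus x = 0.
Proof.
case: (jabsP x) => _ _ h; rewrite /jplus /jminus !opE h (opC x); linear_eq R.
Qed.
Lemma jminusN x : jminus x = jplus (- x).
Proof.
rewrite /jminus /jplus; have -> // : jabs (- x) = jabs x.
case: (jabsP x) => _ p h; case: (jabsP (- x)) => _ p' h'; apply: sqrt_uniq => //.
by rewrite h h' !opE opprK.
Qed.
Lemma jplus_uniq x u v : pos u -> pos v -> u ** v = 0 -> u - v = x -> jplus x = u.
Proof.
move=> pu pv uv <-; case: (jabsP (u - v)) => _ p h.
have e : jabs (u - v) = u + v.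
  apply: sqrt_uniq => //; first exact: posD.
  by rewrite h !opE (opC v u) uv; linear_eq R.
rewrite /jplus e; linear_eq R.
Qed.

End FunctionalCalculus.

(** * The Hahn-Banach theorem for sublinear functionals *)

Section HahnBanach.
Variables (R : realType) (V : lmodType R).
Implicit Types (s r : V -> R) (x y : V).

Definition sublin s := (forall x y, s (x + y) <= s x + s y) /\
  (forall k x, 0 < k -> s (k *: x) <= k * s x).

Lemma sublinZ s k x : sublin s -> 0 < k -> s (k *: x) = k * s x.
Proof.
move=> [_ h] k0; apply/le_anti; rewrite h // -ler_pdivlMl //.
by rewrite (le_trans _ (h _ _ _)) ?invr_gt0 // scalerA mulVf ?gt_eqF // scale1r.
Qed.
Lemma sublin0 s : sublin s -> s 0 = 0.
Proof.
move=> hs; have := @sublinZ s 2 0 hs (ltr0n _ 2); rewrite scaler0; lra.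
Qed.
Lemma sublin_ge s x : sublin s -> - s (- x) <= s x.
Proof.
by move=> hs; have := hs.1 x (- x); rewrite subrr (sublin0 hs); lra.
Qed.

(** A sublinear functional below [s]. If [s] is minimal the two agree, and t = 1 gives s x <= s (x +
    y) - s y, the missing half of additivity. *)
Let shift s y x := inf [set s (x + t *: y) - t * s y | t in [set t : R | 0 <= t]].

Let shift_lb s y x : sublin s ->
  has_inf [set s (x + t *: y) - t * s y | t in [set t : R | 0 <= t]].
Proof.
move=> hs; split; first by exists (s (x + 0 *: y) - 0 * s y), 0 => /=.
exists (- s (- x)) => _ [t /= t0 <-].
have : s (t *: y) <= s (x + t *: y) + s (- x).
  by have := hs.1 (x + t *: y) (- x); rewrite addrAC subrr add0r.
have [->|tn0] := eqVneq t 0.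
  by rewrite scale0r mul0r addr0 subr0 (sublin0 hs); lra.
by rewrite (sublinZ _ hs) ?lt_neqAle 1?eq_sym ?tn0 //; lra.
Qed.

Let shift_le s y x t : sublin s -> 0 <= t -> shift s y x <= s (x + t *: y) - t * s y.
Proof. by move=> hs t0; apply: ge_inf; [have [] := shift_lb y x hs|exists t]. Qed.

Let shift_sublin s y : sublin s -> sublin (shift s y).
Proof.
move=> hs; split=> [x z|k x k0].
  apply/ler_addgt0Pr => e e0; have e20 : 0 < e / 2 by rewrite divr_gt0.
  have [_ [t /= t0 <-] ht] := inf_adherent e20 (shift_lb y x hs).
  have [_ [r /= r0 <-] hr] := inf_adherent e20 (shift_lb y z hs).
  apply: (le_trans (shift_le _ _ hs (addr_ge0 t0 r0))).
  have := hs.1 (x + t *: y) (z + r *: y).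
  have -> : x + t *: y + (z + r *: y) = x + z + (t + r) *: y by linear_eq R.
  move: ht hr; rewrite -!/(shift _ _ _) mulrDl; lra.
apply/ler_addgt0Pr => e e0; have e20 : 0 < e / k by rewrite divr_gt0.
have [_ [t /= t0 <-] ht] := inf_adherent e20 (shift_lb y x hs).
apply: (le_trans (shift_le _ _ hs (mulr_ge0 (ltW k0) t0))).
rewrite -scalerA -scalerDr (sublinZ _ hs) // -mulrA -mulrBr.
have : k * (s (x + t *: y) - t * s y) <= k * (shift s y x + e / k).
  by rewrite ler_pM2l // ltW.
have ek : k * (e / k) = e by field; rewrite gt_eqF.
by rewrite (mulrDr k (shift s y x)) ek.
Qed.

Theorem hahn_banach r x0 : sublin r -> exists w : V -> R,
  [/\ (forall k x y, w (k *: x + y) = k * w x + w y), (forall x, w x <= r x) & w x0 = r x0].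
Proof.
(* Searching below the shift along [x0] instead of below [r] forces w (- x0) <= - r x0, hence the
   equality at [x0]. *)
move=> hr; have hr' := shift_sublin x0 hr; set r' := shift r x0 in hr'.
pose T := {s : V -> R | sublin s /\ forall x, s x <= r' x}.
pose Rel (s t : T) := `[< forall x, sval t x <= sval s x >].
have [s hs] : exists s : T, forall t, Rel s t -> t = s.
  apply: Zorn.
  - by move=> s; apply/asboolP.
  - by move=> s t u /asboolP h1 /asboolP h2; apply/asboolP => x; exact: le_trans (h1 x).
  - move=> [s hs] [t ht] /asboolP /= h1 /asboolP /= h2.
    have e : s = t by apply/funext => x; apply/le_anti; rewrite h1 h2.
    by subst t; congr exist; exact: Prop_irrelevance.
  move=> C totC; have [[s0 C0]|nC] := pselect (C !=set0); last first.
    have hh : sublin r' /\ forall x, r' x <= r' x by split.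
    by exists (exist _ r' hh) => s Cs; case: nC; exists s.
  pose m x := inf [set sval s x | s in C].
  have lb x : has_inf [set sval s x | s in C].
    split; first by exists (sval s0 x), s0.
    exists (- r' (- x)) => _ [s Cs <-]; have [h1 h2] := svalP s.
    by rewrite (le_trans _ (sublin_ge x h1)) // lerN2.
  have mle x (s : T) : C s -> m x <= sval s x.
    by move=> Cs; apply: ge_inf; [have [] := lb x|exists s].
  have hm : sublin m /\ forall x, m x <= r' x.
    split; last first.
      by move=> x; rewrite (le_trans (mle x s0 C0)) //; have [_] := svalP s0.
    split=> [x y|k x k0].
      apply/ler_addgt0Pr => e e0; have e20 : 0 < e / 2 by rewrite divr_gt0.
      have [_ [s Cs <-] sx] := inf_adherent e20 (lb x).
      have [_ [t Ct <-] ty] := inf_adherent e20 (lb y).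
      have [u [Cu us ut]] : exists u, [/\ C u, sval u x <= sval s x & sval u y <= sval t y].
        by have [/asboolP h|/asboolP h] := totC s t Cs Ct; [exists t|exists s].
      have [[h _] _] := svalP u; have := h x y; have := mle (x + y) u Cu.
      move: sx ty us ut; rewrite -!/(m _); lra.
    apply/ler_addgt0Pr => e e0; have e20 : 0 < e / k by rewrite divr_gt0.
    have [_ [s Cs <-] sx] := inf_adherent e20 (lb x).
    have [h1 _] := svalP s; rewrite (le_trans (mle _ s Cs)) // (sublinZ _ h1) //.
    have : k * sval s x <= k * (m x + e / k) by rewrite ler_pM2l // ltW.
    have ek : k * (e / k) = e by field; rewrite gt_eqF.
    by rewrite (mulrDr k (m x)) ek.
  by exists (exist _ m hm) => s Cs; apply/asboolP => x; exact: mle.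
case: s hs => w [hw wr] /= hs.
have wD x y : w (x + y) = w x + w y.
  apply/le_anti; rewrite hw.1 /=.
  have h : sublin (shift w y) /\ forall x, shift w y x <= r' x.
    split; first exact: shift_sublin.
    move=> z; rewrite (le_trans (shift_le y z hw (lexx 0))) //.
    by rewrite scale0r mul0r addr0 subr0.
  have /(congr1 sval) /= e : exist _ (shift w y) h = exist _ w (conj hw wr) :> T.
    apply: hs; apply/asboolP => z /=; rewrite (le_trans (shift_le y z hw (lexx 0))) //.
    by rewrite scale0r mul0r addr0 subr0.
  by have := shift_le y x hw (ler01 : 0 <= 1); rewrite e scale1r mul1r; lra.
have wN x : w (- x) = - w x.
  by apply/eqP; rewrite -addr_eq0 -wD addNr (sublin0 hw).
have wZ k x : w (k *: x) = k * w x.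
  have [k0|k0|->] := ltgtP k 0; last by rewrite scale0r mul0r (sublin0 hw).
    have kN : 0 < - k by rewrite oppr_gt0.
    by have := sublinZ x hw kN; rewrite scaleNr wN mulNr => /oppr_inj.
  exact: sublinZ.
have wle x : w x <= r x.
  rewrite (le_trans (wr x)) // (le_trans (shift_le x0 x hr (lexx 0))) //.
  by rewrite scale0r mul0r addr0 subr0.
exists w; split => //; first by move=> k x y; rewrite wD wZ.
apply/le_anti; rewrite wle /=; have := wr (- x0); rewrite wN => h.
have := shift_le x0 (- x0) hr (ler01 : 0 <= 1).
by rewrite scale1r mul1r addNr (sublin0 hr); move: h; rewrite /r'; lra.
Qed.

End HahnBanach.

(** * States *)

Section States.
Variables (R : realType) (A : jbuAlg R).
Implicit Types (a b c x y z u v : A) (w : A -> R) (k l t : R) (C : set A).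

Definition state (w : A -> R) := [/\ (forall k x y, w (k *: x + y) = k * w x + w y),
  (forall x, pos x -> 0 <= w x) & w \one = 1].

Section StateTheory.
Variable w : A -> R.
Hypothesis hw : state w.
Lemma state0 : w 0 = 0.
Proof. by case: hw => h _ _; have := h 1 0 0; rewrite scaler0 addr0 mul1r; lra. Qed.
Lemma stateD x y : w (x + y) = w x + w y.
Proof. by case: hw => h _ _; have := h 1 x y; rewrite scale1r mul1r. Qed.
Lemma stateZ k x : w (k *: x) = k * w x.
Proof. by case: hw => h _ _; have := h k x 0; rewrite !addr0 state0 addr0. Qed.
Lemma stateN x : w (- x) = - w x.
Proof. by rewrite -scaleN1r stateZ mulN1r. Qed.
Lemma stateB x y : w (x - y) = w x - w y.
Proof. by rewrite stateD stateN. Qed.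
Lemma state1 : w \one = 1. Proof. by case: hw. Qed.
Lemma state_pos x : pos x -> 0 <= w x. Proof. by case: hw => _ h _; exact: h. Qed.
Lemma state_le x y : x <== y -> w x <= w y.
Proof. by move/state_pos; rewrite stateB subr_ge0. Qed.
Lemma state_norm x : `|w x| <= `|x|.
Proof.
rewrite ler_norml; have := state_le (jle_norm x); have := state_le (jle_normN x).
by rewrite stateN !stateZ state1 mulr1 => -> ->.
Qed.
Lemma state_sq0 r z : w (r ** r) = 0 -> w (r ** z) = 0.
Proof.
move=> h; have key k : 0 <= 2 * k * w (r ** z) + w (z ** z).
  have := state_pos (pos_sq (k *: r + z)).
  have -> : (k *: r + z) ** (k *: r + z) = (k * k) *: (r ** r) + ((2 * k) *: (r ** z) + z ** z).
    by rewrite !opE (opC z r); linear_eq R.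
  by rewrite stateD stateZ h mulr0 add0r stateD stateZ.
apply/eqP; rewrite eq_le; apply/andP; split; rewrite leNgt; apply/negP => n0.
  have := key (- (w (z ** z) + 1) / w (r ** z)).
  rewrite (_ : 2 * _ * _ = - 2 * (w (z ** z) + 1)); last by field; rewrite gt_eqF.
  have := state_pos (pos_sq z); lra.
have := key (- (w (z ** z) + 1) / w (r ** z)).
rewrite (_ : 2 * _ * _ = - 2 * (w (z ** z) + 1)); last by field; rewrite lt_eqF.
have := state_pos (pos_sq z); lra.
Qed.
End StateTheory.

Lemma posk_ge0 k : \one != 0 :> A -> pos (k *: (\one : A)) -> 0 <= k.
Proof.
move=> n0 pk; rewrite leNgt; apply/negP => k0.
have : pos (- (k *: (\one : A))) by rewrite -scaleNr; apply: posk; rewrite oppr_ge0 ltW.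
move/(pos_antisym pk) => /eqP; rewrite scaler_eq0 (negbTE n0) orbF => /eqP e.
by rewrite e ltxx in k0.
Qed.

(** Hahn-Banach for the sublinear functional whose value at [x] is the least [k] with
    [x <== k *: \one]: linear functionals below it are positive and unital. *)
Lemma state_max a : \one != 0 :> A -> exists w, state w /\ a <== w a *: \one.
Proof.
move=> n0; pose S x := [set k : R | x <== k *: \one]; pose r x := inf (S x).
have lb x k : S x k -> - `|x| <= k.
  rewrite /S /= => h; rewrite -subr_ge0; apply: (posk_ge0 n0).
  by have := jle_trans (jle_normN x) h; rewrite /jle; congr pos; linear_eq R.
have hi x : has_inf (S x).
  by split; [exists `|x|; exact: jle_norm|exists (- `|x|) => k; exact: lb].
have rS x : S x (r x).
  apply: pos_eps => e e0; have [k Sk kr] := inf_adherent e0 (hi x).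
  have : pos ((r x + e - k) *: (\one : A)) by apply: posk; rewrite subr_ge0 ltW.
  by move/(posD Sk); congr pos; linear_eq R.
have rle x k : S x k -> r x <= k by move=> h; apply: ge_inf => //; case: (hi x).
have rs : sublin r.
  split=> [x y|k x k0]; apply: rle.
    by have := jleD (rS x) (rS y); rewrite /S /= -scalerDl.
  by have := jleZ (ltW k0) (rS x); rewrite /S /= scalerA.
have [w [wl wr wa]] := hahn_banach a rs.
have w0 : w 0 = 0 by have := wl 1 0 0; rewrite scaler0 addr0 mul1r; lra.
have wN x : w (- x) = - w x by have := wl (-1) x 0; rewrite addr0 w0 scaleN1r mulN1r addr0.
exists w; split; last by rewrite wa; exact: rS.
split=> // [x px|].
  have : w (- x) <= 0.
    rewrite (le_trans (wr _)) //; apply: rle; rewrite /S /= scale0r /jle sub0r opprK //.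
  by rewrite wN oppr_le0.
apply/le_anti/andP; split; first by rewrite (le_trans (wr _)) // rle // /S /= scale1r; exact: jle_refl.
have : w (- \one) <= -1.
  by rewrite (le_trans (wr _)) // rle // /S /= scaleN1r; exact: jle_refl.
by rewrite wN; lra.
Qed.

(** Take roots twice, u^2 = y and v^2 = u. By [state_sq0], [w] kills every product with [u], in
    particular [u] itself, hence every product with [v]. By [op_triple], y c with y = (v v)(v v) is
    a sum of terms whose outermost factor is [u] or [v]. *)
Lemma state_null w y c : state w -> pos y -> w y = 0 -> w (c ** y) = 0.
Proof.
move=> hw py wy.
have [u [_ pu uu]] := pos_sqrt (geno_AS y) (geno1 y) (geno_id y) py.
have [v [_ pv vv]] := pos_sqrt (geno_AS u) (geno1 u) (geno_id u) pu.
have h2 z : w (u ** z) = 0 by apply: state_sq0 => //; rewrite uu.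
have h1 z : w (v ** z) = 0 by apply: state_sq0 => //; rewrite vv -[u]op1r.
have e : y = (v ** v) ** (v ** v) by rewrite vv uu.
rewrite opC e op_triple vv !(stateD hw, stateN hw) !h1 !h2; ring.
Qed.

(* [(1 - t L_c)] has a positive inverse for small [t]: at a boundary point of the cone
   take a state vanishing there. *)
Lemma pos_resolvent x c t : `|t| * `|c| < 1 -> pos (x - t *: (c ** x)) -> pos x.
Proof.
move=> tc px; have [e|n0] := eqVneq (\one : A) 0.
  by have -> : x = 0; [rewrite -(op1l x) e op0l|exact: pos0].
have [w [hw xw]] := state_max (- x) n0; set k := w (- x) in xw.
have [k0|k0] := leP k 0.
  have : pos (- k *: (\one : A)) by apply: posk; rewrite oppr_ge0.
  by move/(posD xw); congr pos; linear_eq R.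
have py : pos (x + k *: \one) by move: xw; congr pos; linear_eq R.
have wy : w (x + k *: \one) = 0.
  by rewrite stateD // stateZ // state1 // /k stateN // mulr1 addrN.
have := state_null c hw py wy; rewrite opDr opZr op1r stateD // stateZ // => h.
have := state_pos hw px; rewrite stateB // stateZ //.
have wx : w x = - k by rewrite /k stateN // opprK.
have cx : w (c ** x) = - (k * w c) by apply/eqP; rewrite -addr_eq0 h.
have : `|t * w c| <= `|t| * `|c| by rewrite normrM ler_wpM2l // state_norm.
move=> h1; have := ler_norm (t * w c); rewrite wx cx => h2 h3.
have h4 : t * w c < 1 by apply: le_lt_trans tc; apply: le_trans h1.
have : 0 <= k * (t * w c - 1) by move: h3; rewrite -subr_ge0; nra.
by rewrite pmulr_rge0 // subr_ge0 leNgt h4.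
Qed.

End States.

(** From here on duality is used only through suprema of bounded increasing sequences; the order
    continuity of multiplication that is needed comes from [sup_mul]. *)
Record jbwAlg (R : realType) := JbwAlg {
  jbw_u :> jbuAlg R;
  jbw_sup : forall u : nat -> jbw_u, (forall n, u n <== u n.+1) ->
    (exists b, forall n, u n <== b) ->
    exists s, (forall n, u n <== s) /\ (forall b, (forall n, u n <== b) -> s <== b) }.

Section SupFromDual.
Variables (R : realType) (A : jbuAlg R).

Lemma jle_chain (u : nat -> A) : (forall n, u n <== u n.+1) ->
  forall n m, (n <= m)%N -> u n <== u m.
Proof.
move=> h n m; elim: m => [|m IH]; first by rewrite leqn0 => /eqP ->; exact: jle_refl.
rewrite leq_eqVlt => /orP[/eqP ->|/IH h1]; first exact: jle_refl.
exact: jle_trans h1 (h m).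
Qed.

Lemma norm_leP (k : R) (a : A) : `|a| <= k -> - (k *: \one) <== a /\ a <== k *: \one.
Proof.
move=> h; have kk : pos ((k - `|a|) *: (\one : A)) by apply: posk; rewrite subr_ge0.
split; first by have := posD kk (jle_normN a); rewrite /jle; congr pos; linear_eq R.
by have := posD kk (jle_norm a); rewrite /jle; congr pos; linear_eq R.
Qed.

(** The balls in [D] are order intervals, those starting at some [u n] and those ending at an upper
    bound. Each contains all late terms of [u], so finitely many have a common point; a point of all
    of them is the supremum. *)
Lemma dual_sup : dual_Banach A -> forall u : nat -> A, (forall n, u n <== u n.+1) ->
    (exists b, forall n, u n <== b) ->
    exists s, (forall n, u n <== s) /\ (forall b, (forall n, u n <== b) -> s <== b).
Proof.
move=> [E [T [Tl Tl2 Tn Ts]]] u uS [b0 hb0].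
have uch := jle_chain uS.
pose K0 := `|b0 - u 0%N|.
pose D := [set cr : A * R | (exists n, cr = (u n + K0 *: \one, K0)) \/
  (exists2 b, (forall n, u n <== b) & cr = (b - `|b - u 0%N| *: \one, `|b - u 0%N|))].
have key cr : D cr -> exists N, forall m, (N <= m)%N -> `|u m - cr.1| <= cr.2.
  move=> [[n ->]|[b hb ->]].
    exists n => m nm /=; apply: norm_le; rewrite ?normr_ge0 // /jle.
      by have := uch _ _ nm; rewrite /jle; congr pos; linear_eq R.
    have h1 := jle_norm (b0 - u 0%N); have h2 := hb0 m; have h3 := uch 0%N n (leq0n n).
    have := posD (posD h1 h2) (posD h3 (posk (normr_ge0 (b0 - u 0%N)))).
    by rewrite -/K0; congr pos; linear_eq R.
  exists 0%N => m _ /=; apply: norm_le; rewrite ?normr_ge0 // /jle.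
    have h1 := jle_norm (b - u 0%N); have h3 := uch 0%N m (leq0n m).
    have := posD (posD h1 h3) (posk (normr_ge0 (b - u 0%N))).
    by congr pos; linear_eq R.
  by have := hb m; rewrite /jle; congr pos; linear_eq R.
have [|s sD|s hs] := @dual_ball_fip R A E T Tl Tl2 Tn Ts D.
- by exists (u 0%N + K0 *: \one, K0); left; exists 0%N.
- have [N hN] : exists N, forall i, i \in s -> forall m, (N <= m)%N -> `|u m - i.1| <= i.2.
    elim: s sD => [|i s IH] sD; first by exists 0%N.
    have [|N hN] := IH; first by move=> j js; apply: sD; rewrite inE js orbT.
    have [M hM] := key i (sD i (mem_head _ _)).
    exists (maxn N M) => j; rewrite inE => /orP[/eqP ->|js] m; rewrite geq_max => /andP[Nm Mm].
      exact: hM.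
    exact: hN.
  by exists (u N) => i si; apply: hN.
exists s; split=> [n|b hb].
  have /norm_leP[h _] := hs _ (or_introl (ex_intro _ n erefl)).
  by move: h; rewrite /jle /=; congr pos; linear_eq R.
have /norm_leP[_ h] := hs _ (or_intror (ex_intro2 _ _ b hb erefl)).
by move: h; rewrite /jle /=; congr pos; linear_eq R.
Qed.
End SupFromDual.

(** * Positivity of Peirce projections and reflections *)

Section PeircePositivity.
Variables (R : realType) (A : jbuAlg R).
Implicit Types (a b c x y z u v p q e : A) (k l t : R) (C : set A).

Lemma proj_compl p : proj p -> proj (\one - p).
Proof. by move=> pp; rewrite /proj !(opBl, opBr, op1l, op1r) pp; linear_eq R. Qed.

Lemma proj_pos p : proj p -> pos p.
Proof. by move=> pp; rewrite -pp; exact: pos_sq. Qed.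

Lemma proj_le1 p : proj p -> p <== \one.
Proof. by move=> /proj_compl/proj_pos. Qed.

Lemma norm_proj p : proj p -> `|p| <= 1.
Proof.
move=> pp; apply: norm_le_one; last exact: proj_le1.
by rewrite /jle opprK; apply: posD; [exact: proj_pos|exact: pos1].
Qed.

Lemma pcomm_compl p x : pcomm p x -> pcomm (\one - p) x.
Proof.
move=> /pcommE h; apply/pcommE; rewrite !(opBl, opBr, op1l, op1r) h; linear_eq R.
Qed.

(** Since [c] has no half component, k - c splits into orthogonal pieces under [p] and 1 - p, and
    [norm_orth_max] bounds the first by the whole. *)
Lemma pos_pcomm p c : proj p -> pcomm p c -> pos c -> pos (p ** c).
Proof.
move=> pp pc [k hk]; exists k.
have /pcommE pc2 := pc.
have k0 : 0 <= k by exact: le_trans hk.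
have pcompl : p ** (\one - p) = 0 by rewrite opBr op1r pp subrr.
have e1 : k *: \one - c = (k *: p - p ** c) + (k *: (\one - p) - (c - p ** c)) by linear_eq R.
have h : `|k *: p - p ** c| <= k.
  rewrite (le_trans _ hk) // e1.
  rewrite (norm_orth_max (x := k *: p - p ** c) (y := k *: (\one - p) - (c - p ** c)) pp) ?le_max ?lexx //.
    by rewrite opBr opZr pp pc2.
  by rewrite opBr opZr pcompl opBr pc2 subrr scaler0 subr0.
have -> : k *: \one - p ** c = (k *: p - p ** c) + k *: (\one - p) by linear_eq R.
rewrite (norm_orth_max (x := k *: p - p ** c) (y := k *: (\one - p)) pp) ?opZr ?pcompl ?scaler0 //; last by rewrite opBr opZr pp pc2.
rewrite ge_max h normrZ ger0_norm // ler_piMr // norm_proj //; exact: proj_compl.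
Qed.

Lemma peirce1_lin p k x y : peirce1 p (k *: x + y) = k *: peirce1 p x + peirce1 p y.
Proof. by rewrite /peirce1 !opE; linear_eq R. Qed.
Lemma peirce1D p x y : peirce1 p (x + y) = peirce1 p x + peirce1 p y.
Proof. by have := peirce1_lin p 1 x y; rewrite !scale1r. Qed.
Lemma peirce1B p x y : peirce1 p (x - y) = peirce1 p x - peirce1 p y.
Proof. by have := peirce1_lin p (-1) y x; rewrite !scaleN1r addrC => ->; rewrite addrC. Qed.
Lemma peirce1_comm p x : pcomm p x -> peirce1 p x = p ** x.
Proof. by move=> /pcommE h; rewrite /peirce1 h; linear_eq R. Qed.
Lemma peirce1_half p x : p ** x = 2^-1 *: x -> peirce1 p x = 0.
Proof. by move=> h; rewrite /peirce1 !(opE, h); linear_eq R. Qed.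
Lemma peirce1_id p x : p ** x = x -> peirce1 p x = x.
Proof. by move=> h; rewrite /peirce1 !h; linear_eq R. Qed.
Lemma peirce1_0 p x : p ** x = 0 -> peirce1 p x = 0.
Proof. by move=> h; rewrite /peirce1 !(opE, h); linear_eq R. Qed.
Lemma peirce1_sq p a h b : proj p -> p ** a = a -> p ** h = 2^-1 *: h -> p ** b = 0 ->
  peirce1 p ((a + h + b) ** (a + h + b)) = a ** a + p ** (h ** h).
Proof.
move=> pp pa ph pb.
have -> : (a + h + b) ** (a + h + b) =
   a ** a + (h ** h + (2 *: (a ** h) + (2 *: (b ** h) + (b ** b + 2 *: (a ** b))))).
  by rewrite !opE (opC h a) (opC b a) (opC h b); linear_eq R.
rewrite !peirce1D (peirce1_id (peirce11 pp pa pa)) (peirce1_comm (peircehh pp ph ph)).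
rewrite (peirce1_half (x := 2 *: (a ** h))); last by rewrite !opE peirce1h // !scalerA mulrC.
rewrite (peirce1_half (x := 2 *: (b ** h))); last by rewrite !opE peirce0h // !scalerA mulrC.
rewrite (peirce1_0 (x := b ** b)); last exact: peirce00.
by rewrite (peirce10 pp pa pb) scaler0 (peirce1_0 (x := 0)) ?op0r // !addr0.
Qed.

(** Positivity of [U_p]: if r^2 = x and a, h are the 1- and half components of [r], the 1-component
    of [x] is a^2 + p h^2, and h^2 commutes with [p]. *)
Lemma pos_peirce1 p x : proj p -> pos x -> pos (peirce1 p x).
Proof.
move=> pp px; have [r [_ pr <-]] := pos_sqrt (geno_AS x) (geno1 x) (geno_id x) px.
rewrite {1 2}(peirce_sum p r) peirce1_sq ?peirce1P ?peircehP ?peirce0P //.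
apply: posD; first exact: pos_sq.
apply: pos_pcomm => //; last exact: pos_sq.
by apply: peircehh => //; exact: peircehP.
Qed.
Lemma posD_eq0 a b : pos a -> pos b -> a + b = 0 -> a = 0.
Proof.
move=> pa pb h; apply: pos_antisym => //.
by have -> : - a = b by linear_from R h.
Qed.

Lemma peirce1_eq0 p x : proj p -> pos x -> peirce1 p x = 0 -> p ** x = 0.
Proof.
move=> pp px; have [r [_ pr <-]] := pos_sqrt (geno_AS x) (geno1 x) (geno_id x) px.
rewrite {1 2}(peirce_sum p r) peirce1_sq ?peirce1P ?peircehP ?peirce0P // => h.
have ph : pos (p ** (peirceh p r ** peirceh p r)).
  apply: pos_pcomm => //; last exact: pos_sq.
  by apply: peircehh => //; exact: peircehP.
have a0 : peirce1 p r = 0 by apply: sq_eq0; exact: posD_eq0 (pos_sq _) ph h.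
have h0 : peirceh p r = 0.
  apply: (half_sq0_eq0 pp (peircehP _ pp)); apply: (posD_eq0 ph (pos_sq (peirce1 p r))).
  by rewrite addrC.
rewrite (peirce_sum p r) a0 h0 !add0r.
by apply: peirce00 => //; exact: peirce0P.
Qed.

Lemma proj_face p x y : proj p -> pos x -> x <== y -> p ** y = 0 -> p ** x = 0.
Proof.
move=> pp px xy py; apply: peirce1_eq0 => //.
apply: pos_antisym; first exact: pos_peirce1.
have := pos_peirce1 pp xy; rewrite peirce1B (peirce1_0 py) sub0r //.
Qed.
Lemma proj_face1 p x y : proj p -> pos x -> x <== y -> p ** y = y -> p ** x = x.
Proof.
move=> pp px xy py; have := @proj_face (\one - p) x y (proj_compl pp) px xy.
rewrite !opBl !op1l py subrr => /(_ erefl)/eqP; rewrite subr_eq0 => /eqP <- //.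
Qed.

Lemma pos_refl p x : proj p -> pos x -> pos (refl p x).
Proof.
move=> pp px; have [r [_ pr <-]] := pos_sqrt (geno_AS x) (geno1 x) (geno_id x) px.
by rewrite reflM //; exact: pos_sq.
Qed.
Lemma refl1 p : proj p -> refl p \one = \one.
Proof. by move=> pp; apply: refl_comm; apply/pcommE; rewrite op1r pp. Qed.
Lemma refl_proj p q : proj p -> proj q -> proj (refl p q).
Proof. by move=> pp pq; rewrite /proj -reflM // pq. Qed.
End PeircePositivity.

(** * Range projections *)

Section RangeProjection.
Variables (R : realType) (A : jbwAlg R).
Implicit Types (a b c d s x y z u v w p q r : A) (k l t : R) (C : set A).

(** Multiplication by [b] is not monotone, but for z >= 0 and small [t] the element z + t b z is
    positive up to a multiple of t^2, by [pos_resolvent]. With z = s - u m this makes s + t (b s -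
    c) + O(t^2) an upper bound of the sequence in the limit; minimality of [s] leaves t (b s - c) >=
    - O(t^2), for both signs of [t]. Dividing by [t] gives the claim. *)
Lemma sup_mul (u : nat -> A) s b c : (forall n, u n <== u n.+1) ->
  (forall n, u n <== s) -> (forall b, (forall n, u n <== b) -> s <== b) ->
  (forall e, 0 < e -> exists N, forall m, (N <= m)%N -> `|b ** u m - c| <= e) -> b ** s = c.
Proof.
move=> uS us smin ulim; have uch := jle_chain uS.
pose B := `|b|; pose Z := `|s - u 0%N|.
have B0 : 0 <= B by exact: normr_ge0.
have Z0 : 0 <= Z by exact: normr_ge0.
have key t : `|t| * B <= 2^-1 ->
    pos (t *: (b ** s - c) + (2 * t ^+ 2 * (B ^+ 2 * Z)) *: \one).
  (* Applying 1 - t b to z + t b z + D leaves the errors t D b and t^2 b (b z). Each is at most D /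
     2, the first because |t| B <= 1/2. *)
  move=> tB; set D := 2 * t ^+ 2 * (B ^+ 2 * Z).
  have D0 : 0 <= D.
    by apply: mulr_ge0; apply: mulr_ge0 => //; exact: sqr_ge0.
  have step e m : 0 < e -> `|b ** u m - c| <= e ->
      u m <== s + t *: (b ** s - c) + (D + `|t| * e) *: \one.
    move=> e0 he; pose z := s - u m; have pz : pos z by exact: us.
    have nz : `|z| <= Z.
      apply: norm_mono => //; have := uch 0%N m (leq0n m); rewrite /jle /z; congr pos; linear_eq R.
    have pX : pos (z + t *: (b ** z) + D *: \one).
      apply: (@pos_resolvent _ _ _ b t); first by rewrite (le_lt_trans tB) // invf_lt1 // ltr1n.
      have -> : z + t *: (b ** z) + D *: \one - t *: (b ** (z + t *: (b ** z) + D *: \one)) =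
          z + (D *: \one - ((t * D) *: b + (t * t) *: (b ** (b ** z)))).
        by rewrite !(opDr, opZr, op1r); linear_eq R.
      apply: posD => //; apply: pos_norm.
      rewrite (le_trans (ler_normD _ _)) // (normrZ (t * D) b) (normrZ (t * t)) !(normrM t) -/B.
      have h1 : `|b ** (b ** z)| <= B * (B * Z).
        rewrite (le_trans (op_norm _ _)) // -/B ler_wpM2l // (le_trans (op_norm _ _)) //.
        by rewrite ler_wpM2l.
      have h2 : `|t| * `|D| * B <= 2^-1 * D.
        by rewrite (ger0_norm D0) mulrAC ler_wpM2r.
      have h3 : `|t| * `|t| * `|b ** (b ** z)| <= t ^+ 2 * (B * (B * Z)).
        by rewrite -normrM -expr2 ger0_norm ?sqr_ge0 // ler_wpM2l ?sqr_ge0.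
      apply: le_trans (lerD h2 h3) _; rewrite /D; lra.
    have hr : `|t *: (b ** u m - c)| <= `|t| * e by rewrite normrZ ler_wpM2l.
    have := posD pX (pos_norm (_ : `|- (t *: (b ** u m - c))| <= `|t| * e)).
    rewrite normrN => /(_ hr); rewrite /jle /z; congr pos.
    rewrite !opE; linear_eq R.
  apply: pos_eps => e e0.
  have t1 : 0 < `|t| + 1 by rewrite ltr_wpDl.
  have [N hN] := ulim _ (divr_gt0 e0 t1).
  have h : s <== s + t *: (b ** s - c) + (D + `|t| * (e / (`|t| + 1))) *: \one.
    apply: smin => n; apply: (jle_trans (uch n (maxn N n) (leq_maxr _ _))).
    by apply: step; [exact: divr_gt0|apply: hN; exact: leq_maxl].
  have te : `|t| * (e / (`|t| + 1)) <= e.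
    by rewrite mulrCA ger_pMr // ler_pdivrMr // mul1r lerDl.
  have := posD h (posk (_ : 0 <= e - `|t| * (e / (`|t| + 1)))).
  rewrite subr_ge0 => /(_ te); congr pos; linear_eq R.
have small e : 0 < e -> exists t, [/\ 0 < t, t * B <= 2^-1 & 2 * t * (B ^+ 2 * Z) <= e].
  move=> e0; pose M := 2 * (B ^+ 2 * Z) + 1; have M0 : 0 < M.
    by rewrite ltr_wpDl //; apply: mulr_ge0 => //; apply: mulr_ge0 => //; exact: sqr_ge0.
  have B1 : 0 < 2 * (B + 1) by rewrite mulr_gt0 // ltr_wpDl.
  exists (Num.min (2 * (B + 1))^-1 (e / M)); split.
  - by rewrite lt_min invr_gt0 B1 divr_gt0.
  - apply: (@le_trans _ _ ((2 * (B + 1))^-1 * B)); first by rewrite ler_wpM2r // ge_min lexx.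
    rewrite ler_pdivrMl //; lra.
  - rewrite mulrAC mulrC; apply: (@le_trans _ _ (e / M * (2 * (B ^+ 2 * Z)))).
      apply: ler_wpM2r; last by rewrite ge_min lexx orbT.
      by apply: mulr_ge0 => //; apply: mulr_ge0 => //; exact: sqr_ge0.
    by rewrite mulrAC ler_pdivrMr // ler_wpM2l ?(ltW e0) // lerDl.
apply/eqP; rewrite -subr_eq0; apply/eqP; apply: pos_antisym; apply: pos_eps => e /small[t [t0 tB te]].
  have := key t; rewrite gtr0_norm // => /(_ tB) /(posZ (ltW (_ : 0 < t^-1))); rewrite invr_gt0 => /(_ t0).
  rewrite scalerDr !scalerA mulVf ?gt_eqF // scale1r.
  have -> : t^-1 * (2 * t ^+ 2 * (B ^+ 2 * Z)) = 2 * t * (B ^+ 2 * Z) by field; rewrite gt_eqF.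
  move=> h; have := posD h (posk (_ : 0 <= e - 2 * t * (B ^+ 2 * Z))).
  by rewrite subr_ge0 => /(_ te); congr pos; linear_eq R.
have := key (- t); rewrite normrN gtr0_norm // => /(_ tB) /(posZ (ltW (_ : 0 < t^-1))).
rewrite invr_gt0 => /(_ t0); rewrite scalerDr !scalerA mulrN mulVf ?gt_eqF // scaleN1r.
have -> : t^-1 * (2 * (- t) ^+ 2 * (B ^+ 2 * Z)) = 2 * t * (B ^+ 2 * Z) by field; rewrite gt_eqF.
move=> h; have := posD h (posk (_ : 0 <= e - 2 * t * (B ^+ 2 * Z))).
by rewrite subr_ge0 => /(_ te); congr pos; linear_eq R.
Qed.

(* [r] is the range projection of the positive element [x]. *)
Definition is_rp x r := [/\ proj r,
  (forall C w, is_AS (jb_op A) C -> C \one -> C x -> C w -> r ** (x ** w) = x ** w),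
  (forall p, proj p -> p ** x = x -> p ** r = r)
  & (forall d, (forall w, geno x w -> d ** (x ** w) = 0) -> d ** r = 0)].

(** The supremum of 1 - (1 - x)^n. All these elements are multiples of [x] inside [geno x], so what
    annihilates the products [x ** w] annihilates the supremum, by [sup_mul]. *)
Lemma rp_ex1 x : pos x -> x <== \one -> exists r, is_rp x r.
Proof.
move=> px x1; pose y := \one - x; pose u n := \one - pw y n.
have hC := geno_AS x; have C1 := geno1 x; have Cx := geno_id x.
have Cy : geno x y by exact: (ASB hC).
have Cpw n : geno x (pw y n) by elim: n => //= n IH; exact: (ASM hC).
have pp n : pos (pw y n) by elim: n => //= n IH; exact: (posM hC).
have xpw n : x ** pw y n = pw y n - pw y n.+1.
  have G w : x ** w = w - y ** w by rewrite /y opBl op1l; linear_eq R.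
  exact: G.
have uS n : u n <== u n.+1.
  rewrite /jle /u; have := posM hC C1 Cx (Cpw n) px (pp n).
  by rewrite xpw; congr pos; linear_eq R.
have u1 n : u n <== \one.
  by have := pp n; rewrite /jle /u; congr pos; linear_eq R.
have [s [us smin]] := @jbw_sup _ A u uS (ex_intro _ \one u1).
(* The elements [x ** pw y n] decrease with [n] and their partial sums telescope to at most 1. *)
have dn n : `|x ** pw y n| <= n.+1%:R^-1.
  have h : n.+1%:R *: (x ** pw y n) <== y - pw y n.+1.
    elim: n => [|n IH]; first by rewrite xpw scale1r; exact: jle_refl.
    have h2 : pos (x ** pw y n - x ** pw y n.+1).
      rewrite -opBr -xpw -(ASA hC) //; apply: (posM hC) => //; [exact: (ASM hC)|exact: pos_sq].
    have h3 := jleZ (ler0n R n.+1) h2.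
    have := posD IH h3; rewrite /jle; congr pos.
    rewrite -[n.+2%:R]natr1 [x ** pw y n.+1]xpw; linear_eq R.
  have h1 : n.+1%:R *: (x ** pw y n) <== \one.
    apply: (jle_trans h); have := posD px (pp n.+1); rewrite /jle /y; congr pos; linear_eq R.
  have h0 : pos (n.+1%:R *: (x ** pw y n)) by apply: posZ => //; exact: (posM hC).
  have := norm_mono h0 h1; rewrite normrZ ger0_norm // => h4.
  by rewrite -[leRHS]mulr1 ler_pdivlMl // (le_trans h4) // norm_one.
have sxw C w : is_AS (jb_op A) C -> C \one -> C x -> C w -> s ** (x ** w) = x ** w.
  move=> hD D1 Dx Dw; have sub := geno_min hD D1 Dx; rewrite opC; apply: (sup_mul uS us smin) => e e0.
  have W0 : 0 < (`|w| + 1) / e by rewrite divr_gt0 // ltr_wpDl.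
  exists (Num.truncn ((`|w| + 1) / e)) => m hm.
  have -> : x ** w ** u m - x ** w = - (w ** (x ** pw y m)).
    rewrite /u opBr op1r (opC x w) (ASA hD) //; last exact: sub.
    linear_eq R.
  rewrite normrN (le_trans (op_norm _ _)) //.
  apply: (@le_trans _ _ ((`|w| + 1) * m.+1%:R^-1)).
    by apply: ler_pM => //; rewrite lerDl.
  rewrite ler_pdivrMr // -ler_pdivrMl // mulrC ltW //.
  by rewrite (lt_le_trans (truncnS_gt _)) // ler_nat ltnS.
have un n : exists2 w, geno x w & u n = x ** w.
  elim: n => [|n [w Cw hw]].
    by exists \one => //; rewrite op1r /u /= /y; linear_eq R.
  exists (w + pw y n); first exact: (ASD hC).
  by rewrite opDr -hw xpw /u; linear_eq R.
have ps : pos s.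
  have := posD (us 0%N) px; rewrite /u /= /y; congr pos; linear_eq R.
have s1 : s <== \one by exact: smin.
(* As s (u n) = u n, positivity of (s - u n)^2 gives s^2 >= 2 u n - (u n)^2, which is again a term
   of the sequence, with index 2n + 1. *)
have ss : proj s.
  have h1 : s ** s <== s.
    have := posM (geno_AS s) (geno1 s) (geno_id s) (ASB (geno_AS s) (geno1 s) (geno_id s)) ps s1.
    by rewrite opBr op1r.
  apply: jle_antisym => //; apply: smin => n.
  have [w Cw hw] := un n; have sun : s ** u n = u n by rewrite hw (sxw (geno x)).
  have h := pos_sq (s - u n).
  have e (a : A) : s ** a = a -> (s - a) ** (s - a) = s ** s - (2 *: a - a ** a).
    by move=> sa; rewrite !(opBl, opBr) (opC a s) sa; linear_eq R.
  rewrite (e _ sun) in h; apply: jle_trans h.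
  have -> : 2 *: u n - u n ** u n = u (n + n).+1.
    rewrite /u !(opBl, opBr, op1l, op1r) pwM; linear_eq R.
  by apply: jle_chain => //; rewrite -addnS leq_addr.
exists s; split=> //.
- move=> p pp0 px1.
  have p'x : (\one - p) ** x = 0 by rewrite opBl op1l px1 subrr.
  have pp' := proj_compl pp0.
  have cy : lcomm (\one - p) y.
    apply/(lcomm_proj _ pp'); apply: pcommB; last exact: pcomm0.
    by apply/pcommE; rewrite op1r pp'.
  have py : (\one - p) ** y = \one - p by rewrite /y opBr op1r p'x subr0.
  have ppw n : (\one - p) ** pw y n = \one - p.
    by elim: n => //= n IH; rewrite cy IH opC py.
  have : (\one - p) ** s = 0.
    apply: (sup_mul uS us smin) => e e0; exists 0%N => m _.
    by rewrite /u opBr op1r ppw !subrr normr0 ltW.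
  by rewrite opBl op1l => /eqP; rewrite subr_eq0 => /eqP.
- move=> d hd; apply: (sup_mul uS us smin) => e e0; exists 0%N => m _.
  by have [w Cw ->] := un m; rewrite hd // subrr normr0 ltW.
Qed.

Lemma geno_sub x C : is_AS (jb_op A) C -> C \one -> C x -> geno x `<=` C.
Proof. exact: geno_min. Qed.

Lemma rp_ex x : pos x -> exists r, is_rp x r.
Proof.
move=> px; pose k := `|x| + 1; have k0 : 0 < k by rewrite ltr_wpDl.
have ki : 0 <= k^-1 by rewrite invr_ge0 ltW.
have [|r [h1 h2 h3 h4]] := @rp_ex1 (k^-1 *: x) (posZ ki px).
  have h := jleZ ki (jle_norm x); rewrite scalerA in h; apply: (jle_trans h).
  rewrite -[X in _ <== X]scale1r /jle -scalerBl; apply: posk.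
  by rewrite subr_ge0 ler_pdivrMl // mulr1 lerDl.
have xE : x = k *: (k^-1 *: x) by rewrite scalerA mulfV ?gt_eqF // scale1r.
have gE w : geno x w <-> geno (k^-1 *: x) w.
  split; apply: geno_sub => //; try exact: geno_AS; try exact: geno1.
    by rewrite {2}xE; apply: (ASZ (geno_AS _)); exact: geno_id.
  by apply: (ASZ (geno_AS _)); exact: geno_id.
exists r; split=> //.
- move=> C w hC C1 Cx Cw; rewrite xE opZl opZr (h2 C) //; exact: (ASZ hC).
- by move=> p pp ppx; apply: h3 => //; rewrite opZr ppx.
- by move=> d hd; apply: h4 => w /gE gw; rewrite opZl opZr hd // scaler0.
Qed.

Definition rp x := xget 0 [set r | is_rp x r].
Lemma rpP x : pos x -> is_rp x (rp x).
Proof. by move=> px; rewrite /rp; case: xgetP => [w -> //|h]; case: (rp_ex px) => r /h. Qed.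

Lemma rp_proj x : pos x -> proj (rp x). Proof. by case/rpP. Qed.
Lemma rp_id x : pos x -> rp x ** x = x.
Proof. by case/rpP=> _ h _ _; have := h _ _ (geno_AS x) (geno1 x) (geno_id x) (geno1 x); rewrite op1r. Qed.
Lemma rp_min x p : pos x -> proj p -> p ** x = x -> p ** rp x = rp x.
Proof. by case/rpP=> _ _ h _; exact: h. Qed.
Lemma rp_min0 x p : pos x -> proj p -> p ** x = 0 -> p ** rp x = 0.
Proof.
move=> px pp h; have := @rp_min x (\one - p) px (proj_compl pp).
by rewrite !opBl !op1l h subr0 => /(_ erefl) /eqP; rewrite subr_eq addrC -subr_eq subrr => /eqP <-.
Qed.
Lemma rp_uniq x r : pos x -> proj r -> r ** x = x ->
  (forall p, proj p -> p ** x = x -> p ** r = r) -> rp x = r.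
Proof.
move=> px pr rx rm; rewrite -(rp_min px pr rx) opC; apply: rm; [exact: rp_proj|exact: rp_id].
Qed.
Lemma rp_proj_id p : proj p -> rp p = p.
Proof.
move=> pp; apply: rp_uniq => //; first exact: proj_pos.
Qed.

Lemma rp_orth C x y : is_AS (jb_op A) C -> C \one -> C x -> C y -> pos x ->
  x ** y = 0 -> rp x ** y = 0.
Proof.
move=> hC C1 Cx Cy px xy; case: (rpP px) => _ _ _ h; rewrite opC; apply: h => w gw.
by rewrite -(ASA hC) // ?(opC y) ?xy ?op0l //; exact: (geno_min hC C1 Cx).
Qed.

(** The difference of [b] and its reflection in r = rp x kills all [x ** w], hence kills [r]. It
    also lies in the half space of [r], so it is 0. *)
Lemma rp_comm C x b : is_AS (jb_op A) C -> C \one -> C x -> C b -> pos x -> pcomm (rp x) b.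
Proof.
move=> hC C1 Cx Cb px; case: (rpP px) => pr h _ hd.
have gC := geno_min hC C1 Cx.
have fixz w : C w -> refl (rp x) (x ** w) = x ** w.
  by move=> Cw; apply: refl_comm; apply: pcomm1; exact: (h C).
have d0 : (refl (rp x) b - b) ** rp x = 0.
  apply: hd => w /gC Cw; have Cxw := ASM hC Cx Cw; rewrite opBl -{1}(fixz w Cw) -reflM //.
  by rewrite (opC b) (ASA hC) // fixz ?subrr //; exact: (ASM hC).
have hE : refl (rp x) b - b = - 2 *: peirceh (rp x) b by rewrite reflE /peirceh; linear_eq R.
move: d0; rewrite hE opZl opC peircehP // => /eqP.
by rewrite !scaler_eq0 oppr_eq0 invr_eq0 !pnatr_eq0 /= => /eqP.
Qed.

Lemma rp_refl q x : proj q -> pos x -> refl q (rp x) = rp (refl q x).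
Proof.
move=> pq px; have px' := pos_refl pq px; apply/esym/rp_uniq => //.
- by apply: refl_proj => //; exact: rp_proj.
- by rewrite -reflM // rp_id.
move=> p pp ppx; have pp' := refl_proj pq pp.
have h : refl q p ** x = x by rewrite -[x in LHS](reflK pq) -reflM // ppx reflK.
have := rp_min px pp' h => h2.
by rewrite -[p in LHS](reflK pq) -reflM // h2.
Qed.

Lemma rp_le x y : pos x -> x <== y -> rp y ** rp x = rp x.
Proof.
move=> px xy; have py : pos y by have := posD xy px; rewrite subrK.
apply: rp_min => //; first exact: rp_proj.
by apply: (proj_face1 _ px xy); [exact: rp_proj|exact: rp_id].
Qed.

Lemma rp_rp_orth C x y : is_AS (jb_op A) C -> C \one -> C x -> C y -> pos x -> pos y ->
  x ** y = 0 -> rp x ** rp y = 0.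
Proof.
move=> hC C1 Cx Cy px py xy; apply: rp_min0 => //; first exact: rp_proj.
exact: (rp_orth hC).
Qed.

End RangeProjection.

(** * Spectral projections *)

Section Spectral.
Variables (R : realType) (A : jbwAlg R).
Implicit Types (a b c d s x y z u v w p q r f g : A) (k l t m h : R) (C : set A).

Lemma jplus_AS C x : is_AS (jb_op A) C -> C \one -> C x -> C (jplus x).
Proof. by move=> hC C1 Cx; apply: (geno_min hC C1 Cx); exact: jplus_geno. Qed.
Lemma ASk C k x : is_AS (jb_op A) C -> C \one -> C x -> C (x - k *: \one).
Proof. by move=> hC C1 Cx; apply: (ASB hC) => //; exact: (ASZ hC). Qed.

Lemma geno_k a k : geno a (a - k *: \one).
Proof. exact: (ASk k (geno_AS a) (geno1 a) (geno_id a)). Qed.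

Lemma rp_jminus x : rp (jplus x) ** jminus x = 0.
Proof.
apply: (rp_orth (geno_AS x) (geno1 x)) => //; try exact: jplus_pos; try exact: jplusM.
  exact: jplus_geno.
exact: jminus_geno.
Qed.

Lemma rp_jplus x : rp (jplus x) ** x = jplus x.
Proof. by rewrite -{2}(jplusB x) opBr rp_jminus subr0 rp_id //; exact: jplus_pos. Qed.

Lemma rp_jplus_comm C x b : is_AS (jb_op A) C -> C \one -> C x -> C b -> pcomm (rp (jplus x)) b.
Proof.
by move=> hC C1 Cx Cb; apply: (rp_comm hC) => //; [exact: jplus_AS|exact: jplus_pos].
Qed.

Lemma pcomm_sum p x : x = p ** x + (\one - p) ** x.
Proof. by rewrite opBl op1l addrC subrK. Qed.

Lemma jplus_le C x w : is_AS (jb_op A) C -> C \one -> C x -> C w -> pos w -> x <== w ->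
  jplus x <== w.
Proof.
move=> hC C1 Cx Cw pw xw; set e := rp (jplus x).
have pe : proj e by apply: rp_proj; exact: jplus_pos.
have Cu := jplus_AS hC C1 Cx.
rewrite /jle (pcomm_sum e (w - _)); apply: posD.
  have -> : e ** (w - jplus x) = e ** (w - x) by rewrite !opBr rp_jplus rp_id //; exact: jplus_pos.
  by apply: pos_pcomm => //; apply: (rp_jplus_comm hC) => //; exact: (ASB hC).
have -> : (\one - e) ** (w - jplus x) = (\one - e) ** w.
  rewrite opBr (opBl _ _ (jplus x)) op1l rp_id ?subrr ?subr0 //; exact: jplus_pos.
apply: pos_pcomm => //; first exact: proj_compl.
by apply: pcomm_compl; apply: (rp_jplus_comm hC).
Qed.

Lemma jplus_ge x : x <== jplus x.
Proof. by rewrite /jle -{2}(jplusB x) opprB addrC subrK; exact: jminus_pos. Qed.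

Lemma jplus_mono C x y : is_AS (jb_op A) C -> C \one -> C x -> C y -> x <== y ->
  jplus x <== jplus y.
Proof.
move=> hC C1 Cx Cy xy; apply: (jplus_le hC) => //; [exact: jplus_AS|exact: jplus_pos|].
exact: jle_trans xy (jplus_ge y).
Qed.
Lemma jminus_mono C x y : is_AS (jb_op A) C -> C \one -> C x -> C y -> x <== y ->
  jminus y <== jminus x.
Proof.
move=> hC C1 Cx Cy xy; rewrite !jminusN.
by apply: (jplus_mono hC) => //; [exact: (ASN hC)|exact: (ASN hC)|exact: jleN].
Qed.

Lemma jplus_id x : pos x -> jplus x = x.
Proof. by move=> px; apply: (@jplus_uniq _ _ x x 0) => //; rewrite ?op0r ?subr0 //; exact: pos0. Qed.
Lemma jplus_0 x : x <== 0 -> jplus x = 0.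
Proof.
move=> px; apply: (@jplus_uniq _ _ x 0 (- x)); rewrite ?op0l ?sub0r ?opprK //; first exact: pos0.
by move: px; rewrite /jle sub0r.
Qed.

(** The spectral projection of [a] for the open half-line above [k]. *)
Definition sp a k := rp (jplus (a - k *: \one)).

Lemma sp_proj a k : proj (sp a k). Proof. by apply: rp_proj; exact: jplus_pos. Qed.

Lemma sp_comm C a b k : is_AS (jb_op A) C -> C \one -> C a -> C b -> pcomm (sp a k) b.
Proof. by move=> hC C1 Ca Cb; apply: (rp_jplus_comm hC) => //; exact: ASk. Qed.

Lemma refl_sp q a k : proj q -> pcomm q a -> pcomm q (sp a k).
Proof.
move=> pq qa; apply: refl_fix => //; rewrite rp_refl //; last exact: jplus_pos.
congr rp; have e : refl q (a - k *: \one) = a - k *: \one.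
  by rewrite reflB reflZ refl1 // (refl_comm qa).
apply/esym/jplus_uniq.
- by apply: pos_refl => //; exact: jplus_pos.
- by apply: (pos_refl pq); exact: (jminus_pos (a - k *: \one)).
- by rewrite -reflM // jplusM reflE !opE; linear_eq R.
- by rewrite -reflB jplusB e.
Qed.

Lemma sp_sp_comm a k l : pcomm (sp a k) (sp a l).
Proof.
apply: refl_sp; first exact: sp_proj.
exact: (sp_comm _ (geno_AS a) (geno1 a) (geno_id a) (geno_id a)).
Qed.

Lemma sp_le a k l : k <= l -> sp a k ** sp a l = sp a l.
Proof.
move=> kl; apply: rp_le; first exact: jplus_pos.
apply: (jplus_mono (geno_AS a) (geno1 a)).
- exact: geno_k.
- exact: geno_k.
have : pos ((l - k) *: (\one : A)) by apply: posk; rewrite subr_ge0.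
by rewrite /jle; congr pos; linear_eq R.
Qed.

Lemma sp_mul a k l : sp a k ** sp a l = sp a (Num.max k l).
Proof.
have [kl|lk] := leP k l; first by rewrite sp_le.
by rewrite opC sp_le // ltW.
Qed.

Section Chain.
Variables (a : A) (h : R).
Hypothesis h0 : 0 < h.
Let hC := geno_AS a.
Let C1 := geno1 a.
Let Ca := geno_id a.
Let t k := a - k *: \one.
Let Ct k : geno a (t k). Proof. exact: geno_k. Qed.
(** The slice of [a] between the levels k and k + h. Slices telescope, and each lies between [h]
    times the spectral projections at its two levels. *)
Let m k := jplus (t k) - jplus (t (k + h)).
Let tt k : t (k + h) <== t k.
Proof. by have := posk (A := A) (ltW h0); rewrite /jle /t; congr pos; linear_eq R. Qed.

Let chain_low k : h *: sp a (k + h) <== m k.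
Proof.
set e := sp a (k + h); have pe : proj e by exact: sp_proj.
have ce x : geno a x -> pcomm e x by exact: (sp_comm _ hC).
have e1 : e ** jplus (t (k + h)) = jplus (t (k + h)) by apply: rp_id; exact: jplus_pos.
have em : e ** jminus (t k) = 0.
  apply: (@proj_face _ _ e (jminus (t k)) (jminus (t (k + h)))) => //; first exact: jminus_pos.
    exact: (jminus_mono hC).
  exact: rp_jminus.
have e2 : e ** jplus (t k) = jplus (t (k + h)) + h *: e.
  have -> : e ** jplus (t k) = e ** t k by rewrite -{2}(jplusB (t k)) opBr em subr0.
  have -> : t k = t (k + h) + h *: \one by rewrite /t; linear_eq R.
  by rewrite opDr opZr op1r rp_jplus.
rewrite /jle (pcomm_sum e (m k)) {1}/m opBr e2 e1.
have -> : (\one - e) ** m k = (\one - e) ** jplus (t k).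
  by rewrite /m opBr (opBl _ _ (jplus (t (k + h)))) op1l e1 subrr subr0.
have := pos_pcomm (proj_compl pe) (pcomm_compl (ce _ (jplus_AS hC C1 (@Ct k)))) (jplus_pos (t k)).
by congr pos; linear_eq R.
Qed.

Let chain_high k : m k <== h *: sp a k.
Proof.
set e := sp a k; have pe : proj e by exact: sp_proj.
have ce x : geno a x -> pcomm e x by exact: (sp_comm _ hC).
have Cu := jplus_AS hC C1 (@Ct k); have Cv := jplus_AS hC C1 (@Ct (k + h)).
have e1 : e ** jplus (t k) = jplus (t k) by apply: rp_id; exact: jplus_pos.
have e2 : e ** jplus (t (k + h)) = jplus (t (k + h)).
  apply: (@proj_face1 _ _ e _ (jplus (t k))) => //; first exact: jplus_pos.
  exact: (jplus_mono hC).
have mh : m k <== h *: \one.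
  have : jplus (t k) <== jplus (t (k + h)) + h *: \one.
    apply: (jplus_le hC) => //; first by apply: (ASD hC) => //; exact: (ASZ hC).
      by apply: posD; [exact: jplus_pos|exact/posk/ltW].
    have := jplus_ge (t (k + h)); rewrite /jle {2 4}/t; congr pos; linear_eq R.
  by rewrite /jle /m; congr pos; linear_eq R.
have ch : pcomm e (h *: \one - m k).
  by apply: ce; apply: (ASB hC); [exact: (ASZ hC)|exact: (ASB hC)].
have := pos_pcomm pe ch mh; rewrite /jle /m !opBr opZr op1r e1 e2.
by congr pos; linear_eq R.
Qed.

Lemma spectral_chain (N : nat) : pos a -> a <== (N%:R * h) *: \one ->
  `|a - h *: \sum_(i < N) sp a (i.+1%:R * h)| <= h.
Proof.
move=> pa aN; set S := \sum_(i < N) _.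
have aE : a = \sum_(i < N) m (i%:R * h).
  have H M : \sum_(i < M) m (i%:R * h) = jplus a - jplus (t (M%:R * h)).
    elim: M => [|M IH]; first by rewrite big_ord0 /t mul0r scale0r subr0 subrr.
    have e : M.+1%:R * h = M%:R * h + h by rewrite -natr1 mulrDl mul1r.
    rewrite big_ord_recr /= IH e.
    have -> : m (M%:R * h) = jplus (t (M%:R * h)) - jplus (t (M%:R * h + h)) by [].
    linear_eq R.
  rewrite H jplus_id // jplus_0 ?subr0 //.
  by move: aN; rewrite /jle /t; congr pos; linear_eq R.
have low M : h *: \sum_(i < M) sp a (i.+1%:R * h) <== \sum_(i < M) m (i%:R * h).
  elim: M => [|M IH]; first by rewrite !big_ord0 scaler0; exact: jle_refl.
  rewrite !big_ord_recr scalerDr; apply: jleD => //=.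
  by rewrite -natr1 mulrDl mul1r; exact: chain_low.
have high M : \sum_(i < M) m (i%:R * h) <== h *: (\one + \sum_(i < M) sp a (i.+1%:R * h)).
  have hs M' : \sum_(i < M') m (i%:R * h) <== h *: \sum_(i < M') sp a (i%:R * h).
    elim: M' => [|M' IH]; first by rewrite !big_ord0 scaler0; exact: jle_refl.
    rewrite !big_ord_recr scalerDr; apply: jleD => //=; exact: chain_high.
  apply: (jle_trans (hs M)); apply: jleZ; first exact: ltW.
  case: M => [|M]; first by rewrite !big_ord0 addr0 /jle subr0; exact: pos1.
  rewrite big_ord_recl big_ord_recr /=; apply: jleD; first by apply: proj_le1; exact: sp_proj.
  have -> : \sum_(i < M) sp a ((lift ord0 i)%:R * h) = \sum_(i < M) sp a (i.+1%:R * h).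
    by apply: eq_bigr => i _; rewrite lift0.
  rewrite /jle addrAC subrr add0r; apply: proj_pos; exact: sp_proj.
rewrite {1}aE; apply: norm_le; first exact: ltW.
  apply: (@jle_trans _ _ 0); first by rewrite /jle sub0r opprK; exact/posk/ltW.
  rewrite /jle subr0; exact: low.
have := high N; rewrite /jle -/S; congr pos; linear_eq R.
Qed.

(** The second difference compares two consecutive slices, which are separated by [h] times the
    spectral projection at their common level. *)
Lemma jplus_convex k : pos (jplus (a - k *: \one) - 2 *: jplus (a - (k + h) *: \one) +
  jplus (a - (k + h + h) *: \one)).
Proof.
have := jle_trans (chain_high (k + h)) (chain_low k); rewrite /m /t /jle; congr pos.
linear_eq R.
Qed.
End Chain.

Definition spfam a : set A := [set \one] `|` range (sp a).

Lemma spfam_proj a p : spfam a p -> proj p.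
Proof. by move=> [->|[k _ <-]]; [rewrite /proj op1l|exact: sp_proj]. Qed.
Lemma spfam_mul a p q : spfam a p -> spfam a q -> spfam a (p ** q).
Proof.
move=> [->|[k _ <-]] [->|[l _ <-]]; rewrite ?op1l ?op1r; first by left.
- by right; exists l.
- by right; exists k.
- by right; exists (Num.max k l) => //; rewrite sp_mul.
Qed.
Lemma spfam_comm a p q : spfam a p -> spfam a q -> pcomm p q.
Proof.
move=> [->|[k _ <-]] [->|[l _ <-]]; try by apply/pcommE; rewrite ?op1l ?op1r.
  by apply/pcommE; rewrite op1r; exact: sp_proj.
exact: sp_sp_comm.
Qed.
Lemma spfam_AS a : is_AS (jb_op A) (closure (lspan (spfam a))).
Proof.
apply: AS_closure_lspan; first exact: spfam_mul.
by move=> p q hp hq; apply/(lcomm_proj _ (spfam_proj hp)); exact: spfam_comm hq.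
Qed.

Lemma exists_grid (a : A) (e : R) : 0 < e ->
  exists (h : R) (N : nat), [/\ 0 < h, h < e & `|a| <= N%:R * h].
Proof.
move=> e0; pose h := e / 2; have hp : 0 < h by rewrite divr_gt0.
exists h, (Num.truncn (`|a| / h)).+1; split => //; first by rewrite /h; lra.
by rewrite -ler_pdivrMr // ltW // truncnS_gt.
Qed.

Lemma spfam_dense a : closure (lspan (spfam a)) a.
Proof.
suff H c : pos c -> closure (lspan (spfam c)) c.
  have pc : pos (a + `|a| *: \one) by have := jle_normN a; rewrite /jle opprK.
  have hS := spfam_AS a.
  have S1 : closure (lspan (spfam a)) \one by apply: subset_closure; apply: lspan_gen; left.
  suff h : closure (lspan (spfam a)) (a + `|a| *: \one).
    by have := ASB hS h (ASZ hS `|a| S1); rewrite addrK.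
  have := H _ pc; apply: closure_subset => x; elim=> [|k u v su _ IH]; first exact: lspan0.
  apply: lspanS => //; case: su => [->|[l _ <-]]; [by left|right].
  by exists (l - `|a|) => //; rewrite /sp; congr (rp (jplus _)); linear_eq R.
move=> pc; apply/closure_normP => e e0.
have [h [N [h0 he hN]]] := exists_grid c e0.
exists (h *: \sum_(i < N) sp c (i.+1%:R * h)).
  apply: lspanZ; elim: (N) => [|M IH]; first by rewrite big_ord0; exact: lspan0.
  by rewrite big_ord_recr; apply: lspanD => //; apply: lspan_gen; right; eexists.
apply: le_lt_trans he; apply: spectral_chain => //.
have [_] := norm_leP hN; exact.
Qed.

Lemma lspan_sub (F G : set A) : F `<=` G -> lspan F `<=` lspan G.
Proof.
move=> FG x; elim=> [|k u v Fu _ IH]; first exact: lspan0.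
by apply: lspanS => //; exact: FG.
Qed.

Lemma proj_dense a : closure (lspan (@proj R A)) a.
Proof.
have := @spfam_dense a; apply: closure_subset; apply: lspan_sub; exact: spfam_proj.
Qed.

Lemma peirce1_le f q z : proj f -> q ** f = f -> f ** z = z -> proj q -> q ** z = z.
Proof.
move=> pf qf fz pq.
have := peirce10 pf fz (_ : f ** (\one - q) = 0).
by rewrite opBr op1r (opC f) qf subrr => /(_ erefl); rewrite opBr op1r => /eqP; rewrite subr_eq0 opC => /eqP <-.
Qed.

(** [U_f] annihilates the half space of [q]: its value there is an eigenvector of [q] both for 1,
    lying under [f], and for 1/2, since multiplication by [f] preserves that space. *)
Lemma peirce1_tower f q x : proj f -> proj q -> q ** f = f -> peirce1 f (peirce1 q x) = peirce1 f x.
Proof.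
move=> pf pq qf; move: (peirce_sum q x) (peircehP x pq) (peirce0P x pq).
move: (peirce1 q x) (peirceh q x) (peirce0 q x) => x1 y x0 -> qy q0.
rewrite !peirce1D (peirce1_0 (x := x0)); last exact: (peirce10 pq qf).
have h1 : q ** peirce1 f y = peirce1 f y by apply: (peirce1_le pf qf) => //; exact: peirce1P.
have h2 : q ** peirce1 f y = 2^-1 *: peirce1 f y.
  have fy := peirce1h pq qf qy; rewrite /peirce1 opBr opZr fy (peirce1h pq qf fy); linear_eq R.
have -> : peirce1 f y = 0 by rewrite h1 in h2; linear_from R h2.
by rewrite !addr0.
Qed.

(** On a grid of mesh below [e], take the last nonzero spectral projection of the compressed
    element: under it the element lies between two consecutive levels. *)
Lemma excise1 q x (e : R) : proj q -> q != 0 -> 0 < e ->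
  exists f m, [/\ proj f, f != 0, q ** f = f & `|peirce1 f x - m *: f| <= e].
Proof.
move=> pq q0 e0; pose a := peirce1 q x; have qa : q ** a = a by exact: peirce1P.
pose b := a + `|a| *: q.
have qb : q ** b = b by rewrite /b opDr opZr qa pq.
have pb : pos b.
  have := pos_pcomm pq _ (_ : pos (a + `|a| *: \one)); rewrite opDr opZr op1r qa; apply.
    by apply: pcommD; [exact: pcomm1|apply/pcommE; rewrite !opZr op1r pq].
  by have := jle_normN a; rewrite /jle opprK.
have [h [N [h0 he hN]]] := exists_grid b e0.
(* At level 0 the projection [q] replaces [sp b 0], which could be 0; so the chain starts at a
   nonzero projection. *)
pose g (k : nat) := if k is 0%N then q else sp b (k%:R * h).
have pg (k : nat) : proj (g k) by case: k => [//|k]; exact: sp_proj.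
have qg (k : nat) : q ** g k = g k.
  case: k => [|k] //; apply: rp_min => //; first exact: jplus_pos.
  apply: (@proj_face1 _ _ q _ b) => //; first exact: jplus_pos.
  rewrite -{2}(jplus_id pb); apply: (jplus_mono (geno_AS b) (geno1 b)).
  - exact: geno_k.
  - exact: geno_id.
  have := posk (A := A) (_ : 0 <= k.+1%:R * h); rewrite mulr_ge0 ?ltW // => /(_ isT).
  by rewrite /jle; congr pos; linear_eq R.
have gN : g N.+1 = 0.
  rewrite /g /sp jplus_0 ?rp_proj_id // ?/proj ?op0l //.
  have [_ bN] := norm_leP hN; have := posD bN (posk (A := A) (ltW h0)).
  by rewrite /jle -natr1; congr pos; linear_eq R.
have [k gk gk1] : exists2 k, g k != 0 & g k.+1 = 0.
  elim: (N) gN => [|M IH] gM; first by exists 0%N.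
  have [e1|n1] := eqVneq (g M.+1) 0; first exact: IH.
  by exists M.+1.
exists (g k), (k%:R * h - `|a|); split => //.
rewrite -(peirce1_tower _ (pg k) pq (qg k)) -/a.
have aE : a = b - `|a| *: q by rewrite /b; linear_eq R.
rewrite {1}aE.
have gq : g k ** q = g k by rewrite opC qg.
have gb : pcomm (g k) b.
  case: (k) => [|j]; first exact: pcomm1.
  exact: (sp_comm _ (geno_AS b) (geno1 b) (geno_id b) (geno_id b)).
have -> : peirce1 (g k) (b - `|a| *: q) = g k ** b - `|a| *: g k.
  rewrite peirce1B (peirce1_comm gb) peirce1_comm ?opZr ?gq //.
  by apply: pcommZ; apply/pcommE; rewrite gq pg.
have -> : g k ** b - `|a| *: g k - (k%:R * h - `|a|) *: g k = g k ** (b - (k%:R * h) *: \one).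
  by rewrite opBr opZr op1r; linear_eq R.
set c := b - _; have gc : pcomm (g k) c.
  by apply: pcommB => //; apply: pcommZ; apply/pcommE; rewrite op1r pg.
have low : pos (g k ** c).
  rewrite /c; case: (k) => [|j].
    by rewrite mul0r scale0r subr0 /= qb.
  by rewrite /= rp_jplus; exact: jplus_pos.
have high : g k ** c <== h *: g k.
  have bh : b <== (k.+1%:R * h) *: \one.
    have := jplus_ge (b - (k.+1%:R * h) *: \one).
    have -> : jplus (b - (k.+1%:R * h) *: \one) = 0.
      have gk2 : rp (jplus (b - (k.+1%:R * h) *: \one)) = 0 by [].
      by have := rp_id (jplus_pos (b - (k.+1%:R * h) *: \one)); rewrite gk2 op0l.
    by rewrite /jle; congr pos; linear_eq R.
  have ch : pcomm (g k) (h *: \one - c).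
    by apply: pcommB => //; apply: pcommZ; apply/pcommE; rewrite op1r pg.
  have := pos_pcomm (pg k) ch; rewrite opBr opZr op1r; apply.
  move: bh; rewrite /jle /c -natr1; congr pos; linear_eq R.
rewrite (le_trans (norm_mono low high)) // normrZ gtr0_norm //.
by rewrite (le_trans _ (ltW he)) // ler_piMr ?norm_proj // ltW.
Qed.

End Spectral.

(** * Exchanged projections *)

HB.lock Definition sgn (R : realType) (A : jbwAlg R) (x : A) : A := rp (jplus x) - rp (jminus x).
HB.lock Definition supp (R : realType) (A : jbwAlg R) (x : A) : A := rp (jplus x) + rp (jminus x).

Section Exchange.
Variables (R : realType) (A : jbwAlg R).
Implicit Types (a b c d s x y z u v w p q r e f g : A) (k l t m h : R) (C : set A).

Lemma refl_0 q : refl q 0 = 0.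
Proof. by rewrite reflE !op0r; linear_eq R. Qed.

Lemma jplus_refl q x : proj q -> refl q (jplus x) = jplus (refl q x).
Proof.
move=> pq; apply/esym/(@jplus_uniq _ _ _ _ (refl q (jminus x))).
- by apply: pos_refl => //; exact: jplus_pos.
- by apply: pos_refl => //; exact: jminus_pos.
- by rewrite -reflM // jplusM refl_0.
- by rewrite -reflB jplusB.
Qed.
Lemma jminus_refl q x : proj q -> refl q (jminus x) = jminus (refl q x).
Proof. by move=> pq; rewrite !jminusN jplus_refl // reflN. Qed.

Lemma sgnE x : sgn x = rp (jplus x) - rp (jminus x). Proof. by rewrite sgn.unlock. Qed.
Lemma suppE x : supp x = rp (jplus x) + rp (jminus x). Proof. by rewrite supp.unlock. Qed.

Lemma sgn_refl q x : proj q -> refl q (sgn x) = sgn (refl q x).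
Proof.
move=> pq; rewrite !sgnE reflB !rp_refl ?jplus_refl ?jminus_refl //.
  exact: jminus_pos.
exact: jplus_pos.
Qed.
Lemma supp_refl q x : proj q -> refl q (supp x) = supp (refl q x).
Proof.
move=> pq; rewrite !suppE reflD !rp_refl ?jplus_refl ?jminus_refl //.
  exact: jminus_pos.
exact: jplus_pos.
Qed.
Lemma sgnN x : sgn (- x) = - sgn x.
Proof. by rewrite !sgnE !jminusN opprK opprB. Qed.

Lemma rp_pm_orth x : rp (jplus x) ** rp (jminus x) = 0.
Proof.
apply: (rp_rp_orth (geno_AS x) (geno1 x)); first exact: jplus_geno.
- exact: jminus_geno.
- exact: jplus_pos.
- exact: jminus_pos.
- exact: jplusM.
Qed.

Lemma sgn_sq x : sgn x ** sgn x = supp x.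
Proof.
rewrite !sgnE !suppE !opE (opC (rp (jminus x)) (rp (jplus x))) rp_pm_orth.
rewrite !rp_proj; [linear_eq R|exact: jminus_pos|exact: jplus_pos].
Qed.
Lemma supp_proj x : proj (supp x).
Proof.
rewrite /proj !suppE !opE (opC (rp (jminus x)) (rp (jplus x))) rp_pm_orth.
rewrite !rp_proj; [linear_eq R|exact: jminus_pos|exact: jplus_pos].
Qed.
Lemma supp_sgn x : supp x ** sgn x = sgn x.
Proof.
rewrite !sgnE !suppE !opE (opC (rp (jminus x)) (rp (jplus x))) rp_pm_orth.
rewrite !rp_proj; [linear_eq R|exact: jminus_pos|exact: jplus_pos].
Qed.

Lemma rp_jminus_jplus x : rp (jminus x) ** jplus x = 0.
Proof.
apply: (rp_orth (geno_AS x) (geno1 x)); first exact: jminus_geno.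
- exact: jplus_geno.
- exact: jminus_pos.
- by rewrite opC jplusM.
Qed.

Lemma jabsE x : jabs x = jplus x + jminus x.
Proof. rewrite /jplus /jminus; linear_eq R. Qed.

Lemma sgn_supp_id x : sgn x ** jabs x = x /\ supp x ** x = x.
Proof.
have h1 := rp_jminus x; have h2 := rp_jminus_jplus x.
have h3 := rp_id (jplus_pos x); have h4 := rp_id (jminus_pos x).
suff H a b c d : a ** d = 0 -> b ** c = 0 -> a ** c = c -> b ** d = d ->
    (a - b) ** (c + d) = c - d /\ (a + b) ** (c - d) = c - d.
  by have := H _ _ _ _ h1 h2 h3 h4; rewrite jplusB -jabsE -sgnE -suppE.
by move=> g1 g2 g3 g4; rewrite !opE g1 g2 g3 g4; split; linear_eq R.
Qed.
Lemma sgn_abs x : sgn x ** jabs x = x. Proof. by case: (sgn_supp_id x). Qed.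
Lemma supp_id x : supp x ** x = x. Proof. by case: (sgn_supp_id x). Qed.

Lemma sq_peirce0 p z : proj p -> p ** (z ** z) = 0 -> p ** z = 0.
Proof.
move=> pp pz; have h : peirce1 p (z ** z) = 0 by exact: peirce1_0.
move: h; rewrite {1 2}(peirce_sum p z) peirce1_sq ?peirce1P ?peircehP ?peirce0P // => h.
have ph : pos (p ** (peirceh p z ** peirceh p z)).
  apply: pos_pcomm => //; last exact: pos_sq.
  by apply: peircehh => //; exact: peircehP.
have a0 : peirce1 p z = 0 by apply: sq_eq0; exact: posD_eq0 (pos_sq _) ph h.
have h0 : peirceh p z = 0.
  apply: (half_sq0_eq0 pp (peircehP _ pp)); apply: (posD_eq0 ph (pos_sq (peirce1 p z))).
  by rewrite addrC.
by rewrite (peirce_sum p z) a0 h0 !add0r peirce0P.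
Qed.

Lemma compl_id p x : (\one - p) ** x = 0 <-> p ** x = x.
Proof.
rewrite opBl op1l; split=> [/eqP|->]; last by rewrite subrr.
by rewrite subr_eq0 => /eqP <-.
Qed.

Lemma supp_min p x : proj p -> p ** x = x -> p ** supp x = supp x.
Proof.
move=> pp /compl_id px; have pp' := proj_compl pp; apply/compl_id.
have [_ _ hs] := jabsP x.
have pa : (\one - p) ** jabs x = 0 by apply: sq_peirce0 => //; rewrite hs peirce00.
rewrite !suppE opDr !rp_min0 ?addr0 //; try exact: jplus_pos; try exact: jminus_pos.
  by rewrite /jminus opZr opBr pa px subrr scaler0.
by rewrite /jplus opZr opDr pa px addr0 scaler0.
Qed.
Lemma supp_min0 p x : proj p -> p ** x = 0 -> p ** supp x = 0.
Proof.
move=> pp px; have := @supp_min (\one - p) x (proj_compl pp).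
by rewrite !opBl !op1l px subr0 => /(_ erefl)/eqP; rewrite subr_eq addrC -subr_eq subrr => /eqP <-.
Qed.
Lemma supp_sq x : supp (x ** x) = supp x.
Proof.
have pa := supp_proj (x ** x); have ps := supp_proj x.
have h1 : supp x ** supp (x ** x) = supp (x ** x).
  by apply: supp_min => //; apply: peirce11 => //; exact: supp_id.
have h2 : supp (x ** x) ** supp x = supp x.
  apply: supp_min => //; apply/compl_id; apply: sq_peirce0; first exact: proj_compl.
  by apply/compl_id; exact: supp_id.
by rewrite -h2 opC.
Qed.
Lemma supp_eq0 x : supp x = 0 -> x = 0.
Proof. by move=> h; rewrite -(supp_id x) h op0l. Qed.

(** In matrix terms [e] and [f] are two diagonal units and [u] is the symmetric off-diagonal unit
    joining them. *)
Definition exch e f u :=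
  [/\ proj e, proj f, e ** f = 0, u ** u = e + f & e ** u = 2^-1 *: u /\ f ** u = 2^-1 *: u].

Lemma exchC e f u : exch e f u -> exch f e u.
Proof.
by case=> pe pf ef uu [eu fu]; split => //; [rewrite opC|rewrite addrC].
Qed.

Lemma proj_orthD p q : proj p -> proj q -> p ** q = 0 -> proj (p + q).
Proof. by move=> pp pq h; rewrite /proj !opE pp pq (opC q p) h; linear_eq R. Qed.

Lemma half_half p q x : p ** x = 2^-1 *: x -> q ** x = 2^-1 *: x -> (p + q) ** x = x.
Proof. by move=> hp hq; rewrite opDl hp hq; linear_eq R. Qed.

(* The polar decomposition of [x]. *)
Lemma link_exch p q x : proj p -> proj q -> p ** q = 0 ->
  p ** x = 2^-1 *: x -> q ** x = 2^-1 *: x ->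
  [/\ exch (p ** supp x) (q ** supp x) (sgn x), p ** (p ** supp x) = p ** supp x
    & q ** (q ** supp x) = q ** supp x].
Proof.
move=> pp pq pq0 px qx; set u := sgn x; set r := supp x.
have up g : proj g -> g ** x = 2^-1 *: x -> g ** u = 2^-1 *: u /\ pcomm g r.
  move=> pg gx; have gu : g ** u = 2^-1 *: u.
    by apply: (refl_anti pg); rewrite sgn_refl // (refl_half gx) sgnN.
  by split => //; rewrite /r -sgn_sq; exact: peircehh.
have [pu pr] := up p pp px; have [qu qr] := up q pq qx.
have rr : proj r by exact: supp_proj.
have ru : r ** u = u by exact: supp_sgn.
have pS : proj (p + q) by exact: proj_orthD.
have sr : (p + q) ** r = r.
  by rewrite /r -sgn_sq; apply: peirce11 => //; exact: half_half.
have half g : proj g -> pcomm g r -> g ** u = 2^-1 *: u -> (g ** r) ** u = 2^-1 *: u.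
  move=> pg gr gu; rewrite opC (opC g r).
  have gr' : pcomm r u by exact: pcomm1.
  by rewrite -(pcomm_mulA g rr gr') (opC u g) gu opZr ru.
have gg g : proj g -> pcomm g r -> proj (g ** r).
  move=> pg gr; rewrite /proj; have /pcommE ggr := gr.
  have g1 : pcomm g (g ** r) by exact: pcomm1.
  rewrite -(pcomm_mulA r pg g1) (opC (g ** r)).
  have rg : pcomm r g by apply/(lcomm_proj _ rr); apply/lcommC/(lcomm_proj _ pg).
  have : r ** (g ** r) = g ** r by have /pcommE := rg; rewrite (opC r g).
  by move=> ->.
split; [split => //|by have /pcommE := pr|by have /pcommE := qr].
- exact: gg.
- exact: gg.
- have h1 : p ** (p ** r) = p ** r by have /pcommE := pr.
  apply: (peirce10 pp h1).
  have -> : q ** r = r - p ** r by rewrite -{2}sr opDl addrC addKr.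
  by rewrite opBr h1 subrr.
- by rewrite sgn_sq -/r -opDl sr.
- by split; exact: half.
Qed.

(** The symmetry s acting as [u] on the corner of e + f and as 1 outside. As (1 + s)/2 is a
    projection, the automorphism [U_s] is one of the reflections [refl]; this is [swap u]. *)
Definition exsym u := u + \one - u ** u.
Definition swap u := refl (2^-1 *: (\one + exsym u)).

Lemma exch_unit e f u : exch e f u -> (e + f) ** u = u.
Proof. by case=> _ _ _ _ [eu fu]; exact: half_half. Qed.
Lemma exch_proj e f u : exch e f u -> proj (e + f).
Proof. by case=> pe pf ef _ _; exact: proj_orthD. Qed.

Lemma exsymE e f u x : exch e f u -> exsym u ** x = u ** x + x - e ** x - f ** x.
Proof. by case=> pe pf ef uu _; rewrite /exsym uu opBl opDl op1l opDl; linear_eq R. Qed.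

Lemma exsym_sq e f u : exch e f u -> exsym u ** exsym u = \one.
Proof.
move=> E; have [pe pf ef uu _] := E; have hu := exch_unit E; have hp := exch_proj E.
rewrite /exsym uu; move: (e + f) hu hp uu => g hu hp uu.
by rewrite !opBl !opBr !opDl !opDr !op1l !op1r hp (opC u g) hu uu; linear_eq R.
Qed.

Lemma exsym_proj e f u : exch e f u -> proj (2^-1 *: (\one + exsym u)).
Proof.
move=> E; have := exsym_sq E; move: (exsym u) => s h.
by rewrite /proj opZl opZr opDl !opDr !op1l op1r h; linear_eq R.
Qed.

Lemma swapE u x : swap u x = 2 *: (exsym u ** (exsym u ** x)) - x.
Proof.
rewrite /swap reflE; move: (exsym u) => s.
by rewrite !opZl !opDl !op1l !opZr !opDr; linear_eq R.
Qed.

Section Swap.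
Variables (e f u : A).
Hypothesis E : exch e f u.
Let pe : proj e. Proof. by case: E. Qed.
Let pf : proj f. Proof. by case: E. Qed.
Let ef : e ** f = 0. Proof. by case: E. Qed.
Let uu : u ** u = e + f. Proof. by case: E. Qed.
Let eu : e ** u = 2^-1 *: u. Proof. by case: E => _ _ _ _ []. Qed.
Let fu : f ** u = 2^-1 *: u. Proof. by case: E => _ _ _ _ []. Qed.
Let ph := exsym_proj E.

Lemma swapD x y : swap u (x + y) = swap u x + swap u y. Proof. exact: reflD. Qed.
Lemma swapZ k x : swap u (k *: x) = k *: swap u x. Proof. exact: reflZ. Qed.
Lemma swapB x y : swap u (x - y) = swap u x - swap u y. Proof. exact: reflB. Qed.
Lemma swapM x y : swap u (x ** y) = swap u x ** swap u y.
Proof. exact: reflM. Qed.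
Lemma swapK x : swap u (swap u x) = x.
Proof. exact: reflK. Qed.

Lemma swap_e : swap u e = f.
Proof.
rewrite swapE (exsymE e E) (opC u e) eu pe (opC f e) ef.
have -> : 2^-1 *: u + e - e - 0 = 2^-1 *: u by linear_eq R.
by rewrite opZr (exsymE u E) uu eu fu; linear_eq R.
Qed.
Lemma swap_0 x : e ** x = 0 -> f ** x = 0 -> swap u x = x.
Proof.
move=> ex fx; have S0 : (e + f) ** x = 0 by rewrite opDl ex fx addr0.
have ux : u ** x = 0.
  by rewrite opC opC; exact: (peirce10 (exch_proj E) (exch_unit E) S0).
have h : exsym u ** x = x by rewrite (exsymE x E) ux ex fx; linear_eq R.
by rewrite swapE !h; linear_eq R.
Qed.
End Swap.

Section Frame.
Variables (e1 e2 e3 u v : A).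
Hypotheses (E : exch e1 e2 u) (F : exch e1 e3 v) (e23 : e2 ** e3 = 0).
Let w := 2 *: (u ** v).

Let p1 : proj e1. Proof. by case: E. Qed.
Let p2 : proj e2. Proof. by case: E. Qed.
Let p3 : proj e3. Proof. by case: F. Qed.
Let e12 : e1 ** e2 = 0. Proof. by case: E. Qed.
Let e13 : e1 ** e3 = 0. Proof. by case: F. Qed.
Let e1u : e1 ** u = 2^-1 *: u. Proof. by case: E => _ _ _ _ []. Qed.
Let e2u : e2 ** u = 2^-1 *: u. Proof. by case: E => _ _ _ _ []. Qed.
Let e1v : e1 ** v = 2^-1 *: v. Proof. by case: F => _ _ _ _ []. Qed.
Let e3v : e3 ** v = 2^-1 *: v. Proof. by case: F => _ _ _ _ []. Qed.

Lemma frame_cross : e3 ** u = 0 /\ e2 ** v = 0.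
Proof.
split; rewrite opC.
  apply: (peirce10 (exch_proj E) (exch_unit E)); by rewrite opDl e13 e23 addr0.
apply: (peirce10 (exch_proj F) (exch_unit F)).
by rewrite opDl (opC e3) e12 e23 addr0.
Qed.

Lemma frame_w : [/\ e1 ** w = 0, e2 ** w = 2^-1 *: w & e3 ** w = 2^-1 *: w].
Proof.
have [e3u e2v] := frame_cross.
have h2 : e2 ** w = 2^-1 *: w.
  by rewrite /w opZr (opC u v) (peirce0h p2 e2v e2u) !scalerA mulrC.
have h3 : e3 ** w = 2^-1 *: w.
  by rewrite /w opZr (peirce0h p3 e3u e3v) !scalerA mulrC.
split => //; rewrite opC; apply: (peirce10 (proj_orthD p2 p3 e23)).
  exact: half_half.
by rewrite opDl (opC e2) (opC e3) e12 e13 addr0.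
Qed.

(** The exchange of [e1] and [e3] by [v] is transported by [swap u] to one of [e2] and [e3]. That
    [swap u v] equals [w] holds because their difference lies in the half space of [e1] while both
    are orthogonal to [e1]. *)
Lemma frame_exch : exch e2 e3 w /\ u ** w = 2^-1 *: v.
Proof.
have [e3u e2v] := frame_cross; have [e1w e2w e3w] := frame_w.
have uv : u ** v = 2^-1 *: w by rewrite /w; linear_eq R.
move: (w) e1w e2w e3w uv => z e1w e2w e3w uv.
have sv : swap u v = z + (u ** z - 2^-1 *: v).
  rewrite swapE (exsymE v E) e1v e2v uv.
  have -> : 2^-1 *: z + v - 2^-1 *: v - 0 = 2^-1 *: z + 2^-1 *: v by linear_eq R.
  by rewrite opDr !opZr !(exsymE _ E) e1w e2w e1v e2v uv; linear_eq R.
have s3 : swap u e3 = e3 by apply: (swap_0 E).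
have s1 := swap_e E.
have h2 : e2 ** swap u v = 2^-1 *: swap u v by rewrite -{1}s1 -(swapM E) e1v (swapZ u).
have h3 : e3 ** swap u v = 2^-1 *: swap u v by rewrite -{1}s3 -(swapM E) e3v (swapZ u).
have h1 : e1 ** swap u v = 0.
  rewrite opC; apply: (peirce10 (proj_orthD p2 p3 e23)); first exact: half_half.
  by rewrite opDl (opC e2) (opC e3) e12 e13 addr0.
have zz0 : u ** z - 2^-1 *: v = 0.
  have hz : e1 ** (u ** z - 2^-1 *: v) = 2^-1 *: (u ** z - 2^-1 *: v).
    by rewrite opBr opZr e1v (opC u z) (peirce0h p1 e1w e1u); linear_eq R.
  move: h1; rewrite sv opDr e1w hz add0r => h1; linear_from R h1.
have svw : swap u v = z by rewrite sv zz0 addr0.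
split; last by apply/eqP; rewrite -subr_eq0 zz0.
split => //; rewrite -svw -(swapM E); have [_ _ _ -> _] := F.
by rewrite swapD s1 s3.
Qed.
End Frame.
End Exchange.

(** * Two projections *)

Section TwoProjections.
Variables (R : realType) (A : jbwAlg R).
Implicit Types (a b c d s x y z u v w p q r e f g : A) (k l t m h : R) (C : set A).

Lemma pcomm_sym p q : proj p -> proj q -> pcomm p q -> pcomm q p.
Proof. by move=> pp pq h; apply/(lcomm_proj _ pq)/lcommC/(lcomm_proj _ pp). Qed.

Lemma proj_mul p q : proj p -> proj q -> pcomm p q -> proj (p ** q).
Proof.
move=> pp pq pc; rewrite /proj; have /pcommE ppq := pc.
have g1 : pcomm p (p ** q) by exact: pcomm1.
rewrite -(pcomm_mulA q pp g1) (opC (p ** q)).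
by have /pcommE := pcomm_sym pp pq pc; rewrite (opC q p) => ->.
Qed.

Lemma proj_mulM s x y : proj s -> pcomm s x -> pcomm s y -> (s ** x) ** (s ** y) = s ** (x ** y).
Proof.
move=> ps hx hy; have sx : pcomm s (s ** x) by apply: pcomm1; apply/pcommE.
rewrite -(pcomm_mulA _ ps sx) (opC _ y) -(pcomm_mulA _ ps hy) (opC y x).
by apply/pcommE; exact: pcommM.
Qed.

Lemma pcomm_peirce1 s q x : proj s -> pcomm s q -> pcomm s x -> pcomm s (peirce1 q x).
Proof.
move=> ps sq sx; rewrite /peirce1; have h := pcommM ps sq sx.
by apply: pcommB => //; apply: pcommZ; exact: pcommM.
Qed.

(* The squared sine of the angle between [p] and [q]; it commutes with both. *)
Definition tpc p q := p + q - 2 *: (p ** q).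

Lemma tpcC p q : tpc p q = tpc q p. Proof. by rewrite /tpc (opC p q) (addrC p). Qed.

Section Pair.
Variables p q a x b : A.
Hypotheses (pp : proj p) (pq : proj q).
Hypotheses (qa : q ** a = a) (qx : q ** x = 2^-1 *: x) (qb : q ** b = 0) (pE : p = a + x + b).
Let ab : a ** b = 0. Proof. exact: (peirce10 pq qa qb). Qed.

Lemma tpcE : tpc p q = q - a + b.
Proof. by rewrite /tpc (opC p q) pE !opDr qa qx qb; linear_eq R. Qed.


Lemma tpc_sq : x ** x = tpc p q - tpc p q ** tpc p q /\ q ** (x ** x) = a - a ** a.
Proof.
have h1 : a ** a + b ** b + x ** x = a + b.
  have h2 : proj (refl q p) by exact: refl_proj.
  have : refl q p = a - x + b.
    rewrite pE !reflD (refl_half qx) (refl_comm (pcomm1 qa)) (refl_comm (pcomm0 qb)).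
    by [].
  move: h2 => /[swap] -> h2; have h3 := pp; move: h2 h3; rewrite pE.
  rewrite /proj !opE (opC b a) ab => h2 h3.
  have h4 := congr2 +%R h2 h3; rewrite (opC x a) (opC b x) (opC x b) in h4.
  by linear_from R h4.
split.
  rewrite tpcE !opE (opC a q) (opC b q) (opC b a) ab qa qb pq.
  linear_from R h1.
have := congr1 (fun y => q ** y) h1; rewrite !opDr (peirce11 pq qa qa) (peirce00 pq qb qb) qa qb.
by move=> h2; linear_from R h2.
Qed.
End Pair.

Lemma pcomm_tpc_r p q : proj q -> pcomm q (tpc p q).
Proof.
move=> pq; rewrite (tpcE (peirce1P p pq) (peircehP p pq) (peirce0P p pq) (peirce_sum q p)).
apply: pcommD; last by apply: pcomm0; exact: peirce0P.
by apply: pcomm1; rewrite opBr pq peirce1P.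
Qed.
Lemma pcomm_tpc_l p q : proj p -> pcomm p (tpc p q).
Proof. by move=> pp; rewrite tpcC; exact: pcomm_tpc_r. Qed.

(** One-sided: only parts of [q] are excluded. A part of [p] orthogonal to [q] may exist and is
    split off in [tp_part]. *)
Definition generic p q :=
  forall f, proj f -> q ** f = f -> (p ** f = f \/ p ** f = 0) -> f = 0.

Section Generic.
Variables p q a x b : A.
Hypotheses (pp : proj p) (pq : proj q).
Hypotheses (qa : q ** a = a) (qx : q ** x = 2^-1 *: x) (qb : q ** b = 0) (pE : p = a + x + b).
Let ab : a ** b = 0. Proof. exact: (peirce10 pq qa qb). Qed.
Let aE : a = peirce1 q p.
Proof. by rewrite pE; have [-> _ _] := peirce_uniq qa qx qb. Qed.
Local Notation c := (tpc p q).
Local Notation u := (sgn x).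
Local Notation r := (supp x).
Let cE : c = q - a + b. Proof. exact: (tpcE qa qx qb pE). Qed.
Let rr : proj r. Proof. exact: supp_proj. Qed.
Let cr : pcomm q c. Proof. exact: pcomm_tpc_r. Qed.
Let cl : pcomm p c. Proof. exact: pcomm_tpc_l. Qed.

Lemma tp_supp_comm : pcomm p r /\ pcomm q r.
Proof.
have [xx _] := tpc_sq pp pq qa qx qb pE.
have h g : proj g -> pcomm g c -> pcomm g r.
  move=> pg gc; apply: refl_fix; rewrite -supp_sq supp_refl // refl_comm //.
  by rewrite xx; apply: pcommB => //; exact: pcommM.
by split; apply: h.
Qed.

Hypothesis gen : generic p q.

(** Off the support of the off-diagonal part [x], [p] and [q] commute. There [q] is the sum of a
    projection orthogonal to [p] and one under [p], and genericity kills both. *)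
Lemma tp_supp_ge : r ** q = q.
Proof.
have [pr qr] := tp_supp_comm; have [xx qxx] := tpc_sq pp pq qa qx qb pE.
have ps : proj (\one - r) by exact: proj_compl.
have rx : r ** x = x by exact: supp_id.
have sx : (\one - r) ** x = 0 by apply/compl_id.
have sp' : pcomm (\one - r) p by apply/pcomm_compl/pcomm_sym.
have sq : pcomm (\one - r) q by apply/pcomm_compl/pcomm_sym.
suff g0 : (\one - r) ** q = 0 by apply/compl_id.
move: (\one - r) ps sx sp' sq => s ps sx sp' sq.
have sa : pcomm s a by rewrite aE; exact: pcomm_peirce1.
have sc : pcomm s c.
  by rewrite /tpc; apply: pcommB; [exact: pcommD|apply: pcommZ; exact: pcommM].
have sxx : s ** (x ** x) = 0 by rewrite (pcomm_mulA _ ps (pcomm0 sx)) sx op0r.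
have saa : s ** a = s ** (a ** a).
  apply/eqP; rewrite -subr_eq0 -opBr -qxx.
  by rewrite (pcomm_mulA _ ps sq) sxx op0r.
have sxa : s ** (x ** a) = 0.
  by rewrite opC opC (opC x a) (pcomm_mulA _ ps sa) sx op0r.
have spa : s ** (p ** a) = s ** a.
  by rewrite pE !opDl (opC b a) ab !opDr op0r sxa saa; linear_eq R.
have g1p : proj (s ** (q - a)).
  have pqa : pcomm s (q - a) by exact: pcommB.
  rewrite /proj (proj_mulM ps pqa pqa).
  have -> : (q - a) ** (q - a) = q - a - a + a ** a.
    by rewrite !opBl !opBr pq (opC a q) qa; linear_eq R.
  by rewrite opDr -saa -opDr; congr (s ** _); linear_eq R.
have z1 : s ** (q - a) = 0.
  apply: gen => //.
    by rewrite -(pcomm_mulA _ ps sq) !opBr pq qa.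
  right; rewrite -(pcomm_mulA _ ps sp') opBr (opC p q) {1}pE !opDr qa qx qb.
  by rewrite opNr opZr op0r spa sx; linear_eq R.
have sqa : s ** q = s ** a by apply/eqP; rewrite -subr_eq0 -opBr z1.
apply: gen; first exact: proj_mul.
  by rewrite -(pcomm_mulA _ ps sq) pq.
by left; rewrite sqa -(pcomm_mulA _ ps sp').
Qed.

Lemma tp_exch : exch q (r - q) u.
Proof.
have rq := tp_supp_ge; have qx' : (\one - q) ** x = 2^-1 *: x.
  by rewrite opBl op1l qx; linear_eq R.
have q0 : q ** (\one - q) = 0 by rewrite opBr op1r pq subrr.
have [E _ _] := link_exch pq (proj_compl pq) q0 qx qx'.
by move: E; rewrite opBl op1l (opC q) rq.
Qed.

(** The two by two matrix form of a pair of projections: diagonal entries 1 - c and c, off-diagonal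
    entry [jabs x], the root of c - c^2. *)
Lemma tp_part : [/\ proj (r ** p), proj (p - r ** p), (r ** p) ** (p - r ** p) = 0,
   q ** (p - r ** p) = 0 &
   r ** p = (\one - c) ** q + c ** (r - q) + jabs x ** u].
Proof.
have [pr qr] := tp_supp_comm; have rp := pcomm_sym pp rr pr.
have /pcommE rrp := rp; have rq := tp_supp_ge.
have Rx : r ** x = x by exact: supp_id.
have r0 : r ** (p - r ** p) = 0 by rewrite opBr rrp subrr.
split.
- exact: proj_mul.
- rewrite -{1}(op1l p) -opBl; apply: proj_mul => //; first exact: proj_compl.
  exact: pcomm_compl.
- exact: (peirce10 rr rrp r0).
- exact: (peirce10 rr rq r0).
have ra : r ** a = a by exact: (peirce1_le pq rq qa rr).
have xu : jabs x ** u = x by rewrite opC sgn_abs.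
rewrite xu {1}pE !opDr ra Rx opBl op1l.
have cq : c ** q = q - a by rewrite cE opDl opBl pq (opC a q) (opC b q) qa qb; linear_eq R.
have -> : c ** r = q - a + r ** b by rewrite opC cE opDr opBr rq ra.
by rewrite opNr cq; linear_eq R.
Qed.
End Generic.

Lemma generic_sub p q q1 : generic p q -> proj q -> proj q1 -> q ** q1 = q1 -> generic p q1.
Proof.
move=> g pq p1 h f pf hf; apply: g => //; exact: (peirce1_le p1 h hf pq).
Qed.
End TwoProjections.

(** * Type I2 summands *)

Section Room.
Variables (R : realType) (A : jbwAlg R).
Implicit Types (a b c d s x y z u v w p q r e f g : A) (k l t m h : R) (C : set A).

Lemma opcommP a b : opcomm (jb_op A) a b <-> lcomm a b.
Proof.
rewrite /opcomm /lcomm; split=> h x; last by rewrite opC -h (opC x b).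
by rewrite (opC b x) -h opC.
Qed.

Lemma UopE p x : proj p -> Uop (jb_op A) p x = peirce1 p x.
Proof. by move=> pp; rewrite /Uop /jsq /peirce1 pp. Qed.

Lemma summandP p x : proj p -> summand (jb_op A) p x <-> p ** x = x.
Proof.
move=> pp; split; first by case=> y _ <-; rewrite UopE // peirce1P.
by move=> h; exists x => //; rewrite UopE // peirce1_id.
Qed.

Lemma Uop_summandP p z x : proj p -> proj z -> z ** p = p ->
  (Uop (jb_op A) p @` summand (jb_op A) z) x <-> p ** x = x.
Proof.
move=> pp pz zp; split; first by case=> y _ <-; rewrite UopE // peirce1P.
move=> h; exists x; last by rewrite UopE // peirce1_id.
by apply/summandP => //; exact: (peirce1_le pp zp h pz).
Qed.

Lemma lcomm_closure F a : (forall x, F x -> lcomm a x) -> forall x, closure (lspan F) x -> lcomm a x.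
Proof.
move=> h x cx y; apply/eqP; rewrite -subr_eq0; apply/eqP.
apply: (@closure_ker _ _ _ (fun x => a ** (x ** y) - x ** (a ** y)) (2 * (`|a| * `|y|)) (lspan F)).
- by move=> u v; rewrite !opE; linear_eq R.
- move=> u; rewrite (le_trans (ler_normB _ _)) //.
  have h1 : `|a ** (u ** y)| <= `|a| * `|y| * `|u|.
    by rewrite (le_trans (op_norm _ _)) // -mulrA ler_wpM2l // mulrC op_norm.
  have h2 : `|u ** (a ** y)| <= `|a| * `|y| * `|u|.
    by rewrite mulrC (le_trans (op_norm _ _)) // ler_wpM2l // op_norm.
  by rewrite -mulrA mulr_natl mulr2n lerD.
- by move=> u Fu; rewrite (lspan_lcomm h Fu) subrr.
- exact: cx.
Qed.

Definition corner q y : set A := [set f | [/\ proj f, q ** f = f & pcomm f y]].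

(** The spectral projections of [y] commute with [q]; multiplying an approximation of [y] by [q]
    moves it into the corner. *)
Lemma corner_dense q y : proj q -> q ** y = y -> closure (lspan (corner q y)) y.
Proof.
move=> pq qy; apply/closure_normP => e e0.
have [z Sz yz] := (closure_normP _ _).1 (@spfam_dense R A y) e e0; exists (q ** z); last first.
  rewrite -{1}qy -opBr (le_lt_trans (op_norm _ _)) //.
  by rewrite (le_lt_trans _ yz) // ler_piMl // norm_proj.
elim: Sz => [|k u v Fu _ IH]; first by rewrite op0r; exact: lspan0.
rewrite opDr opZr; apply: lspanS => //.
have pu := spfam_proj Fu.
have qu : pcomm q u.
  case: Fu => [->|[t _ <-]]; first by apply/pcommE; rewrite op1r pq.
  by apply: refl_sp => //; exact: pcomm1.
have uy : pcomm u y.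
  case: Fu => [->|[t _ <-]]; first by apply: pcomm1; rewrite op1l.
  apply: (sp_comm t (geno_AS y)) => //; [exact: geno1|exact: geno_id|exact: geno_id].
have uq := pcomm_sym pq pu qu.
split; [exact: proj_mul|by apply/pcommE|].
have fw w : q ** w = w -> (q ** u) ** w = u ** w.
  move=> qw; rewrite -{1}qw (proj_mulM pq qu (pcomm1 qw)) (pcomm_mulA _ pq qu) qw.
  by [].
apply/pcommE; rewrite (fw y qy) fw; first by apply/pcommE.
by rewrite (pcomm_mulA _ pq qu) qy.
Qed.

Lemma half_sub q f x : proj q -> proj f -> q ** f = f -> q ** x = 2^-1 *: x ->
  f ** (f ** x) = 2^-1 *: (f ** x).
Proof.
move=> pq pf qf qx; have l1 : lcomm q f by exact: lcomm_peirce1.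
have e1 : peirce1 f x = 0.
  have h2 : q ** peirce1 f x = peirce1 f x.
    exact: (peirce1_le pf qf (peirce1P x pf)).
  have : q ** peirce1 f x = 2^-1 *: peirce1 f x.
    by rewrite /peirce1 opBr opZr !(l1) qx !opZr; linear_eq R.
  rewrite h2 => /eqP; rewrite -subr_eq0 => /eqP h3; linear_from R h3.
by move: e1; rewrite /peirce1 => h3; linear_from R h3.
Qed.

(** [half_sub] for f + e, minus its instances for [f] and for [e], leaves only the cross term. *)
Lemma half_cross q f e x : proj q -> proj f -> proj e -> f ** e = 0 ->
  q ** f = f -> q ** e = e -> q ** x = 2^-1 *: x -> e ** (f ** x) = 0.
Proof.
move=> pq pf pe fe qf qe qx; have h1 := half_sub pq pf qf qx.
have h2 := half_sub pq pe qe qx.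
have h3 : (f + e) ** ((f + e) ** x) = 2^-1 *: ((f + e) ** x).
  by apply: (half_sub pq (proj_orthD pf pe fe)) => //; rewrite opDr qf qe.
have l1 : f ** (e ** x) = e ** (f ** x) by exact: lcomm_peirce0.
move: h3; rewrite !opDl !opDr h1 h2 l1 => h3; linear_from R h3.
Qed.

Lemma exch_eq0 e f u : exch e f u -> e = 0 -> u = 0.
Proof.
case=> _ _ _ _ [eu _] e0; move: eu; rewrite e0 op0l => eu.
by linear_from R eu.
Qed.

(** The rest g = p + q - w kills [p] and commutes with [u], so g u is killed by [p] and also halved
    by it. Hence g u = 0, and g = g (u u) = 0. *)
Lemma central_exch p q u w : exch p q u ->
  proj w -> (p + q) ** w = w -> w ** p = p -> pcomm w u -> w = p + q.
Proof.
move=> E pw zw wp wu; have [pp pq pq0 uu [pu qu]] := E.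
have pz := exch_proj E; have zu := exch_unit E.
have zp : (p + q) ** p = p by rewrite opDl pp (opC q) pq0 addr0.
move: (p + q) uu pz zu zw zp => z uu pz zu zw zp.
have pg : proj (z - w).
  by rewrite /proj !opBl !opBr pz (opC w z) zw pw; linear_eq R.
have gp : (z - w) ** p = 0 by rewrite opBl zp wp subrr.
have gu : pcomm (z - w) u.
  apply/(lcomm_proj _ pg)/lcommC; rewrite -scaleN1r; apply: lcommD.
    by apply/lcommC/(lcomm_proj _ pz)/pcomm1.
  by apply/lcommZ/lcommC/(lcomm_proj _ pw).
have gz : (z - w) ** z = z - w by rewrite opBl pz (opC w z) zw.
have [g gE] : exists g, g = z - w by exists (z - w).
rewrite -gE in pg gp gu gz.
move: pg gp gu gz => pg gp gu gz.
have /pcommE ggu := gu.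
have t0 : g ** u = 0.
  have h1 : p ** (g ** u) = 0 by rewrite opC; exact: (peirce10 pg ggu).
  have : p ** (g ** u) = g ** (p ** u) by apply: lcomm_peirce0 => //; rewrite opC.
  by rewrite h1 pu opZr => h2; linear_from R h2.
have g0 : g = 0 by rewrite -gz -uu (pcomm_mulA _ pg gu) t0 op0r.
by apply/esym/eqP; rewrite -subr_eq0 -gE g0.
Qed.

Lemma exch_swap_corner e f u y : exch e f u -> e ** swap u y = swap u (f ** y).
Proof. by move=> E; rewrite (swapM E) -(swap_e E) (swapK E). Qed.

Lemma corner_abelian z q : proj q -> proj z -> z ** q = q ->
  (forall x y w, q ** x = x -> q ** y = y -> q ** w = w -> (x ** y) ** w = x ** (y ** w)) ->
  abelian_in (jb_op A) (summand (jb_op A) z) q.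
Proof.
move=> pq pz zq h; split => //; first by apply/summandP.
move=> x y w; rewrite !Uop_summandP //; exact: h.
Qed.

Lemma typeI2_of_exch q f u : exch q f u ->
  (forall y, pcomm (q + f) y) ->
  (forall x y w, q ** x = x -> q ** y = y -> q ** w = w -> (x ** y) ** w = x ** (y ** w)) ->
  central_projection (jb_op A) (q + f) /\ typeI2_summand (jb_op A) (q + f).
Proof.
move=> E cr ass; have E' := exchC E; have [pq pf qf uu [qu fu]] := E.
have pz := exch_proj E; have zu := exch_unit E.
have zq : (q + f) ** q = q by rewrite opDl pq (opC f) qf addr0.
have zf : (q + f) ** f = f by rewrite opDl pf qf add0r.
have cz x : opcomm (jb_op A) (q + f) x by apply/opcommP/lcomm_proj.
split; first by split.
exists q, f; split => //.
- exact: corner_abelian.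
- apply: corner_abelian => // x y w hx hy hw.
  have h v : f ** v = v -> q ** swap u v = swap u v.
    by move=> hv; rewrite (exch_swap_corner _ E) hv.
  have := congr1 (swap u) (ass _ _ _ (h x hx) (h y hy) (h w hw)).
  by rewrite !(swapM E) !(swapK E).
have cin : central_in (jb_op A) (summand (jb_op A) (q + f)) (q + f).
  by split => // ; apply/summandP.
have uin : summand (jb_op A) (q + f) u by apply/summandP.
have H w : central_in (jb_op A) (summand (jb_op A) (q + f)) w ->
    [/\ proj w, (q + f) ** w = w & pcomm w u].
  case=> /summandP - /(_ pz) hw pw cw; split => //.
  by apply/(lcomm_proj _ pw)/opcommP; apply: cw.
split; split => // w /H [pw zw wu] wq.
- by rewrite (central_exch E pw zw wq wu).
- by rewrite (central_exch E' pw) // addrC.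
Qed.

(* Without a type I2 summand there is room for a third projection: otherwise the corner of [q]
   is associative and [q] together with its partner forms a type I2 summand. *)
Lemma room p q : no_typeI2_summand (jb_op A) -> proj p -> proj q -> q <> 0 -> generic p q ->
  exists q1 e u, [/\ q ** q1 = q1, q1 <> 0, exch q1 e u & e ** (p ** q1) = 0].
Proof.
move=> nI2 pp pq q0 gen; apply: contrapT => no.
have Hno q1 e u : q ** q1 = q1 -> exch q1 e u -> e ** (p ** q1) = 0 -> u = 0.
  move=> h1 h2 h3; have [q10|q10] := pselect (q1 = 0); first exact: (exch_eq0 h2).
  by exfalso; apply: no; exists q1, e, u.
(* Polar decomposition turns an element joining [f] and [g] into exchanged subprojections; if these
   would provide room, the element must be 0. *)
have link f g y : proj f -> proj g -> f ** g = 0 -> q ** f = f ->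
    f ** y = 2^-1 *: y -> g ** y = 2^-1 *: y ->
    (forall q1 e, proj q1 -> proj e -> f ** q1 = q1 -> g ** e = e -> e ** (p ** q1) = 0) -> y = 0.
  move=> pf pg fg qf fy gy h; have [E h1 h2] := link_exch pf pg fg fy gy.
  apply: supp_eq0; rewrite -sgn_sq (Hno _ _ _ _ E) ?op0l //.
    exact: (peirce1_le pf qf h1).
  by have [? ? _ _ _] := E; exact: h.
move: (peirce1P p pq) (peircehP p pq) (peirce0P p pq) (peirce_sum q p).
move: (peirce1 q p) (peirceh q p) (peirce0 q p) => a x b qa qx qb pE.
have E := tp_exch pp pq qa qx qb pE gen.
have [pr qr] := tp_supp_comm pp pq qa qx qb pE.
have pr' := supp_proj x.
have rq := tp_supp_ge pp pq qa qx qb pE gen.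
move: (supp x) (sgn x) E pr qr pr' rq => r u E pr qr pr' rq.
(* Nothing joins [f] to q - f: since [f] commutes with [a], every [e] under q - f and [q1] under [f]
   meet the condition on [p]. *)
have step1 f y : proj f -> q ** f = f -> pcomm f a -> q ** y = y -> pcomm f y.
  move=> pf qf fa qy; have pg : proj (q - f).
    by rewrite /proj !opBl !opBr pq (opC f q) qf pf; linear_eq R.
  have fg : f ** (q - f) = 0 by rewrite opBr (opC f q) qf pf subrr.
  apply: (link f (q - f)) => //; first exact: peircehP.
    rewrite opBl peircehP //; have -> : q ** peirceh f y = peirceh f y.
      by rewrite /peirceh opBr !opZr !(peirce11 pq) // ; do ?apply: peirce11.
    by linear_eq R.
  move=> q1 e p1 pe f1 ge.
  have fe : f ** e = 0 by rewrite opC; apply: (peirce10 pg ge); rewrite opC.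
  have q1q : q ** q1 = q1 by exact: (peirce1_le pf qf f1).
  have qe : q ** e = e by apply: (peirce1_le pg _ ge) => //; rewrite opBr pq qf.
  rewrite pE !opDl opDr opDr (opC b) (peirce10 pq q1q qb) op0r addr0.
  have -> : e ** (x ** q1) = 0.
    by rewrite (opC x); apply: (half_cross pq) => //; exact: (peirce10 pf f1 fe).
  rewrite addr0 opC; apply: (peirce10 pf _ fe).
  by rewrite (pcomm_mulA _ pf fa) f1.
(* [a] is a limit of combinations of subprojections of [q] that commute with [a]; these commute with
   [f] by [step1]. *)
have a_central f : proj f -> q ** f = f -> pcomm f a.
  move=> pf qf; apply/(lcomm_proj _ pf).
  apply: (@lcomm_closure (corner q a)); last exact: corner_dense.
  by move=> g [pg qg ga]; apply/lcommC/(lcomm_proj _ pg); exact: step1.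
have all_comm f y : proj f -> q ** f = f -> q ** y = y -> pcomm f y.
  by move=> pf qf qy; apply: step1 => //; exact: a_central.
have ass y z w : q ** y = y -> q ** z = z -> q ** w = w -> (y ** z) ** w = y ** (z ** w).
  move=> hy hz hw; rewrite opC (opC z w); apply/lcommC.
  apply: (@lcomm_closure (corner q w)); last exact: corner_dense.
  by move=> g [pg qg gw]; apply/lcommC/(lcomm_proj _ pg); exact: all_comm.
(* Nothing joins [q] to 1 - r either, because [p] commutes with [r]. Together with [swap u] this
   makes [r] central. *)
have qhalf y : r ** y = 2^-1 *: y -> q ** y = 0.
  move=> ry; apply: (link q (\one - r)) => //.
  - exact: proj_compl.
  - by rewrite opBr op1r (opC q r) rq subrr.
  - exact: (half_sub pr').
  - by rewrite opBl op1l (peirce1h pr' rq ry); linear_eq R.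
  move=> q1 e p1 pe f1 ge.
  have re : r ** e = 0.
    by rewrite opC; apply: (peirce10 (proj_compl pr') ge); rewrite opBl op1l pr' subrr.
  rewrite opC; apply: (peirce10 pr' _ re).
  by rewrite (pcomm_mulA _ pr' (pcomm_sym pp pr' pr)) (peirce1_le pq rq f1 pr').
have rE : q + (r - q) = r by rewrite addrC subrK.
have central y : pcomm (q + (r - q)) y.
  rewrite rE; set h := peirceh r y; have rh : r ** h = 2^-1 *: h by exact: peircehP.
  have h1 := qhalf h rh.
  have sr : swap u r = r.
    by rewrite -{1}rE swapD (swap_e E) -(swap_e E) (swapK E) (swap_e E) addrC.
  have h2 : q ** swap u h = 0 by apply: qhalf; rewrite -{1}sr -(swapM E) rh swapZ.
  have h3 : (r - q) ** h = 0.
    by rewrite -[LHS](swapK E) -(exch_swap_corner _ E) h2 /swap refl_0.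
  have h4 : r ** h = 0 by rewrite -rE opDl h1 h3 addr0.
  rewrite /pcomm -/h; move: rh; rewrite h4 => rh; linear_from R rh.
have [cz t2] := typeI2_of_exch E central ass.
apply: (nI2 _ cz _ t2); rewrite rE => r0; apply: q0.
by rewrite -rq r0 op0l.
Qed.

End Room.

(** * Frame functions on the sphere *)

Section CosinePowers.
Variable R : realType.
Implicit Types (x s k c : R).

Lemma sin_le_id x : 0 <= x -> sin x <= x.
Proof.
move=> x0; have [|c _] := @MVT_segment R sin cos 0 x x0.
  by apply: continuous_subspaceT; exact: continuous_sin.
by rewrite sin0 !subr0 => ->; rewrite ler_piMl // cos_le1.
Qed.

Lemma cos_ge x : 1 - x ^+ 2 <= cos x.
Proof.
wlog x0 : x / 0 <= x => [H|].
  by have [h|/ltW h] := leP 0 x; [exact: H|rewrite -cosN -sqrrN; apply: H; rewrite oppr_ge0].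
have [|c hc] := @MVT_segment R cos (fun c => - sin c) 0 x x0.
  by apply: continuous_subspaceT; exact: continuous_cos.
move: hc; rewrite in_itv /= => /andP[c0 cx].
rewrite cos0 subr0 => e; have h : sin c * x <= x * x.
  by rewrite ler_wpM2r // (le_trans (sin_le_id c0)).
by rewrite expr2; lra.
Qed.

Lemma bernoulli_le c n : 0 <= c <= 1 -> 1 - n%:R * (1 - c) <= c ^+ n.
Proof.
move=> /andP[c0 c1]; elim: n => [|n IH]; first by rewrite mul0r subr0 expr0.
rewrite exprS; have h : c * (1 - n%:R * (1 - c)) <= c * c ^+ n by rewrite ler_wpM2l.
have n0 : 0 <= n%:R :> R by exact: ler0n.
have e : n.+1%:R = n%:R + 1 :> R by rewrite natr1.
rewrite e; move: (n%:R : R) n0 h => m m0 h.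
have : 0 <= m * ((1 - c) * (1 - c)) by rewrite mulr_ge0 // mulr_ge0; lra.
by lra.
Qed.

(** The price of turning by the angle [s] in [n] equal steps of [ffp_step] is a factor that tends to
    1. *)
Lemma cos_pow_lim s k : k < 1 -> exists n, [/\ (0 < n)%N, 0 < cos (s / n%:R) &
  k < cos (s / n%:R) ^+ n].
Proof.
move=> k1; pose d := Num.min 1 (1 - k); have d0 : 0 < d by rewrite lt_min; lra.
have d1 : d <= 1 by rewrite ge_min lexx.
have dk : d <= 1 - k by rewrite ge_min lexx orbT.
pose n := (Num.truncn ((s ^+ 2) / d)).+1.
have sd0 : 0 <= s ^+ 2 / d by rewrite divr_ge0 ?sqr_ge0 // ltW.
have hn : s ^+ 2 / d < n%:R by have /andP[_] := truncn_itv sd0.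
have n0 : 0 < n%:R :> R by rewrite ltr0n.
have n1 : 1 <= n%:R :> R by rewrite ler1n.
have h : s ^+ 2 / n%:R < d by rewrite ltr_pdivrMr // mulrC -ltr_pdivrMr.
have cc := cos_ge (s / n%:R).
have h2 : n%:R * (s / n%:R) ^+ 2 = s ^+ 2 / n%:R by field; rewrite gt_eqF.
have h3 : (s / n%:R) ^+ 2 <= s ^+ 2 / n%:R.
  by rewrite -h2 ler_peMl // sqr_ge0.
have c0 : 0 < cos (s / n%:R) by lra.
exists n; split => //; have := @bernoulli_le (cos (s / n%:R)) n.
rewrite (ltW c0) cos_le1 => /(_ erefl); apply: lt_le_trans.
have : n%:R * (1 - cos (s / n%:R)) <= n%:R * (s / n%:R) ^+ 2.
  by apply: ler_wpM2l; [exact: ltW|lra].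
by rewrite h2 => ?; lra.
Qed.
End CosinePowers.

Section FrameFunction.
Variable R : realType.
Implicit Types (x y z a b c s t k : R).
Variable F : R -> R -> R -> R.
Hypothesis F_ge0 : forall x y z, x ^+ 2 + y ^+ 2 + z ^+ 2 = 1 -> 0 <= F x y z.
Hypothesis F_pole : F 1 0 0 = 1.
Hypothesis F_equator : forall y z, y ^+ 2 + z ^+ 2 = 1 -> F 0 y z = 0.
Hypothesis F_opp : forall x y z, F (- x) (- y) (- z) = F x y z.
Hypothesis F_plane : forall x y z x' y' z' a b,
  x ^+ 2 + y ^+ 2 + z ^+ 2 = 1 -> x' ^+ 2 + y' ^+ 2 + z' ^+ 2 = 1 ->
  x * x' + y * y' + z * z' = 0 -> a ^+ 2 + b ^+ 2 = 1 ->
  F (a * x + b * x') (a * y + b * y') (a * z + b * z') +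
  F (a * x' - b * x) (a * y' - b * y) (a * z' - b * z) = F x y z + F x' y' z'.

(* [F] along a great circle tangent to the latitude circle at [(x, y, z)]. *)
Lemma ff_descent x y z n m a b : x ^+ 2 + y ^+ 2 + z ^+ 2 = 1 -> n ^+ 2 + m ^+ 2 = 1 ->
  y * n + z * m = 0 -> a ^+ 2 + b ^+ 2 = 1 ->
  F (a * x) (a * y + b * n) (a * z + b * m) <= F x y z.
Proof.
move=> u1 u2 o ab; have := @F_plane x y z 0 n m a b u1.
rewrite (F_equator u2) addr0 !mulr0 addr0 sub0r => <- //; first last.
- by rewrite add0r.
- by rewrite expr0n add0r.
rewrite lerDl F_ge0 //.
have -> : (- (b * x)) ^+ 2 + (a * n - b * y) ^+ 2 + (a * m - b * z) ^+ 2 =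
  b ^+ 2 * (x ^+ 2 + y ^+ 2 + z ^+ 2) + a ^+ 2 * (n ^+ 2 + m ^+ 2) - 2 * a * b * (y * n + z * m)
  by ring.
by rewrite u1 u2 o; lra.
Qed.

Lemma ff_le1 x y z : x ^+ 2 + y ^+ 2 + z ^+ 2 = 1 -> F x y z <= 1.
Proof.
move=> u; have [k0|k0] := eqVneq (y ^+ 2 + z ^+ 2) 0.
  have y0 : y = 0 by nra.
  have z0 : z = 0 by nra.
  have [h|h] : x = 1 \/ x = -1.
    have : (x - 1) * (x + 1) = 0 by nra.
    by move/eqP; rewrite mulf_eq0 => /orP[] /eqP h; [left|right]; lra.
  + by rewrite h y0 z0 F_pole.
  + by rewrite h y0 z0 -{1 2}oppr0 F_opp F_pole.
set k := Num.sqrt (y ^+ 2 + z ^+ 2).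
have s0 : 0 <= y ^+ 2 + z ^+ 2 by rewrite addr_ge0 // sqr_ge0.
have kk : k ^+ 2 = y ^+ 2 + z ^+ 2 by rewrite sqr_sqrtr.
have kn : k != 0 by rewrite -sqrf_eq0 kk.
rewrite -F_pole.
have := @ff_descent 1 0 0 (y / k) (z / k) x k; rewrite !mulr0 !add0r mulr1 !(mulrC k) !divfK //.
apply; [ring| |ring|by rewrite kk -u addrA].
by rewrite !expr_div_n -mulrDl -kk divff // sqrf_eq0.
Qed.

(* Gnomonic coordinates: the ray through [(1, r cos t, r sin t)]. *)
Definition ffp (r t : R) : R :=
  let d := Num.sqrt (1 + r ^+ 2) in F (1 / d) (r * cos t / d) (r * sin t / d).

(** In gnomonic coordinates the great circle of [ff_descent] is the line perpendicular to the
    radius; along it, turning by [s] divides the radius by cos s. *)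
Lemma ffp_step r t s : 0 < r -> 0 < cos s -> ffp (r / cos s) (t + s) <= ffp r t.
Proof.
move=> r0 c0; rewrite /ffp.
set d := Num.sqrt (1 + r ^+ 2); set d' := Num.sqrt (1 + (r / cos s) ^+ 2).
have p1 : 0 < 1 + r ^+ 2 by rewrite ltr_wpDr // sqr_ge0.
have p2 : 0 < 1 + (r / cos s) ^+ 2 by rewrite ltr_wpDr // sqr_ge0.
have dd : d ^+ 2 = 1 + r ^+ 2 by rewrite sqr_sqrtr // ltW.
have dd' : d' ^+ 2 = 1 + (r / cos s) ^+ 2 by rewrite sqr_sqrtr // ltW.
have d0 : 0 < d by rewrite sqrtr_gt0.
have d0' : 0 < d' by rewrite sqrtr_gt0.
have cs (v : R) : cos v ^+ 2 + sin v ^+ 2 = 1 by exact: cos2Dsin2.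
have cn : cos s != 0 by rewrite gt_eqF.
have dn : d != 0 by rewrite gt_eqF.
have dn' : d' != 0 by rewrite gt_eqF.
have := @ff_descent (1 / d) (r * cos t / d) (r * sin t / d) (- sin t) (cos t)
   (d / d') (r * sin s / (cos s * d')).
have -> : d / d' * (1 / d) = 1 / d' by field; rewrite ?dn ?dn'.
have -> : d / d' * (r * cos t / d) + r * sin s / (cos s * d') * - sin t =
   r / cos s * cos (t + s) / d' by rewrite cosD; field; rewrite ?dn ?dn' ?cn.
have -> : d / d' * (r * sin t / d) + r * sin s / (cos s * d') * cos t =
   r / cos s * sin (t + s) / d' by rewrite sinD; field; rewrite ?dn ?dn' ?cn.
apply.
- have -> : (1 / d) ^+ 2 + (r * cos t / d) ^+ 2 + (r * sin t / d) ^+ 2 =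
     (1 + r ^+ 2 * (cos t ^+ 2 + sin t ^+ 2)) / d ^+ 2 by field.
  by rewrite cs mulr1 -dd divff // sqrf_eq0 dn.
- by rewrite sqrrN addrC cs.
- ring.
have -> : (d / d') ^+ 2 + (r * sin s / (cos s * d')) ^+ 2 =
   (d ^+ 2 + (r / cos s) ^+ 2 * sin s ^+ 2) / d' ^+ 2 by field; rewrite ?cn ?dn'.
have -> : d ^+ 2 + (r / cos s) ^+ 2 * sin s ^+ 2 = d' ^+ 2.
  rewrite dd dd' -(cs s); have := cs s => h.
  have -> : sin s ^+ 2 = 1 - cos s ^+ 2 by lra.
  by field.
by rewrite divff // sqrf_eq0.
Qed.

Lemma ffp_steps n r t s : 0 < r -> 0 < cos s -> ffp (r / cos s ^+ n) (t + n%:R * s) <= ffp r t.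
Proof.
move=> r0 c0; elim: n => [|n IH]; first by rewrite expr0 divr1 mul0r addr0.
apply: le_trans IH; have := @ffp_step (r / cos s ^+ n) (t + n%:R * s) s.
rewrite divr_gt0 ?exprn_gt0 // => /(_ erefl c0).
by rewrite -addrA -[in X in _ + (_ + X)](mul1r s) -mulrDl natr1 -mulrA -invfM -exprSr.
Qed.

(** Two steps with opposite angles restore the direction and divide the radius by the squared
    cosine, which is chosen as r / r'. *)
Lemma ffp_radial r r' t : 0 < r -> r <= r' -> ffp r' t <= ffp r t.
Proof.
move=> r0 rr; have r0' := lt_le_trans r0 rr.
have h0 : 0 < r / r' by rewrite divr_gt0.
have h1 : r / r' <= 1 by rewrite ler_pdivrMr // mul1r.
set k := Num.sqrt (r / r'); have k0 : 0 < k by rewrite sqrtr_gt0.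
have kk : k ^+ 2 = r / r' by rewrite sqr_sqrtr // ltW.
have k1 : k <= 1 by nra.
have ca : cos (acos k) = k by rewrite acosK // in_itv /= k1 andbT; lra.
have := @ffp_step r t (acos k); rewrite ca => /(_ r0 k0); apply: le_trans.
have := @ffp_step (r / k) (t + acos k) (- acos k); rewrite cosN ca addrK divr_gt0 // => /(_ erefl k0).
have -> : r / k / k = r'.
  rewrite -mulrA -invfM -expr2 kk; field; rewrite !gt_eqF //.
by [].
Qed.

(** The spiral of elementary proofs of Gleason's theorem: many short steps reach any direction
    before the radius exceeds r', and a radial move covers the rest. *)
Lemma ffp_mono r r' t t' : 0 < r -> r < r' -> ffp r' t' <= ffp r t.
Proof.
move=> r0 rr; have r0' : 0 < r' by exact: lt_trans rr.
have k1 : r / r' < 1 by rewrite ltr_pdivrMr // mul1r.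
have [n [n0 c0 hn]] := cos_pow_lim (t' - t) k1.
have := @ffp_steps n r t ((t' - t) / n%:R) r0 c0.
have -> : t + n%:R * ((t' - t) / n%:R) = t'.
  by rewrite (mulrC n%:R) divfK ?pnatr_eq0 -?lt0n // addrC subrK.
apply: le_trans; apply: ffp_radial; first by rewrite divr_gt0 // exprn_gt0.
rewrite ler_pdivrMr ?exprn_gt0 // mulrC -ler_pdivrMr //; exact: ltW.
Qed.

Lemma polar y z : exists t, y = Num.sqrt (y ^+ 2 + z ^+ 2) * cos t /\
  z = Num.sqrt (y ^+ 2 + z ^+ 2) * sin t.
Proof.
have s0 : 0 <= y ^+ 2 + z ^+ 2 by rewrite addr_ge0 // sqr_ge0.
set k := Num.sqrt _; have kk : k ^+ 2 = y ^+ 2 + z ^+ 2 by rewrite sqr_sqrtr.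
have k0 : 0 <= k by rewrite sqrtr_ge0.
have [e|e] := eqVneq k 0.
  by exists 0; rewrite e !mul0r; rewrite e in kk; split; nra.
have kp : 0 < k by rewrite lt_def e.
have b1 : -1 <= y / k <= 1.
  rewrite ler_pdivlMr // ler_pdivrMr // mul1r mulN1r -ler_norml.
  by rewrite -(@ler_pXn2r _ 2) ?nnegrE // real_normK ?num_real // kk lerDl sqr_ge0.
have ca : cos (acos (y / k)) = y / k by rewrite acosK // in_itv.
have sa : sin (acos (y / k)) = `|z| / k.
  rewrite sin_acos // expr_div_n kk.
  have -> : 1 - y ^+ 2 / (y ^+ 2 + z ^+ 2) = z ^+ 2 / (y ^+ 2 + z ^+ 2).
    by field; rewrite -kk sqrf_eq0.
  by rewrite -kk -expr_div_n sqrtr_sqr normrM normfV (ger0_norm k0).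
have [z0|z0] := leP 0 z.
  by exists (acos (y / k)); rewrite ca sa !(mulrC k) !divfK // ger0_norm.
exists (- acos (y / k)); rewrite cosN sinN ca sa (mulrC k) mulrN (mulrC k) !divfK //.
by rewrite ltr0_norm // opprK.
Qed.

Lemma ff_polar x y z : x ^+ 2 + y ^+ 2 + z ^+ 2 = 1 -> 0 < x ->
  exists2 t, F x y z = ffp (Num.sqrt (1 / x ^+ 2 - 1)) t & True.
Proof.
move=> u x0; have [t [hy hz]] := polar y z; exists t => //; rewrite /ffp.
have e : y ^+ 2 + z ^+ 2 = 1 - x ^+ 2 by rewrite -u; ring.
have xn : x != 0 by rewrite gt_eqF.
have s0 : 0 <= y ^+ 2 + z ^+ 2 by rewrite addr_ge0 // sqr_ge0.
have k0 : 1 / x ^+ 2 - 1 = (y ^+ 2 + z ^+ 2) / x ^+ 2 by rewrite e; field.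
rewrite sqr_sqrtr; last by rewrite k0 divr_ge0 // sqr_ge0.
have -> : Num.sqrt (1 + (1 / x ^+ 2 - 1)) = x^-1.
  have -> : 1 + (1 / x ^+ 2 - 1) = (x^-1) ^+ 2 by field.
  by rewrite sqrtr_sqr ger0_norm // invr_ge0 ltW.
have -> : Num.sqrt (1 / x ^+ 2 - 1) = Num.sqrt (y ^+ 2 + z ^+ 2) / x.
  by rewrite k0 sqrtrM // -exprVn sqrtr_sqr ger0_norm // invr_ge0 ltW.
move: hy hz; move: (Num.sqrt (y ^+ 2 + z ^+ 2)) => k hy hz.
congr F; [by field|rewrite {1}hy; by field|rewrite {1}hz; by field].
Qed.

Lemma ff_mono x y z x' y' z' : x ^+ 2 + y ^+ 2 + z ^+ 2 = 1 -> x' ^+ 2 + y' ^+ 2 + z' ^+ 2 = 1 ->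
  x' ^+ 2 < x ^+ 2 -> F x' y' z' <= F x y z.
Proof.
move=> u u' xx.
wlog x0 : x y z u xx / 0 < x => [H|].
  have [h|h|h] := ltrgtP x 0; [|exact: H|by exfalso; move: xx; rewrite h; nra].
  by rewrite -(F_opp x); apply: H; rewrite ?sqrrN // oppr_gt0.
wlog x0' : x' y' z' u' xx / 0 <= x' => [H|].
  have [h|h] := leP 0 x'; first exact: H.
  by rewrite -(F_opp x'); apply: H; rewrite ?sqrrN // oppr_ge0 ltW.
have [e|n0] := eqVneq x' 0.
  by rewrite e F_equator ?F_ge0 // -u' e; ring.
have xp : 0 < x' by rewrite lt_def n0.
have [e1|n1] := eqVneq (x ^+ 2) 1.
  have -> : F x y z = 1; last exact: ff_le1.
  rewrite -F_pole; congr F; [|nra..]; nra.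
have [t -> _] := ff_polar u x0; have [t' -> _] := ff_polar u' xp.
have h1 : x ^+ 2 < 1 by rewrite lt_def eq_sym n1; nra.
have p0 : 0 < x ^+ 2 by rewrite exprn_gt0.
have p0' : 0 < x' ^+ 2 by rewrite exprn_gt0.
apply: ffp_mono; first by rewrite sqrtr_gt0 subr_gt0 ltr_pdivlMr // mul1r.
rewrite ltr_sqrt; last by rewrite subr_gt0 ltr_pdivlMr // mul1r; nra.
by rewrite ltrD2r ltr_pdivlMr // mulrAC mul1r ltr_pdivrMr // mul1r.
Qed.

(** [F] along one meridian, as a function of the squared first coordinate. [ff_mono] says nothing at
    equal latitudes, so the comparisons below carry strict inequalities. *)
Definition ffh (a : R) := F (Num.sqrt a) (Num.sqrt (1 - a)) 0.

Lemma ffh_unit a : 0 <= a <= 1 -> Num.sqrt a ^+ 2 + Num.sqrt (1 - a) ^+ 2 + 0 ^+ 2 = 1.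
Proof.
by move=> /andP[a0 a1]; rewrite !sqr_sqrtr ?subr_ge0 // expr0n /=; ring.
Qed.

Lemma ffh_ge0 a : 0 <= a <= 1 -> 0 <= ffh a. Proof. by move=> /ffh_unit; exact: F_ge0. Qed.

(** Rotate a point of squared height a + b and an orthogonal point of the equator in their plane;
    the equator contributes 0. *)
Lemma ff_split a b : 0 < a -> 0 < b -> a + b <= 1 ->
  exists x y z x' y' z', [/\ x ^+ 2 + y ^+ 2 + z ^+ 2 = 1, x' ^+ 2 + y' ^+ 2 + z' ^+ 2 = 1,
    x ^+ 2 = a, x' ^+ 2 = b & F x y z + F x' y' z' = ffh (a + b)].
Proof.
move=> a0 b0 ab; have s0 : 0 < a + b by rewrite addr_gt0.
have sn : a + b != 0 by rewrite gt_eqF.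
set p := Num.sqrt (a / (a + b)); set q := Num.sqrt (b / (a + b)).
have pp : p ^+ 2 = a / (a + b) by rewrite sqr_sqrtr // divr_ge0 // ltW.
have qq : q ^+ 2 = b / (a + b) by rewrite sqr_sqrtr // divr_ge0 // ltW.
have pq : p ^+ 2 + q ^+ 2 = 1 by rewrite pp qq; field.
have hu := @ffh_unit (a + b); rewrite (ltW s0) ab in hu; have {}hu := hu erefl.
have h1 : Num.sqrt (a + b) ^+ 2 = a + b by rewrite sqr_sqrtr // ltW.
have e01 : (0 : R) ^+ 2 + 1 ^+ 2 = 1 by ring.
have e001 : (0 : R) ^+ 2 + 0 ^+ 2 + 1 ^+ 2 = 1 by ring.
have eo : Num.sqrt (a + b) * 0 + Num.sqrt (1 - (a + b)) * 0 + 0 * 1 = 0 :> R by ring.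
have := F_plane hu e001 eo pq; rewrite (F_equator e01) addr0 -/(ffh _) => h.
do 6 eexists; split; [| | | |exact: h]; rewrite -/p -/q.
- move: hu; set A := Num.sqrt _; set B := Num.sqrt _ => hu.
  have -> : (p * A + q * 0) ^+ 2 + (p * B + q * 0) ^+ 2 + (p * 0 + q * 1) ^+ 2 =
    p ^+ 2 * (A ^+ 2 + B ^+ 2 + 0 ^+ 2) + q ^+ 2 by ring.
  by rewrite hu mulr1.
- move: hu; set A := Num.sqrt _; set B := Num.sqrt _ => hu.
  have -> : (p * 0 - q * A) ^+ 2 + (p * 0 - q * B) ^+ 2 + (p * 1 - q * 0) ^+ 2 =
    q ^+ 2 * (A ^+ 2 + B ^+ 2 + 0 ^+ 2) + p ^+ 2 by ring.
  by rewrite hu mulr1 addrC.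
- by rewrite mulr0 addr0 exprMn pp h1 divfK.
- by rewrite mulr0 sub0r sqrrN exprMn qq h1 divfK.
Qed.

Lemma ffh_super a b c : 0 <= a -> 0 <= b -> a + b < c -> c <= 1 -> ffh a + ffh b <= ffh c.
Proof.
move=> a0 b0 abc c1; pose d := (c - a - b) / 3.
have d0 : 0 < d by rewrite /d; lra.
have dE : a + b + 3 * d = c by rewrite /d; lra.
have [|||x [y [z [x' [y' [z' [u u' xa xb h]]]]]]] := @ff_split (a + d) (b + d); [lra..|].
apply: (@le_trans _ _ (F x y z + F x' y' z')).
  apply: lerD; apply: ff_mono => //; try (by apply: ffh_unit; lra); rewrite ?xa ?xb sqr_sqrtr //; lra.
rewrite h; apply: ff_mono; try (by apply: ffh_unit; lra); rewrite !sqr_sqrtr; lra.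
Qed.
Lemma ffh_mono a c : 0 <= a -> a < c -> c <= 1 -> ffh a <= ffh c.
Proof.
move=> a0 ac c1; apply: ff_mono; try (by apply: ffh_unit; lra).
by rewrite !sqr_sqrtr; lra.
Qed.

Lemma ffh_sub a b c : 0 < a <= 1 -> 0 < b <= 1 -> 0 < c <= 1 -> c < a + b ->
  ffh c <= ffh a + ffh b.
Proof.
move=> /andP[a0 a1] /andP[b0 b1] /andP[c0 c1] abc; pose k := c / (a + b).
have s0 : 0 < a + b by rewrite addr_gt0.
have k0 : 0 < k by rewrite divr_gt0.
have k1 : k < 1 by rewrite ltr_pdivrMr // mul1r.
have kE : k * a + k * b = c by rewrite -mulrDr divfK // gt_eqF.
have [|||x [y [z [x' [y' [z' [u u' xa xb h]]]]]]] := @ff_split (k * a) (k * b).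
- by rewrite mulr_gt0.
- by rewrite mulr_gt0.
- by rewrite kE.
move: h; rewrite kE => <-.
apply: lerD; apply: ff_mono => //; try (by apply: ffh_unit; lra); rewrite ?xa ?xb sqr_sqrtr; nra.
Qed.

Lemma ffh_subn n t c : 0 < t <= 1 -> 0 < c <= 1 -> c < n%:R * t -> ffh c <= n%:R * ffh t.
Proof.
move=> ht; have /andP[t0 t1] := ht; have g0 : 0 <= ffh t by apply: ffh_ge0; lra.
elim: n c => [|n IH] c hc; have /andP[c0 c1] := hc; first by rewrite mul0r; lra.
have e : n.+1%:R = n%:R + 1 :> R by rewrite natr1.
rewrite e mulrDl mul1r => ct; rewrite mulrDl mul1r.
have n0 : 0 <= n%:R :> R by exact: ler0n.
have [h|h] := ltP c t.
  have := ffh_mono (ltW c0) h t1; have : 0 <= n%:R * ffh t by rewrite mulr_ge0.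
  lra.
have m0 : c - t < Num.min (n%:R * t) 1 by rewrite lt_min; lra.
have m1 : Num.min (n%:R * t) 1 <= n%:R * t by rewrite ge_min lexx.
have m2 : Num.min (n%:R * t) 1 <= 1 by rewrite ge_min lexx orbT.
pose c' := (c - t + Num.min (n%:R * t) 1) / 2.
have c'1 : c - t < c' by rewrite /c'; lra.
have c'2 : c' < Num.min (n%:R * t) 1 by rewrite /c'; lra.
have hc' : 0 < c' <= 1 by lra.
have := IH c' hc'; have := @ffh_sub c' t c hc' ht hc.
move=> h1 h2; have {}h1 := h1 ltac:(lra); have {}h2 := h2 ltac:(lra).
lra.
Qed.

Lemma ffh_supern n t c : 0 <= t -> 0 <= c <= 1 -> n%:R * t < c -> n%:R * ffh t <= ffh c.
Proof.
move=> t0; elim: n c => [|n IH] c hc; have /andP[c0 c1] := hc.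
  by rewrite !mul0r => _; apply: ffh_ge0.
have e : n.+1%:R = n%:R + 1 :> R by rewrite natr1.
rewrite e mulrDl mul1r => ct; rewrite mulrDl mul1r.
have n0 : 0 <= n%:R * t by rewrite mulr_ge0.
pose c' := (n%:R * t + (c - t)) / 2.
have c'1 : c' < c - t by rewrite /c'; lra.
have c'2 : n%:R * t < c' by rewrite /c'; lra.
have h1 := IH c' ltac:(lra) c'2.
have := @ffh_super c' t c ltac:(lra) t0 ltac:(lra) c1; lra.
Qed.

Lemma ffh1 : ffh 1 = 1. Proof. by rewrite /ffh subrr sqrtr0 sqrtr1. Qed.

(** [ffh] is additive up to a slack and [ffh 1 = 1]. If F x y z < x^2, some m / n lies above F x y z
    and below x^2; for [t] slightly above 1 / n one has 1 <= n (ffh t) and m (ffh t) <= F x y z,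
    whence m / n <= F x y z. *)
Theorem frame_function_ge x y z : x ^+ 2 + y ^+ 2 + z ^+ 2 = 1 -> x ^+ 2 <= F x y z.
Proof.
move=> u; rewrite leNgt; apply/negP => hF; have F0 := F_ge0 u.
pose a := (F x y z + x ^+ 2) / 2; pose d := a - F x y z.
have d0 : 0 < d by rewrite /d /a; lra.
have a0 : 0 < a by rewrite /a; lra.
have ax : a < x ^+ 2 by rewrite /a; lra.
have x1 : x ^+ 2 <= 1 by nra.
pose n := (Num.truncn (d^-1)).+2.
have hn : d^-1 < n%:R.
  have di : 0 <= d^-1 by rewrite invr_ge0 ltW.
  by have /andP[_ h] := truncn_itv di; apply: (lt_le_trans h); rewrite ler_nat.
have n2 : 2 <= n%:R :> R by rewrite ler_nat.
have n0 : 0 < n%:R :> R by lra.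
pose m := Num.truncn (n%:R * a).
have /andP[m1 m2] : m%:R <= n%:R * a < m.+1%:R by apply: truncn_itv; rewrite mulr_ge0 // ltW.
have em : m.+1%:R = m%:R + 1 :> R by rewrite natr1.
have nd : 1 < n%:R * d by rewrite -ltr_pdivrMr // mul1r.
have mp : 0 < m%:R :> R.
  have : n%:R * a = n%:R * d + n%:R * F x y z by rewrite /d; ring.
  have : 0 <= n%:R * F x y z by rewrite mulr_ge0 // ltW.
  lra.
have nx : n%:R * a < n%:R * x ^+ 2 by rewrite ltr_pM2l.
(* [t] has to exceed 1 / n with m t < x^2; there is space because m <= n a < n x^2. *)
pose t0 := Num.min (x ^+ 2 / m%:R) 1; pose t := (n%:R^-1 + t0) / 2.
have ni : n%:R^-1 < 1 :> R by rewrite invf_lt1 //; lra.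
have lt0 : n%:R^-1 < t0.
  rewrite lt_min ni andbT ltr_pdivlMr // mulrC ltr_pdivrMr // mulrC; lra.
have t01 : t0 <= 1 by rewrite ge_min lexx orbT.
have t02 : t0 <= x ^+ 2 / m%:R by rewrite ge_min lexx.
have ni0 : 0 < n%:R^-1 :> R by rewrite invr_gt0.
have ht : 0 < t <= 1 by rewrite /t; lra.
have nt : 1 < n%:R * t by rewrite mulrC -ltr_pdivrMr // mul1r /t; lra.
have mt : m%:R * t < x ^+ 2.
  by rewrite mulrC -ltr_pdivlMr // (lt_le_trans _ t02) // /t; lra.
have h1 : ffh 1 <= n%:R * ffh t by apply: ffh_subn => //; lra.
rewrite ffh1 in h1.
have mt0 : 0 <= m%:R * t by rewrite mulr_ge0 //; lra.
pose c := (m%:R * t + x ^+ 2) / 2.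
have c1 : m%:R * t < c by rewrite /c; lra.
have c2 : c < x ^+ 2 by rewrite /c; lra.
have h2 : m%:R * ffh t <= ffh c by apply: ffh_supern => //; lra.
have h3 : ffh c <= F x y z.
  by apply: ff_mono => //; [apply: ffh_unit; lra|rewrite sqr_sqrtr //; lra].
have h4 : m%:R <= n%:R * F x y z.
  have : m%:R <= m%:R * (n%:R * ffh t) by rewrite ler_peMr // ltW.
  have -> : m%:R * (n%:R * ffh t) = n%:R * (m%:R * ffh t) by ring.
  move/le_trans; apply; rewrite ler_wpM2l // ?(ltW n0) //; lra.
have : n%:R * a = n%:R * d + n%:R * F x y z by rewrite /d; ring.
lra.
Qed.
End FrameFunction.

(** * The algebra of a three-frame *)

Section SpectralAction.
Variables (R : realType) (A : jbwAlg R) (a : A).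
Implicit Types (x y z h g p : A) (k l : R).
Local Notation M := (closure (lspan (spfam a))).

Definition mcomm h := forall p, spfam a p -> pcomm p h.

Lemma mcommM h g : mcomm h -> mcomm g -> mcomm (h ** g).
Proof. by move=> ch cg p Fp; apply: pcommM (spfam_proj Fp) (ch p Fp) (cg p Fp). Qed.
Lemma mcommD h g : mcomm h -> mcomm g -> mcomm (h + g).
Proof. by move=> ch cg p Fp; apply: pcommD; [exact: ch|exact: cg]. Qed.
Lemma mcommZ k h : mcomm h -> mcomm (k *: h).
Proof. by move=> ch p Fp; apply: pcommZ; exact: ch. Qed.

(** Elements of the spectral algebra of [a] act as scalars on what commutes with [a]: a computation
    for spectral projections, extended by linearity and continuity in [z] and then in [z']. *)
Lemma mcomm_mul h g z z' : mcomm h -> mcomm g -> M z -> M z' ->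
  (z ** h) ** (z' ** g) = (z ** z') ** (h ** g).
Proof.
move=> ch cg Mz Mz'.
have H0 p p' : spfam a p -> spfam a p' -> (p ** h) ** (p' ** g) = (p ** p') ** (h ** g).
  move=> Fp Fp'; have pp := spfam_proj Fp; have pp' := spfam_proj Fp'.
  have ph := ch p Fp; have pg := cg p Fp; have pp'g := pcommM pp (spfam_comm Fp Fp') pg.
  rewrite (opC (p ** h)) -(pcomm_mulA _ pp pp'g) (opC _ h) -(pcomm_mulA _ pp' (ch p' Fp')).
  rewrite (opC p' (h ** g)) (pcomm_mulA _ pp); last exact: pcommM.
  exact: opC.
have ext (L1 : A -> A) (K : R) : (forall x y, L1 (x - y) = L1 x - L1 y) ->
    (forall k x y, L1 (k *: x + y) = k *: L1 x + L1 y) -> L1 0 = 0 ->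
    (forall x, `|L1 x| <= K * `|x|) -> (forall p, spfam a p -> L1 p = 0) ->
    forall x, M x -> L1 x = 0.
  move=> LB Ll L0 LK Lp x; apply: (closure_ker LB LK) => y.
  by elim=> [|k u v Fu _ IH]; rewrite ?L0 // Ll Lp // IH; linear_eq R.
have nb (b c d e : A) x : `|(x ** b) ** c - (x ** d) ** e| <=
    (`|b| * `|c| + `|d| * `|e|) * `|x|.
  rewrite (le_trans (ler_normB _ _)) // mulrDl; apply: lerD.
    by rewrite (le_trans (op_norm _ _)) // mulrAC ler_wpM2r // mulrC op_norm.
  by rewrite (le_trans (op_norm _ _)) // mulrAC ler_wpM2r // mulrC op_norm.
have H1 p' : spfam a p' -> (z ** h) ** (p' ** g) = (z ** p') ** (h ** g).
  move=> Fp'; apply/eqP; rewrite -subr_eq0; apply/eqP.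
  apply: (ext (fun z => (z ** h) ** (p' ** g) - (z ** p') ** (h ** g))
      (`|h| * `|p' ** g| + `|p'| * `|h ** g|)) Mz.
  - by move=> x y; rewrite !opE; linear_eq R.
  - by move=> k x y; rewrite !opE; linear_eq R.
  - by rewrite !op0l subrr.
  - by move=> x; exact: nb.
  - by move=> p Fp; rewrite H0 // subrr.
apply/eqP; rewrite -subr_eq0 (opC (z ** h) (z' ** g)) (opC z z'); apply/eqP.
apply: (ext (fun z' => (z' ** g) ** (z ** h) - (z' ** z) ** (h ** g))
    (`|g| * `|z ** h| + `|z| * `|h ** g|)) Mz'.
- by move=> x y; rewrite !opE; linear_eq R.
- by move=> k x y; rewrite !opE; linear_eq R.
- by rewrite !op0l subrr.
- by move=> x; exact: nb.
- by move=> p Fp; rewrite opC H1 // (opC p) subrr.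
Qed.

Lemma spfam_M1 : M \one.
Proof. by apply: subset_closure; apply: lspan_gen; left. Qed.

Local Notation T := (asr (spfam_AS a)).
Implicit Types X Y : T.

(** The formal unit is sent to [\one], which is already in the spectral algebra. So [asval] is not
    injective, and identities between coefficients are required only after applying it. *)
Definition asval X : A := ask X *: \one + asc X.
Lemma asval_M X : M (asval X).
Proof.
apply: (ASD (spfam_AS a)) (ascP X); apply: (ASZ (spfam_AS a)); exact: spfam_M1.
Qed.
Lemma asvalD X Y : asval (X + Y) = asval X + asval Y.
Proof. by rewrite /asval ascD askD; linear_eq R. Qed.
Lemma asvalM X Y : asval (X * Y) = asval X ** asval Y.
Proof. by rewrite /asval ascM askM !opDl !opDr !opZl !opZr !op1l !op1r; linear_eq R. Qed.
Lemma asval1 : asval 1 = \one.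
Proof. by rewrite /asval ask1 asc1; linear_eq R. Qed.
Lemma asval_scal k : asval (asscal (spfam_AS a) k) = k *: \one.
Proof. by rewrite /asval ask_asscal asc_asscal; linear_eq R. Qed.
Lemma asval_asin x (Mx : M x) : asval (asin (spfam_AS a) Mx) = x.
Proof. by rewrite /asval ask_asin asc_asin; linear_eq R. Qed.
End SpectralAction.

HB.lock Definition asact (R : realType) (A : jbwAlg R) (a : A) (X : asr (spfam_AS a)) (h : A) : A :=
  asval X ** h.

Section FrameAlgebra.
Variables (R : realType) (A : jbwAlg R) (a : A).
Implicit Types (x y z h g p : A) (k l : R).
Local Notation T := (asr (spfam_AS a)).
Local Notation "X *' h" := (asact X h) (at level 40).
Implicit Types X Y : T.
Local Notation sc := (asscal (spfam_AS a)).

Lemma asactE X h : X *' h = asval X ** h. Proof. by rewrite asact.unlock. Qed.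
Lemma asact_mul X Y h g : mcomm a h -> mcomm a g -> (X *' h) ** (Y *' g) = (X * Y) *' (h ** g).
Proof. by move=> ch cg; rewrite !asactE asvalM (@mcomm_mul _ _ a) //; exact: asval_M. Qed.
Lemma asactDl X Y h : (X + Y) *' h = X *' h + Y *' h.
Proof. by rewrite !asactE asvalD opDl. Qed.
Lemma asactDr X h g : X *' (h + g) = X *' h + X *' g.
Proof. by rewrite !asactE opDr. Qed.
Lemma asactZr X k h : X *' (k *: h) = k *: (X *' h).
Proof. by rewrite !asactE opZr. Qed.
Lemma asact0r X : X *' 0 = 0.
Proof. by rewrite !asactE op0r. Qed.
Lemma asact0l h : (0 : T) *' h = 0.
Proof. by rewrite !asactE /asval ask0 asc0 scale0r addr0 op0l. Qed.
Lemma asact1l h : (1 : T) *' h = h.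
Proof. by rewrite asactE asval1 op1l. Qed.
Lemma asact_scal k X h : (sc k * X) *' h = k *: (X *' h).
Proof. by rewrite !asactE asvalM asval_scal opZl op1l opZl. Qed.

Variables e1 e2 e3 u v w : A.
Hypotheses (p1 : e1 ** e1 = e1) (p2 : e2 ** e2 = e2) (p3 : e3 ** e3 = e3)
  (e12 : e1 ** e2 = 0) (e13 : e1 ** e3 = 0) (e23 : e2 ** e3 = 0)
  (uu : u ** u = e1 + e2) (vv : v ** v = e1 + e3) (ww : w ** w = e2 + e3)
  (e1u : e1 ** u = 2^-1 *: u) (e2u : e2 ** u = 2^-1 *: u) (e3u : e3 ** u = 0)
  (e1v : e1 ** v = 2^-1 *: v) (e2v : e2 ** v = 0) (e3v : e3 ** v = 2^-1 *: v)
  (e1w : e1 ** w = 0) (e2w : e2 ** w = 2^-1 *: w) (e3w : e3 ** w = 2^-1 *: w)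
  (uv : u ** v = 2^-1 *: w) (uw : u ** w = 2^-1 *: v) (vw : v ** w = 2^-1 *: u).
Hypotheses (c1 : mcomm a e1) (c2 : mcomm a e2) (c3 : mcomm a e3)
  (cu : mcomm a u) (cv : mcomm a v) (cw : mcomm a w).

(* The symmetric matrix with entries [s1 s4 s5; s4 s2 s6; s5 s6 s3] in the frame. *)
Definition comb (s1 s2 s3 s4 s5 s6 : T) : A :=
  s1 *' e1 + s2 *' e2 + s3 *' e3 + s4 *' u + s5 *' v + s6 *' w.

Local Notation H := (sc 2^-1).

Lemma comb_mul (s1 s2 s3 s4 s5 s6 t1 t2 t3 t4 t5 t6 : T) :
  comb s1 s2 s3 s4 s5 s6 ** comb t1 t2 t3 t4 t5 t6 =
  comb (s1 * t1 + s4 * t4 + s5 * t5) (s2 * t2 + s4 * t4 + s6 * t6) (s3 * t3 + s5 * t5 + s6 * t6)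
    (H * (s1 * t4 + s4 * t1 + s2 * t4 + s4 * t2 + s5 * t6 + s6 * t5))
    (H * (s1 * t5 + s5 * t1 + s3 * t5 + s5 * t3 + s4 * t6 + s6 * t4))
    (H * (s2 * t6 + s6 * t2 + s3 * t6 + s6 * t3 + s4 * t5 + s5 * t4)).
Proof.
rewrite /comb !asact_scal !asactDl !opDl !opDr !asact_mul //.
rewrite (opC e2 e1) (opC e3 e1) (opC e3 e2) !(opC u e1, opC u e2, opC u e3).
rewrite !(opC v e1, opC v e2, opC v e3, opC w e1, opC w e2, opC w e3).
rewrite (opC v u) (opC w u) (opC w v).
rewrite !(p1, p2, p3, e12, e13, e23, uu, vv, ww, e1u, e2u, e3u, e1v, e2v, e3v, e1w, e2w, e3w, uv, uw, vw).
rewrite !(asactDr, asactZr, asact0r).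
linear_eq R.
Qed.

(** The rank one matrix of the vector (X1, X2, X3) with coefficients in the spectral algebra. *)
Definition Pm (X1 X2 X3 : T) := comb (X1 * X1) (X2 * X2) (X3 * X3) (X1 * X2) (X1 * X3) (X2 * X3).

Lemma half_half1 : H + H = 1.
Proof. by rewrite -asscalD (_ : 2^-1 + 2^-1 = 1) ?asscal1 //; lra. Qed.

Lemma Pm_mul (X1 X2 X3 Y1 Y2 Y3 : T) (S := X1 * Y1 + X2 * Y2 + X3 * Y3) :
  Pm X1 X2 X3 ** Pm Y1 Y2 Y3 = comb (S * (X1 * Y1)) (S * (X2 * Y2)) (S * (X3 * Y3))
   (S * (H * (X1 * Y2 + X2 * Y1))) (S * (H * (X1 * Y3 + X3 * Y1))) (S * (H * (X2 * Y3 + X3 * Y2))).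
Proof. rewrite /Pm comb_mul /S; congr comb; ring. Qed.

Lemma asact_unit S X h : asval S = \one -> (S * X) *' h = X *' h.
Proof. by move=> hS; rewrite !asactE asvalM hS op1l. Qed.
Lemma asact_zero S X h : asval S = 0 -> (S * X) *' h = 0.
Proof. by move=> hS; rewrite !asactE asvalM hS !op0l. Qed.

Lemma Pm_proj (X1 X2 X3 : T) : asval (X1 * X1 + X2 * X2 + X3 * X3) = \one -> proj (Pm X1 X2 X3).
Proof.
move=> h; rewrite /proj Pm_mul; have e X Y : H * (X * Y + Y * X) = X * Y.
  transitivity ((H + H) * (X * Y)); first by ring.
  by rewrite half_half1 mul1r.
by rewrite !e /Pm /comb !(asact_unit _ _ h).
Qed.

Lemma Pm_orth (X1 X2 X3 Y1 Y2 Y3 : T) : asval (X1 * Y1 + X2 * Y2 + X3 * Y3) = 0 ->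
  Pm X1 X2 X3 ** Pm Y1 Y2 Y3 = 0.
Proof. by move=> h; rewrite Pm_mul /comb !(asact_zero _ _ h) !addr0. Qed.

Lemma combD (s1 s2 s3 s4 s5 s6 t1 t2 t3 t4 t5 t6 : T) :
  comb s1 s2 s3 s4 s5 s6 + comb t1 t2 t3 t4 t5 t6 =
  comb (s1 + t1) (s2 + t2) (s3 + t3) (s4 + t4) (s5 + t5) (s6 + t6).
Proof. by rewrite /comb !asactDl; linear_eq R. Qed.

Lemma Pm_plane (X1 X2 X3 Y1 Y2 Y3 a1 b1 : T) : a1 * a1 + b1 * b1 = 1 ->
  Pm (a1 * X1 + b1 * Y1) (a1 * X2 + b1 * Y2) (a1 * X3 + b1 * Y3) +
  Pm (a1 * Y1 - b1 * X1) (a1 * Y2 - b1 * X2) (a1 * Y3 - b1 * X3) = Pm X1 X2 X3 + Pm Y1 Y2 Y3.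
Proof.
move=> h; rewrite /Pm !combD.
have e X Y Z W : (a1 * X + b1 * Z) * (a1 * Y + b1 * W) + (a1 * Z - b1 * X) * (a1 * W - b1 * Y) =
    X * Y + Z * W.
  transitivity ((a1 * a1 + b1 * b1) * (X * Y + Z * W)); first by ring.
  by rewrite h mul1r.
by rewrite !e.
Qed.

Lemma Pm_pole : Pm 1 0 0 = e1.
Proof. by rewrite /Pm /comb !mul0r !mulr0 mulr1 !asact0l asact1l !addr0. Qed.

Lemma Pm_opp (X1 X2 X3 : T) : Pm (- X1) (- X2) (- X3) = Pm X1 X2 X3.
Proof. by rewrite /Pm !mulrNN. Qed.
End FrameAlgebra.

(** * The angle lemma *)

Section FiniteProbability.
Variables (R : realType) (A : jbwAlg R).
Implicit Types (p q : A).

Definition fprob (f : A -> R) := [/\ (forall p, proj p -> 0 <= f p),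
  (forall p q, proj p -> proj q -> p ** q = 0 -> f (p + q) = f p + f q) & f \one = 1].

Lemma fprob_orth f p q : fprob f -> proj p -> proj q -> p ** q = 0 -> f p + f q <= 1.
Proof.
move=> [f0 fD f1] pp pq pq0; have ps := proj_orthD pp pq pq0.
have pc := proj_compl ps.
have h : (p + q) ** (\one - (p + q)) = 0 by rewrite opBr op1r ps subrr.
have e : p + q + (\one - (p + q)) = \one by rewrite addrC subrK.
have := fD _ _ ps pc h; rewrite e f1 (fD _ _ pp pq pq0) => ->.
by rewrite lerDl f0.
Qed.
End FiniteProbability.

Section SpectralCommutation.
Variables (R : realType) (A : jbwAlg R).
Implicit Types (a c h p q x u v e f : A) (k : R).

Lemma spfam_pcomm q a p : proj q -> pcomm q a -> spfam a p -> pcomm q p.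
Proof.
move=> pq qa [->|[t _ <-]]; last exact: refl_sp.
by apply/pcommE; rewrite op1r pq.
Qed.
Lemma mcomm_proj a h : proj h -> pcomm h a -> mcomm a h.
Proof.
by move=> ph ha p Fp; apply: pcomm_sym (spfam_pcomm ph ha Fp); [|exact: spfam_proj Fp].
Qed.
Lemma mcomm1 a : mcomm a \one.
Proof. by move=> p Fp; apply/pcommE; rewrite op1r (spfam_proj Fp). Qed.
Lemma mcommN a h : mcomm a h -> mcomm a (- h).
Proof. by rewrite -scaleN1r; exact: mcommZ. Qed.
Lemma mcomm_lcomm a h x : proj h -> mcomm a h -> closure (lspan (spfam a)) x -> lcomm h x.
Proof.
move=> ph ah; apply: lcomm_closure => p Fp.
by apply/lcommC/(lcomm_proj _ (spfam_proj Fp)); exact: ah.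
Qed.

Lemma exch_mcomm a e f u : exch e f u -> mcomm a e -> mcomm a f -> swap u a = a -> mcomm a u.
Proof.
move=> E ae af sa; have ph := exsym_proj E; have [_ _ _ uu _] := E.
have ah : mcomm a (2^-1 *: (\one + exsym u)) by apply: mcomm_proj => //; exact: refl_fix.
have -> : u = 2 *: (2^-1 *: (\one + exsym u)) - 2 *: \one + e + f.
  by rewrite /exsym uu; linear_eq R.
apply: mcommD => //; apply: mcommD => //; apply: mcommD; first exact: mcommZ.
by apply/mcommN/mcommZ; exact: mcomm1.
Qed.

Lemma mcomm_swap a e f u : exch e f u -> mcomm a u -> swap u a = a.
Proof.
move=> E au; have ph := exsym_proj E; apply: refl_comm => //.
apply/(lcomm_proj _ ph); apply: (mcomm_lcomm ph); last exact: spfam_dense.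
apply: mcommZ; apply: mcommD; first exact: mcomm1.
apply: mcommD; last by apply: mcommN; exact: mcommM.
by apply: mcommD => //; exact: mcomm1.
Qed.

Lemma mcomm_sgn a x : mcomm a x -> mcomm a (sgn x).
Proof.
move=> ax p Fp; have pp := spfam_proj Fp; apply: refl_fix => //.
by rewrite sgn_refl // refl_comm //; exact: ax.
Qed.
End SpectralCommutation.

Section Spread.
Variables (R : realType) (A : jbwAlg R).
Variables (e1 e2 e3 u v c1 : A).
Hypotheses (E : exch e1 e2 u) (F : exch e1 e3 v) (e23 : e2 ** e3 = 0) (hc : e1 ** c1 = c1).
Let p1 : proj e1. Proof. by case: E. Qed.
Let p2 : proj e2. Proof. by case: E. Qed.
Let p3 : proj e3. Proof. by case: F. Qed.
Let e12 : e1 ** e2 = 0. Proof. by case: E. Qed.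
Let e13 : e1 ** e3 = 0. Proof. by case: F. Qed.
Let e21 : e2 ** e1 = 0. Proof. by rewrite opC. Qed.
Let e31 : e3 ** e1 = 0. Proof. by rewrite opC. Qed.
Let e32 : e3 ** e2 = 0. Proof. by rewrite opC. Qed.

(* Copying [c1] from the corner of [e1] to the two other corners makes its spectral projections
   commute with the whole frame. *)
Definition spread := c1 + swap u c1 + swap v c1 + (\one - e1 - e2 - e3).

Let hc2 : e2 ** swap u c1 = swap u c1.
Proof. by rewrite -{1}(swap_e E) -(swapM E) hc. Qed.
Let hc3 : e3 ** swap v c1 = swap v c1.
Proof. by rewrite -{1}(swap_e F) -(swapM F) hc. Qed.
Let z12 : e1 ** swap u c1 = 0. Proof. by rewrite opC; apply: (peirce10 p2 hc2). Qed.
Let z13 : e1 ** swap v c1 = 0. Proof. by rewrite opC; apply: (peirce10 p3 hc3). Qed.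
Let z21 : e2 ** c1 = 0. Proof. by rewrite opC; apply: (peirce10 p1 hc). Qed.
Let z23 : e2 ** swap v c1 = 0. Proof. by rewrite opC; apply: (peirce10 p3 hc3). Qed.
Let z31 : e3 ** c1 = 0. Proof. by rewrite opC; apply: (peirce10 p1 hc). Qed.
Let z32 : e3 ** swap u c1 = 0. Proof. by rewrite opC; apply: (peirce10 p2 hc2). Qed.
Let d1 : e1 ** (\one - e1 - e2 - e3) = 0.
Proof. by rewrite !opBr op1r p1 e12 e13; linear_eq R. Qed.
Let d2 : e2 ** (\one - e1 - e2 - e3) = 0.
Proof. by rewrite !opBr op1r p2 e21 e23; linear_eq R. Qed.
Let d3 : e3 ** (\one - e1 - e2 - e3) = 0.
Proof. by rewrite !opBr op1r p3 e31 e32; linear_eq R. Qed.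

Lemma spread_mul : [/\ e1 ** spread = c1, e2 ** spread = swap u c1 & e3 ** spread = swap v c1].
Proof.
rewrite /spread; move: (\one - e1 - e2 - e3) d1 d2 d3 => d D1 D2 D3; split; rewrite !opDr.
- by rewrite hc z12 z13 D1 !addr0.
- by rewrite z21 hc2 z23 D2 !addr0 add0r.
- by rewrite z31 z32 hc3 D3 !addr0 !add0r.
Qed.

Lemma spread_swap : swap u spread = spread /\ swap v spread = spread.
Proof.
rewrite /spread; move: (\one - e1 - e2 - e3) d1 d2 d3 => d D1 D2 D3; split; rewrite !swapD.
- by rewrite (swapK E) (swap_0 E z13 z23) (swap_0 E D1 D2) (addrC (swap u c1)).
- by rewrite (swapK F) (swap_0 F z12 z32) (swap_0 F D1 D3); linear_eq R.
Qed.

Lemma spread_comm : [/\ pcomm e1 spread, pcomm e2 spread & pcomm e3 spread].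
Proof.
have [h1 h2 h3] := spread_mul.
by split; apply/pcommE; rewrite ?h1 ?h2 ?h3 ?hc ?hc2 ?hc3.
Qed.

Lemma spread_mcomm (w := 2 *: (u ** v)) : [/\ mcomm spread e1, mcomm spread e2 & mcomm spread e3] /\
  [/\ mcomm spread u, mcomm spread v & mcomm spread w].
Proof.
have [h1 h2 h3] := spread_comm; have [su sv] := spread_swap.
have m1 := mcomm_proj p1 h1; have m2 := mcomm_proj p2 h2; have m3 := mcomm_proj p3 h3.
have mu := exch_mcomm E m1 m2 su; have mv := exch_mcomm F m1 m3 sv.
by split; split => //; apply: mcommZ; exact: mcommM.
Qed.

(** Outside the frame [spread] is 1, so the bound on one corner becomes global and [spread] is
    invertible in its spectral algebra. *)
Lemma spread_ge (k : R) : k <= 1 -> k *: e1 <== c1 -> k *: \one <== spread.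
Proof.
move=> k1 kc; have pd : pos (\one - e1 - e2 - e3).
  have -> : \one - e1 - e2 - e3 = \one - (e1 + e2 + e3) by linear_eq R.
  apply/proj_pos/proj_compl/proj_orthD; [exact: proj_orthD|by []|].
  by rewrite opDl e13 e23 addr0.
have pu := pos_refl (exsym_proj E) kc; have pv := pos_refl (exsym_proj F) kc.
have {}pu : pos (swap u c1 - k *: e2) by rewrite -(swap_e E) -swapZ -swapB.
have {}pv : pos (swap v c1 - k *: e3) by rewrite -(swap_e F) -swapZ -swapB.
have k0 : 0 <= 1 - k by rewrite subr_ge0.
have := posD (posD (posD kc pu) pv) (posZ k0 pd).
rewrite /jle /spread; congr pos; linear_eq R.
Qed.

Lemma spread_le : c1 <== e1 -> spread <== \one.
Proof.
move=> kc; have pu := pos_refl (exsym_proj E) kc; have pv := pos_refl (exsym_proj F) kc.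
have {}pu : pos (e2 - swap u c1) by rewrite -(swap_e E) -swapB.
have {}pv : pos (e3 - swap v c1) by rewrite -(swap_e F) -swapB.
have := posD (posD kc pu) pv; rewrite /jle /spread; congr pos; linear_eq R.
Qed.
End Spread.

Section Angle.
Variables (R : realType) (A : jbwAlg R).
Implicit Types (p q e f u v : A) (k : R).

(** With g = [spread], the projection in the conclusion is the rank one matrix of (K, G, 0), where
    K^2 = 1 - g and G^2 = g. On a copy [V] of the sphere with pole [e1], [f] is a frame function, so
    it is at least b^2 = k at [V b a 0]. The coordinates are rotated so that this vector is
    orthogonal to (K, G, 0), which leaves at most 1 - k. *)
Lemma angle_core e1 e2 e3 u v c y (f : A -> R) k : exch e1 e2 u -> exch e1 e3 v ->
  e2 ** e3 = 0 -> pcomm e1 c -> pcomm (e1 + e2) c -> swap u c = c ->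
  pos y -> y ** y = (e1 + e2) ** (c - c ** c) -> 0 < k -> k < 1 ->
  k *: e1 <== c ** e1 -> c ** e1 <== e1 -> fprob f -> f e1 = 1 ->
  f ((\one - c) ** e1 + c ** e2 + y ** u) <= 1 - k.
Proof.
move=> E F e23 c1 rc sc py yy k0 k1 kc1 c1e ff fe.
have [p1 p2 e12 uu [e1u e2u]] := E; have [_ p3 e13 vv [e1v e3v]] := F.
have [e3u e2v] := frame_cross E F e23; have [e1w e2w e3w] := frame_w E F e23.
have [[_ _ _ ww _] uw] := frame_exch E F e23.
have e32 : e3 ** e2 = 0 by rewrite opC.
have [_ vw] := frame_exch F E e32; rewrite (opC v u) in vw.
have hc : e1 ** (c ** e1) = c ** e1 by move/pcommE: c1; rewrite (opC e1 c).
have [m1 m2 _] := spread_mul E F e23 hc.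
have [[d1 d2 d3] [du dv dw]] := spread_mcomm E F e23 hc.
have ge := spread_ge E F e23 (ltW k1) kc1; have le := spread_le E F c1e.
have uv : u ** v = 2^-1 *: (2 *: (u ** v)) by linear_eq R.
move: (2 *: (u ** v)) e1w e2w e3w ww uw vw dw uv => w e1w e2w e3w ww uw vw dw uv.
move: (spread e1 e2 e3 u v (c ** e1)) m1 m2 d1 d2 d3 du dv dw ge le.
rewrite (swapM E) sc (swap_e E) => g m1 m2 d1 d2 d3 du dv dw ge le.
have hM := spfam_AS g; have M1 := spfam_M1 g; have Mg := @spfam_dense R A g.
have pg : pos g by apply/jle0; apply: jle_trans ge; apply/jle0/posk/ltW.
have [K [MK pK KK]] := pos_sqrt hM M1 (ASB hM M1 Mg) le.
have [G [MG pG GG]] := pos_sqrt hM M1 Mg pg.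
have [z [Mz pz gz]] := pos_inv hM M1 Mg k0 ge.
have MKG := ASM hM MK MG; have MGz := ASM hM MG Mz; have MKGz := ASM hM MK MGz.
have Gz : G ** (G ** z) = \one by rewrite -(ASA hM) // GG.
have Gzz : (G ** z) ** (G ** z) = z.
  by rewrite (ASACA hM) // GG -(ASA hM Mg Mz Mz) gz op1l.
have KGzz : (K ** (G ** z)) ** (K ** (G ** z)) = z - \one.
  by rewrite (ASACA hM) // KK Gzz opBl op1l gz.
pose b := Num.sqrt k; pose a := Num.sqrt (1 - k).
have k1' : 0 < 1 - k by rewrite subr_gt0.
have bb : b ^+ 2 = k by rewrite sqr_sqrtr // ltW.
have aa : a ^+ 2 = 1 - k by rewrite sqr_sqrtr // ltW.
have an : a != 0 by rewrite gt_eqF // sqrtr_gt0.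
(* Since [G ** z] is the inverse of [G], this is the solution of b K + a G y2 = 0, the orthogonality
   required. *)
pose y2 := - (b / a) *: (K ** (G ** z)).
have My2 : closure (lspan (spfam g)) y2 by exact: (ASZ hM).
have y22 : y2 ** y2 = (k / (1 - k)) *: (z - \one).
  by rewrite /y2 opZl opZr KGzz scalerA mulrNN -expr2 expr_div_n aa bb.
(* Here k <= g is used: 1 - y2^2 is the multiple 1 / (1 - k) of (g - k) / g, so (y2, y3) can be
   completed to a unit vector. *)
have py3 : pos (\one - y2 ** y2).
  have -> : \one - y2 ** y2 = (1 - k)^-1 *: ((g - k *: \one) ** z).
    by rewrite y22 opBl gz opZl op1l; linear_eq_by R ltac:(fun _ => solve [field; rewrite gt_eqF //]).
  apply: posZ; first by rewrite invr_ge0 ltW.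
  by apply: (posM hM) => //; apply: (ASB hM) => //; apply: (ASZ hM).
have [y3 [My3 _ y33]] := pos_sqrt hM M1 (ASB hM M1 (ASM hM My2 My2)) py3.
have Gy2 : a *: (G ** y2) = - b *: K.
  have e : G ** (K ** (G ** z)) = K by rewrite opC (ASA hM MK MGz MG) (opC _ G) Gz op1r.
  rewrite /y2 opZr e scalerA; congr (_ *: _); rewrite mulrN mulrC divfK //.
clearbody y2.
have rr : proj (e1 + e2) by exact: proj_orthD.
have ru : (e1 + e2) ** u = u by exact: exch_unit E.
have dr : mcomm g (e1 + e2) by exact: mcommD.
have gr : g ** (e1 + e2) = c ** (e1 + e2) by rewrite !opDr (opC g e1) (opC g e2) m1 m2.
have gcc : (c ** (e1 + e2)) ** (c ** (e1 + e2)) = (e1 + e2) ** (c ** c).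
  by rewrite (opC c) (proj_mulM rr rc rc).
have yE : y = (K ** G) ** (e1 + e2).
  apply: sqrt_uniq => //.
    rewrite opC; apply: pos_pcomm => //; last exact: (posM hM).
    by apply/(lcomm_proj _ rr); apply: (mcomm_lcomm rr dr).
  rewrite yy (mcomm_mul dr dr MKG MKG) rr (ASACA hM) // KK GG opBl op1l.
  have ggr : (g ** g) ** (e1 + e2) = (e1 + e2) ** (c ** c).
    by rewrite -gcc -gr (mcomm_mul dr dr Mg Mg) rr.
  by rewrite opBl opBr gr ggr (opC c).
have yu : y ** u = (K ** G) ** u.
  by rewrite yE -{1}(op1l u) (mcomm_mul dr du MKG M1) op1r ru.
pose P := @Pm R A g e1 e2 e3 u v w.
pose s t := asscal (spfam_AS g) t.
pose Y2 := asin (spfam_AS g) My2; pose Y3 := asin (spfam_AS g) My3.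
have D : asval (Y2 * Y2 + Y3 * Y3) = \one.
  by rewrite asvalD !asvalM !asval_asin y33 addrC subrK.
have s0 : s 0 = 0 by exact: asr_eq.
(* The real sphere rotated about the pole [e1] by the rotation with entries y2 and y3, which are
   coefficients and not numbers. *)
pose V x1 x2 x3 := P (s x1) (Y2 * s x2 - Y3 * s x3) (Y3 * s x2 + Y2 * s x3).
have dot x1 x2 x3 t1 t2 t3 : asval (s x1 * s t1 + (Y2 * s x2 - Y3 * s x3) * (Y2 * s t2 - Y3 * s t3) +
   (Y3 * s x2 + Y2 * s x3) * (Y3 * s t2 + Y2 * s t3)) = (x1 * t1 + x2 * t2 + x3 * t3) *: \one.
  transitivity (asval (s x1 * s t1 + (Y2 * Y2 + Y3 * Y3) * (s x2 * s t2 + s x3 * s t3))).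
    by congr asval; ring.
  by rewrite /s -!asscalM -asscalD asvalD asvalM D op1l !asval_scal; linear_eq R.
have Vp x1 x2 x3 : x1 ^+ 2 + x2 ^+ 2 + x3 ^+ 2 = 1 -> proj (V x1 x2 x3).
  by move=> h; apply: Pm_proj => //; rewrite dot -!expr2 h scale1r.
have Vo x1 x2 x3 t1 t2 t3 : x1 * t1 + x2 * t2 + x3 * t3 = 0 -> V x1 x2 x3 ** V t1 t2 t3 = 0.
  by move=> h; apply: Pm_orth => //; rewrite dot h scale0r.
have Ve : V 1 0 0 = e1.
  by rewrite /V /P s0 !mulr0 subr0 addr0 /s asscal1 Pm_pole.
have [f0 fD f1] := ff.
have Vge : b ^+ 2 <= f (V b a 0).
  apply: (@frame_function_ge R (fun x1 x2 x3 => f (V x1 x2 x3))).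
  - by move=> x1 x2 x3 /Vp; exact: f0.
  - by rewrite Ve.
  - move=> x2 x3 h; have h1 : proj (V 0 x2 x3) by apply: Vp; rewrite expr0n add0r.
    have h2 : V 0 x2 x3 ** e1 = 0 by rewrite -Ve; apply: Vo; rewrite !mulr0 mul0r !addr0.
    apply/eqP; rewrite eq_le f0 // andbT.
    by have := fprob_orth ff h1 p1 h2; rewrite fe; lra.
  - move=> x1 x2 x3; congr f; rewrite /V /P /s !asscalN -[RHS]Pm_opp.
    by congr Pm; ring.
  - move=> x1 x2 x3 t1 t2 t3 l m ux ut xt lm.
    have lx j : s (l * j) = s l * s j by exact: asscalM.
    have mx j : s (m * j) = s m * s j by exact: asscalM.
    have ax i j : s (i + j) = s i + s j by exact: asscalD.
    have nx j : s (- j) = - s j by exact: asscalN.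
    have hlm : s l * s l + s m * s m = 1 by rewrite /s -!asscalM -asscalD -!expr2 lm asscal1.
    have h1 : V (l * x1 + m * t1) (l * x2 + m * t2) (l * x3 + m * t3) **
        V (l * t1 - m * x1) (l * t2 - m * x2) (l * t3 - m * x3) = 0.
      apply: Vo; transitivity ((l ^+ 2 - m ^+ 2) * (x1 * t1 + x2 * t2 + x3 * t3) +
         l * m * (t1 ^+ 2 + t2 ^+ 2 + t3 ^+ 2) - l * m * (x1 ^+ 2 + x2 ^+ 2 + x3 ^+ 2)); first by ring.
      by rewrite ux ut xt; ring.
    rewrite -(fD _ _ (Vp _ _ _ _) (Vp _ _ _ _) h1).
    + rewrite -(fD _ _ (Vp _ _ _ ux) (Vp _ _ _ ut) (Vo _ _ _ _ _ _ xt)); congr f.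
      rewrite /V /P !(ax, nx, lx, mx).
      rewrite -[RHS](Pm_plane _ _ _ _ _ _ _ _ _ _ _ _ hlm).
      by congr (_ + _); congr Pm; ring.
    + transitivity (l ^+ 2 * (x1 ^+ 2 + x2 ^+ 2 + x3 ^+ 2) + m ^+ 2 * (t1 ^+ 2 + t2 ^+ 2 + t3 ^+ 2) +
         2 * l * m * (x1 * t1 + x2 * t2 + x3 * t3)); first by ring.
      by rewrite ux ut xt mulr0 addr0 !mulr1.
    + transitivity (l ^+ 2 * (t1 ^+ 2 + t2 ^+ 2 + t3 ^+ 2) + m ^+ 2 * (x1 ^+ 2 + x2 ^+ 2 + x3 ^+ 2) -
         2 * l * m * (x1 * t1 + x2 * t2 + x3 * t3)); first by ring.
      by rewrite ux ut xt mulr0 subr0 !mulr1.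
  by rewrite bb aa expr0n /=; ring.
pose KT := asin (spfam_AS g) MK; pose GT := asin (spfam_AS g) MG.
have p1E : P KT GT 0 = (\one - c) ** e1 + c ** e2 + y ** u.
  rewrite /P /Pm /comb !mulr0 !asact0l !addr0 !asactE !asvalM !asval_asin KK GG.
  by rewrite opBl op1l opBl op1l (opC g e1) (opC g e2) m1 m2 yu.
have pp1 : proj (P KT GT 0).
  apply: Pm_proj => //; rewrite mulr0 addr0 asvalD !asvalM !asval_asin KK GG; linear_eq R.
have pV : proj (V b a 0) by apply: Vp; rewrite bb aa expr0n /=; ring.
have o : P KT GT 0 ** V b a 0 = 0.
  apply: Pm_orth => //; rewrite s0 !mulr0 subr0 mul0r addr0 asvalD !asvalM !asval_asin.
  rewrite !asval_scal opZr op1r opZr op1r opZr Gy2; linear_eq R.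
by have := fprob_orth ff pp1 pV o; rewrite p1E; lra.
Qed.

(** The frame is [q], r - q and [e], with [r] the support of the off-diagonal part: the condition on
    [e] makes it orthogonal to that part, hence to [r]. The rest p - r p is orthogonal to [q], so
    [f] vanishes on it. *)
Lemma angle_upper p q e v (f : A -> R) k : proj p -> proj q -> generic p q ->
  exch q e v -> e ** (p ** q) = 0 -> 0 < k -> k < 1 -> k *: q <== q - peirce1 q p ->
  fprob f -> f q = 1 -> f p <= 1 - k.
Proof.
move=> pp pq gen F epq k0 k1 kc ff fq.
have pa : pos (peirce1 q p) by apply: pos_peirce1 => //; exact: proj_pos.
have [_ pe qe vv [qv ev]] := F.
have fq' := fq; move: pa kc (peirce1P p pq) (peircehP p pq) (peirce0P p pq) (peirce_sum q p) (erefl (peirceh q p)).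
rewrite {5}/peirceh.
move: (peirce1 q p) (peirceh q p) (peirce0 q p) => a x b pa kc qa qx qb pE xdef.
have E := tp_exch pp pq qa qx qb pE gen.
have rq := tp_supp_ge pp pq qa qx qb pE gen.
have [pr qr] := tp_supp_comm pp pq qa qx qb pE.
have [pp1 pp1' p1p1 qp1 rpE] := tp_part pp pq qa qx qb pE gen.
have cE := tpcE qa qx qb pE; have [xx _] := tpc_sq pp pq qa qx qb pE.
have cl := pcomm_tpc_l q pp; have cr := pcomm_tpc_r p pq.
have rr := supp_proj x.
have ru := supp_sgn x.
have ex : e ** x = 0.
  rewrite xdef opBr !opZr (opC q p) epq.
  have -> : e ** (q ** (p ** q)) = q ** (e ** (p ** q)) by apply: lcomm_peirce0 => //; rewrite opC.
  by rewrite epq op0r; linear_eq R.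
have er : e ** supp x = 0 by exact: supp_min0.
have e23 : (supp x - q) ** e = 0 by rewrite opC opBr er (opC e) qe subrr.
have mc : mcomm (tpc p q) (sgn x).
  apply: mcomm_sgn; rewrite xdef => s Fs; have ps := spfam_proj Fs.
  have sp' := pcomm_sym pp ps (spfam_pcomm pp cl Fs).
  have sq := pcomm_sym pq ps (spfam_pcomm pq cr Fs).
  by apply: pcommB; apply: pcommZ; do ?apply: pcommM.
have sc := mcomm_swap E mc.
have rc : pcomm (supp x) (tpc p q).
  have rp := pcomm_sym pp rr pr; have rq' := pcomm_sym pq rr qr.
  by rewrite /tpc; apply: pcommB; [exact: pcommD|apply: pcommZ; exact: pcommM].
have c1E : tpc p q ** q = q - a.
  by rewrite cE opDl opBl pq (opC a q) (opC b q) qa qb addr0.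
have rE : q + (supp x - q) = supp x by rewrite addrC subrK.
rewrite -(subrK (supp x ** p) p).
have [f0 fD f1] := ff.
rewrite (fD _ _ pp1' pp1) ?(opC _ (supp x ** p)) // addrC.
have fz : f (p - supp x ** p) = 0.
  apply/eqP; rewrite eq_le f0 // andbT.
  by have := fprob_orth ff pq pp1' qp1; rewrite fq -lerBrDl subrr.
rewrite fz addr0 rpE; have [_ pjx jxx] := jabsP x.
apply: (angle_core (e3 := e) (v := v)) => //.
- by rewrite rE.
- rewrite rE jxx -xx; apply/esym/peirce11 => //; exact: supp_id.
- by rewrite c1E.
- by rewrite c1E /jle; congr pos: pa; linear_eq R.
Qed.
End Angle.

Section AngleLemma.
Variables (R : realType) (A : jbwAlg R).
Implicit Types (p q e u v x y : A) (k m : R).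

Lemma norm_peirce1 q x : proj q -> `|peirce1 q x| <= `|x|.
Proof.
move=> pq; have h1 := jle_norm x; have h2 := jle_normN x.
have qq : peirce1 q \one = q by rewrite peirce1_comm ?op1r //; apply/pcommE; rewrite op1r pq.
have q1 := proj_le1 pq.
have pp y k : 0 <= k -> y <== k *: \one -> peirce1 q y <== k *: \one.
  move=> k0 h; apply: (@jle_trans _ _ (k *: q)); last exact: jleZ.
  have := pos_peirce1 pq h; rewrite -[k *: \one]addr0 peirce1B peirce1_lin qq.
  by rewrite /peirce1 !op0r; rewrite /jle; congr pos; linear_eq R.
apply: norm_le => //; last exact: pp.
rewrite /jle opprK addrC -(opprK (peirce1 q x)).
have -> : - peirce1 q x = peirce1 q (- x) by rewrite /peirce1 !opNr; linear_eq R.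
by apply: pp => //; move: h2; rewrite /jle; congr pos; linear_eq R.
Qed.

Lemma norm_proj1 q : proj q -> q <> 0 -> `|q| = 1.
Proof.
move=> pq q0; have := norm_sq q; rewrite pq => h.
have n0 : `|q| != 0 by rewrite normr_eq0; apply/eqP.
by apply: (mulfI n0); rewrite mulr1 -expr2 -h.
Qed.

Lemma fprob_mono (f : A -> R) p q : fprob f -> proj p -> proj q -> q ** p = p -> f p <= f q.
Proof.
move=> [f0 fD f1] pp pq h; have pr : proj (q - p).
  by rewrite /proj !opBl !opBr pq (opC p q) h pp; linear_eq R.
have o : p ** (q - p) = 0 by rewrite opBr (opC p q) h pp subrr.
have := fD _ _ pp pr o; rewrite addrC subrK => ->; rewrite lerDl; exact: f0.
Qed.
Lemma fprob_le1 (f : A -> R) p : fprob f -> proj p -> f p <= 1.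
Proof.
move=> ff pp; have [_ _ <-] := ff; apply: fprob_mono => //; last exact: op1l.
exact: op1l.
Qed.
Lemma fprob_sub (f : A -> R) p q : fprob f -> proj p -> proj q -> q ** p = p -> f p = 1 -> f q = 1.
Proof.
move=> ff pp pq h fp; apply/eqP; rewrite eq_le fprob_le1 //= -fp; exact: fprob_mono.
Qed.
Lemma fprob_compl (f : A -> R) p : fprob f -> proj p -> f (\one - p) = 1 - f p.
Proof.
move=> [f0 fD f1] pp; have o : p ** (\one - p) = 0 by rewrite opBr op1r pp subrr.
by have := fD _ _ pp (proj_compl pp) o; rewrite addrC subrK f1 => ->; rewrite addrAC subrr add0r.
Qed.

Hypothesis nI2 : no_typeI2_summand (jb_op A).

Lemma near_corner q q1 x m k : proj q -> proj q1 -> q ** q1 = q1 ->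
  `|peirce1 q x - m *: q| <= k -> `|peirce1 q1 x - m *: q1| <= k.
Proof.
move=> pq p1 h; apply: le_trans.
have -> : peirce1 q1 x - m *: q1 = peirce1 q1 (peirce1 q x - m *: q).
  rewrite peirce1B peirce1_tower // -[m *: q]addr0 peirce1_lin.
  have -> : peirce1 q1 q = q1 by rewrite /peirce1 (opC q1 q) h p1; linear_eq R.
  by rewrite /peirce1 !op0r; linear_eq R.
exact: norm_peirce1.
Qed.

(** Without generic position a piece of [q] lies under [p] or is orthogonal to it, and m = 1 or m =
    0 serves. Otherwise [room] supplies the third projection for [angle_upper], with k = 1 - m - 2
    e. *)
Lemma angle_up p q (e : R) : proj p -> proj q -> q <> 0 -> 0 < e ->
  exists q1 m, [/\ proj q1, q1 <> 0, q ** q1 = q1, `|peirce1 q1 p - m *: q1| <= e &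
    forall f, fprob f -> f q1 = 1 -> f p <= m + 2 * e].
Proof.
move=> pp pq /eqP q0 e0; have [q2 [m [p2 q20 qq2 hm]]] := excise1 p pq q0 e0.
have [gen|] := pselect (generic p q2); last first.
  move=> /existsNP[f] /not_implyP[pf] /not_implyP[hf] /not_implyP[pff fn].
  have qf : q ** f = f by exact: (peirce1_le p2 qq2 hf pq).
  case: pff => pf'.
    exists f, 1; split => //.
      have -> : peirce1 f p - 1 *: f = 0 by rewrite /peirce1 (opC f p) pf' pf; linear_eq R.
      by rewrite normr0 ltW.
    move=> w ww _; have := fprob_le1 ww pp; lra.
  exists f, 0; split => //.
    have -> : peirce1 f p - 0 *: f = 0 by rewrite /peirce1 (opC f p) pf' op0r; linear_eq R.
    by rewrite normr0 ltW.
  move=> w ww wf; rewrite opC in pf'; have := fprob_orth ww pf pp pf'; rewrite wf; lra.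
have [q1 [g [u [h1 q10 E hg]]]] := room nI2 pp p2 (elimN eqP q20) gen.
have p1 : proj q1 by case: E.
have qq1 : q ** q1 = q1 by exact: (peirce1_le p2 qq2 h1 pq).
have hm1 := near_corner p2 p1 h1 hm.
exists q1, m; split => // w ww wq.
have [k0|k0] := leP (1 - m - 2 * e) 0.
  have := fprob_le1 ww pp; lra.
have n1 := norm_proj1 p1 q10.
have pq1 := proj_pos p1.
have pU := pos_peirce1 p1 (proj_pos pp).
have Uq := peirce1P p p1.
(* Positivity of [U_q1 p] keeps [m] above - 2 e. *)
have k1 : 1 - m - 2 * e < 1.
  rewrite ltNge; apply/negP => h.
  have : `|(2 * e) *: q1| <= `|peirce1 q1 p - m *: q1|.
    apply: norm_mono; first by apply: posZ => //; lra.
    have mm : 0 <= - m - 2 * e by lra.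
    by have := posD pU (posZ mm pq1); rewrite /jle; congr pos; linear_eq R.
  rewrite normrZ n1 mulr1 ger0_norm; lra.
have kle : (1 - m - 2 * e) *: q1 <== q1 - peirce1 q1 p.
  move: (peirce1 q1 p) Uq hm1 => U Uq hm1.
  have : pos (q1 ** (e *: \one - (U - m *: q1))).
    apply: pos_pcomm => //; last exact: pos_norm.
    apply: pcommB; first by apply: pcommZ; apply/pcommE; rewrite op1r p1.
    by apply: pcomm1; rewrite opBr opZr Uq p1.
  rewrite !opBr !opZr op1r Uq p1 => h; have := posD h (posZ (ltW e0) pq1).
  by rewrite /jle; congr pos; linear_eq R.
have gq1 := generic_sub gen p2 p1 h1.
have := angle_upper pp p1 gq1 E hg k0 k1 kle ww wq; lra.
Qed.

(** [angle_up] for [p] and then, under the projection obtained, for 1 - p. The two scalars add up to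
    1 within e / 2, and each bound costs another e / 2. *)
Lemma angle p q (e : R) : proj p -> proj q -> q <> 0 -> 0 < e ->
  exists q1 m, [/\ proj q1, q1 <> 0, q ** q1 = q1, `|peirce1 q1 p - m *: q1| <= e &
    forall f, fprob f -> f q1 = 1 -> `|f p - m| <= e].
Proof.
move=> pp pq q0 e0; have e40 : 0 < e / 4 by rewrite divr_gt0.
have [q1 [m [p1 q10 qq1 hm hf]]] := angle_up pp pq q0 e40.
have [q2 [m' [p2 q20 qq2 hm' hf']]] := angle_up (proj_compl pp) p1 q10 e40.
have hm2 := near_corner p1 p2 qq2 hm.
exists q2, m; split => //; first exact: (peirce1_le p1 qq1 qq2 pq).
  by apply: (le_trans hm2); lra.
move=> f ff f2; have f1 := fprob_sub ff p2 p1 qq2 f2.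
have h1 := hf f ff f1; have h2 := hf' f ff f2; rewrite fprob_compl // in h2.
have : `|(1 - m' - m) *: q2| <= e / 4 + e / 4.
  apply: le_trans (lerD hm2 hm').
  apply: le_trans (ler_normD _ _).
  have -> : peirce1 q2 (\one - p) = q2 - peirce1 q2 p.
    rewrite peirce1B; congr (_ - _); rewrite peirce1_comm ?op1r //.
    by apply/pcommE; rewrite op1r p2.
  by rewrite le_eqVlt; apply/orP; left; apply/eqP; congr `|_|; linear_eq R.
rewrite normrZ norm_proj1 // mulr1 ler_norml => h3.
rewrite ler_norml; lra.
Qed.

(** One projection of the list at a time: passing to a smaller corner preserves the estimates
    already obtained, by [near_corner] and [fprob_sub]. *)
Lemma angle_comb (s : seq (R * A)) q (e : R) : (forall x : R * A, x \in s -> proj x.2) -> proj q -> q <> 0 ->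
  0 < e -> exists q1 m, [/\ proj q1, q1 <> 0, q ** q1 = q1,
    `|peirce1 q1 (\sum_(x <- s) x.1 *: x.2) - m *: q1| <= e &
    forall f, fprob f -> f q1 = 1 -> `|\sum_(x <- s) x.1 * f x.2 - m| <= e].
Proof.
elim: s q e => [|[l p] s IH] q e hs pq q0 e0.
  exists q, 0; split => //.
    have -> : peirce1 q (\sum_(x <- [::] : seq (R * A)) x.1 *: x.2) - 0 *: q = 0.
      by rewrite big_nil /peirce1 !op0r; linear_eq R.
    by rewrite normr0 ltW.
  by move=> f _ _; rewrite big_nil subr0 normr0 ltW.
have e2 : 0 < e / 2 by rewrite divr_gt0.
have [|q1 [m [p1 q10 qq1 hm hf]]] := IH q (e / 2) _ pq q0 e2.
  by move=> x xs; apply: hs; rewrite in_cons xs orbT.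
have pp : proj p by apply: (hs (l, p)); rewrite in_cons eqxx.
have l0 : 0 < `|l| + 1 by rewrite ltr_wpDl.
have e3 : 0 < e / 2 / (`|l| + 1) by rewrite divr_gt0.
have le3 t : t <= e / 2 / (`|l| + 1) -> 0 <= t -> `|l| * t <= e / 2.
  move=> ht t0; apply: (@le_trans _ _ ((`|l| + 1) * t)).
    by rewrite mulrDl mul1r lerDl.
  by rewrite mulrC -ler_pdivlMr.
have [q2 [m' [p2 q20 qq2 hm' hf']]] := angle pp p1 q10 e3.
exists q2, (l * m' + m); split => //; first exact: (peirce1_le p1 qq1 qq2 pq).
  rewrite big_cons /= peirce1_lin.
  have -> (x y : A) : l *: x + y - (l * m' + m) *: q2 = l *: (x - m' *: q2) + (y - m *: q2).
    by linear_eq R.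
  rewrite (le_trans (ler_normD _ _)) // [leRHS]splitr lerD //.
    by rewrite normrZ le3.
  exact: (near_corner p1 p2 qq2 hm).
move=> f ff f2; have f1 := fprob_sub ff p2 p1 qq2 f2.
rewrite big_cons /=; set S := \sum_(_ <- _) _.
have -> : l * f p + S - (l * m' + m) = l * (f p - m') + (S - m) by ring.
rewrite (le_trans (ler_normD _ _)) // [leRHS]splitr lerD //; last exact: hf.
by rewrite normrM le3 // hf'.
Qed.
End AngleLemma.

(** * Extension of an orthoisomorphism *)

Section SpectralTop.
Variables (R : realType) (A : jbwAlg R).
Implicit Types (p q x y : A) (k t e : R).

Lemma projk_ge0 k q : proj q -> q <> 0 -> pos (k *: q) -> 0 <= k.
Proof.
move=> pq q0 h; rewrite leNgt; apply/negP => k0; apply: q0.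
have h2 : pos (- k *: q) by apply: posZ; [rewrite oppr_ge0 ltW|exact: proj_pos].
rewrite scaleNr in h2; have /eqP := pos_antisym h h2.
by rewrite scaler_eq0 lt_eqF //= => /eqP.
Qed.

Lemma sp_eq0 x k : sp x k = 0 -> x <== k *: \one.
Proof.
move=> h; have h1 : jplus (x - k *: \one) = 0.
  by rewrite -(rp_id (jplus_pos _)) -/(sp x k) h op0l.
have := jplus_ge (x - k *: \one); rewrite h1 /jle; congr pos; linear_eq R.
Qed.

Lemma sp_corner x k : pcomm (sp x k) x /\ pos (sp x k ** (x - k *: \one)).
Proof.
split; first by apply: (sp_comm k (geno_AS x)); [exact: geno1|exact: geno_id|exact: geno_id].
by rewrite rp_jplus; exact: jplus_pos.
Qed.

Lemma spec_top x e : 0 < e -> e < `|x| -> exists q (s : R), [/\ s = 1 \/ s = -1, proj q, q <> 0,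
  pcomm q x & pos (q ** (s *: x - (`|x| - e) *: \one))].
Proof.
move=> e0 ex; have [h1|h1] := pselect (sp x (`|x| - e) = 0); last first.
  have [h2 h3] := sp_corner x (`|x| - e); exists (sp x (`|x| - e)), 1.
  by rewrite scale1r; split => //; [left|exact: sp_proj].
have [h2|h2] := pselect (sp (- x) (`|x| - e) = 0); last first.
  have [h3 h4] := sp_corner (- x) (`|x| - e); exists (sp (- x) (`|x| - e)), (-1).
  rewrite scaleN1r; split => //; [by right|exact: sp_proj|].
  by have := pcommN h3; rewrite opprK.
have k0 : 0 <= `|x| - e by lra.
have : `|x| <= `|x| - e.
  apply: norm_le => //; last exact: sp_eq0.
  by have := jleN (sp_eq0 h2); rewrite opprK.
by rewrite lerBrDl gerDr leNgt e0.
Qed.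

Lemma state_fprob (w : A -> R) : state w -> fprob w.
Proof.
move=> hw; split; last exact: state1.
  by move=> p pp; apply: state_pos => //; exact: proj_pos.
by move=> p q _ _ _; exact: stateD.
Qed.

Lemma state_proj q : proj q -> q <> 0 -> exists2 w, state w & w q = 1.
Proof.
move=> pq q0; have n0 : \one != 0 :> A.
  by apply/eqP => h; apply: q0; rewrite -(op1l q) h op0l.
have [w [hw qw]] := state_max q n0; exists w => //.
apply/eqP; rewrite eq_le (fprob_le1 (state_fprob hw) pq) /=.
have wq0 : 0 <= w q by apply: state_pos => //; exact: proj_pos.
have := norm_mono (proj_pos pq) qw; rewrite norm_proj1 // normrZ ger0_norm // => h.
by apply: (le_trans h); rewrite ler_piMr // norm_one.
Qed.

Lemma state_top (w : A -> R) q x k : state w -> proj q -> w q = 1 -> pcomm q x ->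
  pos (q ** (x - k *: \one)) -> k <= w x.
Proof.
move=> hw pq wq qx /(state_pos hw).
rewrite opBr opZr op1r (stateB hw) (stateZ hw) wq mulr1 subr_ge0 => h.
have z : w (x ** (\one - q)) = 0.
  apply: state_null => //; first exact/proj_pos/proj_compl.
  by rewrite (stateB hw) (state1 hw) wq subrr.
move: z; rewrite opBr op1r (stateB hw) (opC x) => /eqP; rewrite subr_eq0 => /eqP ->.
exact: h.
Qed.
End SpectralTop.

Section Completion.
Variables (R : realType) (V W : completeNormedModType R) (P : V -> W -> Prop).
Hypothesis iso : forall x y x' y', P x y -> P x' y' -> `|x - x'| = `|y - y'|.

(** Stated for an isometric relation, so that it yields the extension and, with the roles exchanged,
    its surjectivity. *)
Lemma completion (a : V) : (forall e : R, 0 < e -> exists x y, P x y /\ `|a - x| < e) ->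
  exists b : W, forall e : R, 0 < e -> exists x y, [/\ P x y, `|a - x| < e & `|b - y| < e].
Proof.
move=> h; have hn (n : nat) : exists z : V * W, P z.1 z.2 /\ `|a - z.1| < 2^-1 ^+ n.
  have [|x [y [h1 h2]]] := h (2^-1 ^+ n); first by rewrite exprn_gt0 // invr_gt0.
  by exists (x, y).
have [z hz] := choice hn.
have ub n m : (n <= m)%N -> `|(z m).2 - (z n).2| <= 2 * 2^-1 ^+ n.
  move=> nm; rewrite -(iso (hz m).1 (hz n).1).
  have -> : (z m).1 - (z n).1 = (a - (z n).1) - (a - (z m).1) by linear_eq R.
  rewrite (le_trans (ler_normB _ _)) // mulr_natl mulr2n lerD //; first exact: ltW (hz n).2.
  apply: le_trans (ltW (hz m).2) _.
  by apply: ler_wiXn2l => //; rewrite invf_le1 ?ler1n.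
have small (e : R) : 0 < e -> exists n, 2 * 2^-1 ^+ n < e.
  move=> e0; have s0 : 0 <= 2^-1 :> R by lra.
  have s1 : 2^-1 < 1 :> R by lra.
  have [n hn'] := expr_small s0 s1 (divr_gt0 e0 (ltr0Sn R 1)).
  by exists n; rewrite mulrC -ltr_pdivlMr.
have [b hb] := cauchy_limit small ub.
exists b => e e0; have [n hn'] := small e e0; exists (z n).1, (z n).2.
have p0 : 0 <= 2^-1 ^+ n :> R by rewrite exprn_ge0 // invr_ge0.
split; [exact: (hz n).1| |exact: (le_lt_trans (hb n))].
by apply: (lt_trans (hz n).2); apply: le_lt_trans hn'; rewrite ler_peMl // ler1n.
Qed.
End Completion.

Section Extension.
Variables (R : realType) (A B : jbwAlg R) (th : A -> B).
Hypothesis nI2 : no_typeI2_summand (jb_op A).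
Hypothesis th_proj : forall p, proj p -> proj (th p).
Hypothesis th_orth : forall p q, proj p -> proj q -> (p ** q = 0 <-> th p ** th q = 0).
Hypothesis th_surj : forall q, proj q -> exists2 p, proj p & th p = q.

Lemma proj_orth_le (C : jbwAlg R) (p q : C) : proj p -> proj q ->
  q ** p = p <-> (forall r, proj r -> q ** r = 0 -> p ** r = 0).
Proof.
move=> pp pq; split=> [h r _|h]; first exact: (peirce10 pq h).
apply/compl_id; rewrite opC; apply: h; first exact: proj_compl.
by rewrite opBr op1r pq subrr.
Qed.

Lemma th_le p q : proj p -> proj q -> (q ** p = p <-> th q ** th p = th p).
Proof.
move=> pp pq; have a1 := proj_orth_le pp pq.
have a2 := proj_orth_le (th_proj pp) (th_proj pq).
split=> [/a1 h|/a2 h]; [apply/a2|apply/a1] => r pr hr.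
  by have [s ps e] := th_surj pr; move: hr; rewrite -e => /th_orth h1; apply/th_orth/h/h1.
by apply/th_orth => //; apply: h; [exact: th_proj|exact/th_orth].
Qed.

Lemma th_inj p q : proj p -> proj q -> th p = th q -> p = q.
Proof.
move=> pp pq e; have h1 : q ** p = p by apply/th_le; rewrite // e th_proj.
have h2 : p ** q = q by apply/th_le; rewrite // e th_proj.
by rewrite -h1 opC h2.
Qed.

Lemma proj1 (C : jbwAlg R) : proj (\one : C). Proof. exact: op1l. Qed.
Lemma proj0 (C : jbwAlg R) : proj (0 : C). Proof. exact: op0l. Qed.

Lemma th1 : th \one = \one.
Proof.
have [q pq e] := th_surj (proj1 B); have := op1l q.
by move/(th_le pq (proj1 A)); rewrite e op1r.
Qed.
Lemma th0 : th 0 = 0.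
Proof.
by have /(th_orth (proj0 A) (proj0 A)) := op0l (0 : A); rewrite (th_proj (proj0 A)).
Qed.

Lemma thD p q : proj p -> proj q -> p ** q = 0 -> th (p + q) = th p + th q.
Proof.
move=> pp pq o; have o' := (th_orth pp pq).1 o; have ps := proj_orthD pp pq o.
have pps := th_proj pp; have pqs := th_proj pq.
have [s pt e] := th_surj (proj_orthD pps pqs o').
have h1 : th (p + q) ** (th p + th q) = th p + th q.
  rewrite opDr; congr (_ + _); apply/th_le => //.
    by rewrite opDl pp (opC q) o addr0.
  by rewrite opDl pq o add0r.
have sp1 : s ** p = p by apply/th_le; rewrite // e opDl pps (opC (th q)) o' addr0.
have sq1 : s ** q = q by apply/th_le; rewrite // e opDl pqs o' add0r.
have : th s ** th (p + q) = th (p + q) by apply/th_le => //; rewrite opDr sp1 sq1.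
by rewrite e opC h1.
Qed.

Lemma thM p q : proj p -> proj q -> pcomm p q -> th (p ** q) = th p ** th q.
Proof.
move=> pp pq pc; have pm := proj_mul pp pq pc.
have h1 : p ** (p ** q) = p ** q by apply/pcommE.
have h2 : q ** (p ** q) = p ** q.
  by rewrite (opC p); apply/pcommE; exact: pcomm_sym.
have sub r : proj r -> r ** (p ** q) = p ** q ->
    [/\ proj (r - p ** q), (p ** q) ** (r - p ** q) = 0 & th r = th (p ** q) + th (r - p ** q)].
  move=> pr h; have d : proj (r - p ** q).
    by rewrite /proj !opBl !opBr pr (opC _ r) h pm; linear_eq R.
  have o : (p ** q) ** (r - p ** q) = 0 by rewrite opBr (opC _ r) h pm subrr.
  by split => //; rewrite -thD // addrC subrK.
have [d1 o1 ->] := sub p pp h1; have [d2 o2 ->] := sub q pq h2.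
have o3 : (p - p ** q) ** (q - p ** q) = 0.
  by rewrite !opBl !opBr h1 (opC (p ** q) q) h2 pm; linear_eq R.
have O1 := (th_orth pm d1).1 o1; have O2 := (th_orth pm d2).1 o2; have O3 := (th_orth d1 d2).1 o3.
rewrite opDl !opDr O2 O3 (opC (th (p - _))) O1 (th_proj pm); linear_eq R.
Qed.

Lemma th_fprob (w : B -> R) : state w -> fprob (w \o th).
Proof.
move=> hw; split; last by rewrite /= th1; exact: state1.
  by move=> p pp /=; apply: state_pos => //; exact/proj_pos/th_proj.
by move=> p q pp pq o /=; rewrite thD // (stateD hw).
Qed.

(** A relation, because an element has many presentations by projections; that [y] depends only on
    [x] is a consequence of [pspan_iso]. *)
Definition pspan (x : A) (y : B) := exists s : seq (R * A), [/\ (forall z : R * A, z \in s -> proj z.2),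
  x = \sum_(z <- s) z.1 *: z.2 & y = \sum_(z <- s) z.1 *: th z.2].

Lemma pspan_lin k x y x' y' : pspan x y -> pspan x' y' -> pspan (k *: x + x') (k *: y + y').
Proof.
move=> [s [hs -> ->]] [t [ht -> ->]]; exists ([seq (k * z.1, z.2) | z <- s] ++ t); split.
- by move=> z; rewrite mem_cat => /orP[/mapP[u us -> /=]|]; [exact: (hs u)|exact: ht].
- by rewrite big_cat big_map scaler_sumr; congr (_ + _); apply: eq_bigr => z _; rewrite scalerA.
- by rewrite big_cat big_map scaler_sumr; congr (_ + _); apply: eq_bigr => z _; rewrite scalerA.
Qed.

Lemma state_sum (w : B -> R) (s : seq (R * A)) : state w ->
  w (\sum_(z <- s) z.1 *: th z.2) = \sum_(z <- s) z.1 * w (th z.2).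
Proof.
move=> hw; elim: s => [|z s IH]; first by rewrite !big_nil (state0 hw).
by rewrite !big_cons (stateD hw) (stateZ hw) IH.
Qed.

Lemma pspan_norm_le x y : pspan x y -> `|x| <= `|y|.
Proof.
(* One [e] each for nearly attaining the norm, for the corner estimate and for the value of the
   state. *)
move=> [s [hs xE yE]]; apply: (@le_of_le_addeps _ _ _ 3) => e e0.
have [h|h] := leP `|x| e; first by have := normr_ge0 y; lra.
have [q [g [hg pq q0 qx qp]]] := spec_top e0 h.
have [q1 [m [p1 q10 qq1 hm hf]]] := angle_comb nI2 hs pq q0 e0.
have g1 : `|g| = 1 by case: hg => ->; rewrite ?normrN normr1.
have tq0 : th q1 <> 0 by rewrite -th0 => /(th_inj p1 (proj0 A)).
have [w hw wq] := state_proj (th_proj p1) tq0.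
have := hf _ (th_fprob hw) wq; rewrite /= -state_sum // -yE => hwy.
rewrite -xE in hm.
have c1 : pcomm q (g *: x - (`|x| - e) *: \one).
  by apply: pcommB; apply: pcommZ => //; apply/pcommE; rewrite op1r pq.
have : pos (peirce1 q1 (g *: x - (`|x| - e) *: \one)).
  by rewrite -(peirce1_tower _ p1 pq qq1) (peirce1_comm c1); exact: pos_peirce1.
have i1 : peirce1 q1 \one = q1 by rewrite peirce1_comm ?op1r //; apply/pcommE; rewrite op1r p1.
have p00 : peirce1 q1 0 = 0 by rewrite /peirce1 !op0r; linear_eq R.
rewrite peirce1B -[g *: x]addr0 -[_ *: \one]addr0 !peirce1_lin i1 p00 !addr0.
have hq1 := peirce1P x p1; move: (peirce1 q1 x) hm hq1 => U hm hq1 pU.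
have nU : `|g *: (U - m *: q1)| <= e by rewrite normrZ g1 mul1r.
have : pos (q1 ** (e *: \one - g *: (U - m *: q1))).
  apply: pos_pcomm => //; last exact: pos_norm.
  apply: pcommB; first by apply: pcommZ; apply/pcommE; rewrite op1r p1.
  by apply/pcommZ/pcomm1; rewrite opBr opZr hq1 p1.
rewrite opBr !opZr op1r opBr opZr hq1 p1 => pV; have := posD pU pV.
have -> : g *: U - (`|x| - e) *: q1 + (e *: q1 - g *: (U - m *: q1)) = (g * m - (`|x| - 2 * e)) *: q1.
  by linear_eq R.
move/(projk_ge0 p1 q10) => hgm.
have h2 : `|g * (w y - m)| <= e by rewrite normrM g1 mul1r.
have h3 : `|g * w y| <= `|y| by rewrite normrM g1 mul1r; exact: state_norm.
move: h2 h3; rewrite !ler_norml mulrBr; move: (g * w y) (g * m) hgm => gw gm; lra.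
Qed.

(** The angle lemma is available in [A] only, so the projection where [y] nearly attains its norm is
    first pulled back by [th_surj]. *)
Lemma pspan_norm_ge x y : pspan x y -> `|y| <= `|x|.
Proof.
move=> [s [hs xE yE]]; apply: (@le_of_le_addeps _ _ _ 3) => e e0.
have [h|h] := leP `|y| e; first by have := normr_ge0 x; lra.
have [q' [g [hg pq' q0' qy qp]]] := spec_top e0 h.
have [q pq qE] := th_surj pq'.
have q0 : q <> 0 by move=> e1; apply: q0'; rewrite -qE e1 th0.
have [q1 [m [p1 q10 qq1 hm hf]]] := angle_comb nI2 hs pq q0 e0.
have g1 : `|g| = 1 by case: hg => ->; rewrite ?normrN normr1.
have tq0 : th q1 <> 0 by rewrite -th0 => /(th_inj p1 (proj0 A)).
have [w hw wq] := state_proj (th_proj p1) tq0.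
have := hf _ (th_fprob hw) wq; rewrite /= -state_sum // -yE => hwy.
have wq' : w q' = 1.
  by apply: (fprob_sub (state_fprob hw) (th_proj p1) pq' _ wq); rewrite -qE; apply/th_le.
have := state_top hw pq' wq' (pcommZ g qy) qp; rewrite (stateZ hw) => ht.
have hm2 : `|m| <= `|x| + e.
  have -> : `|m| = `|m *: q1| by rewrite normrZ norm_proj1 // mulr1.
  have -> : m *: q1 = peirce1 q1 x - (peirce1 q1 x - m *: q1) by linear_eq R.
  rewrite (le_trans (ler_normB _ _)) // lerD //; first exact: norm_peirce1.
  by rewrite xE.
have h2 : `|g * (w y - m)| <= e by rewrite normrM g1 mul1r.
have h3 : `|g * m| <= `|x| + e by rewrite normrM g1 mul1r.
move: h2 h3; rewrite !ler_norml mulrBr; move: (g * w y) (g * m) ht => gw gm; lra.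
Qed.

Lemma pspan_iso x y x' y' : pspan x y -> pspan x' y' -> `|x - x'| = `|y - y'|.
Proof.
move=> h h'; have := pspan_lin (-1) h' h; rewrite !scaleN1r !(addrC (- _)) => h2.
by apply/eqP; rewrite eq_le pspan_norm_le // pspan_norm_ge.
Qed.

Definition pgraph (a : A) (b : B) := forall e : R, 0 < e ->
  exists x y, [/\ pspan x y, `|a - x| < e & `|b - y| < e].

Lemma pspan0 : pspan 0 0.
Proof. by exists [::]; rewrite !big_nil; split. Qed.
Lemma pspan_proj k p x y : proj p -> pspan x y -> pspan (k *: p + x) (k *: th p + y).
Proof.
move=> pp; apply: pspan_lin; exists [:: (1, p)]; rewrite !big_seq1 !scale1r; split => //.
by move=> z; rewrite inE => /eqP ->.
Qed.

Lemma pgraph_ex a : exists b, pgraph a b.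
Proof.
apply: (completion pspan_iso) => e e0.
have [z Sz az] := (closure_normP _ _).1 (@proj_dense R A a) e e0.
suff [y hy] : exists y, pspan z y by exists z, y.
elim: Sz => [|k u v Fu _ [y hy]]; first by exists 0; exact: pspan0.
by exists (k *: th u + y); exact: pspan_proj.
Qed.

Lemma pgraph_surj b : exists a, pgraph a b.
Proof.
have iso' y x y' x' : pspan x y -> pspan x' y' -> `|y - y'| = `|x - x'|.
  by move=> h h'; rewrite (pspan_iso h h').
have [e e0|a ha] := @completion _ _ _ (fun y x => pspan x y) iso' b.
  have [z Sz az] := (closure_normP _ _).1 (@proj_dense R B b) e e0.
  suff [x hx] : exists x, pspan x z by exists z, x.
  elim: Sz => [|k u v Fu _ [x hx]]; first by exists 0; exact: pspan0.
  by have [p pp <-] := th_surj Fu; exists (k *: p + x); exact: pspan_proj.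
by exists a => e e0; have [y [x [h1 h2 h3]]] := ha e e0; exists x, y.
Qed.

Lemma pgraph_lin k a b a' b' : pgraph a b -> pgraph a' b' -> pgraph (k *: a + a') (k *: b + b').
Proof.
move=> h h' e e0; have k0 : 0 < `|k| + 1 by rewrite ltr_wpDl.
have e2 : 0 < e / 2 by rewrite divr_gt0.
have [x [y [h1 h2 h3]]] := h _ (divr_gt0 e2 k0).
have [x' [y' [h1' h2' h3']]] := h' _ e2.
have bnd (V : normedModType R) (c d c' d' : V) : `|c - d| < e / 2 / (`|k| + 1) -> `|c' - d'| < e / 2 ->
    `|k *: c + c' - (k *: d + d')| < e.
  move=> g1 g2; have -> : k *: c + c' - (k *: d + d') = k *: (c - d) + (c' - d') by linear_eq R.
  rewrite (le_lt_trans (ler_normD _ _)) // [ltRHS]splitr ler_ltD // normrZ.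
  apply: (@le_trans _ _ ((`|k| + 1) * `|c - d|)); first by rewrite mulrDl mul1r lerDl.
  by rewrite mulrC -ler_pdivlMr // ltW.
exists (k *: x + x'), (k *: y + y'); split; [exact: pspan_lin|exact: bnd|exact: bnd].
Qed.

Lemma pgraph_norm a b : pgraph a b -> `|a| = `|b|.
Proof.
move=> h; have nrm (V : normedModType R) (u v : V) : `|u| <= `|u - v| + `|v|.
  by rewrite -{1}(subrK v u) ler_normD.
have [h1 h2] : `|a| <= `|b| /\ `|b| <= `|a|; last by apply/eqP; rewrite eq_le h1.
split; apply: (@le_of_le_addeps _ _ _ 2) => e e0; have [x [y [hxy ax bx]]] := h e e0.
  have := pspan_norm_le hxy; have := nrm _ a x; have := nrm _ y b; rewrite (distrC y).
  lra.
by have := pspan_norm_ge hxy; have := nrm _ b y; have := nrm _ x a; rewrite (distrC x); lra.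
Qed.

Lemma pgraph_uniq a b b' : pgraph a b -> pgraph a b' -> b = b'.
Proof.
move=> h h'; have := pgraph_norm (pgraph_lin (-1) h' h).
have -> : -1 *: a + a = 0 by linear_eq R.
rewrite normr0 => /esym/normr0_eq0 /eqP; rewrite scaleN1r addrC subr_eq0.
by move/eqP.
Qed.

Definition pext a : B := xget 0 [set b | pgraph a b].
Lemma pextP a : pgraph a (pext a).
Proof. by rewrite /pext; case: xgetP => [b -> //|h]; case: (pgraph_ex a) => b /h. Qed.

Lemma pext_lin k x y : pext (k *: x + y) = k *: pext x + pext y.
Proof. by apply: pgraph_uniq (pextP _) _; apply: pgraph_lin; exact: pextP. Qed.
Lemma pext_norm x : `|pext x| = `|x|. Proof. by rewrite (pgraph_norm (pextP x)). Qed.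
Lemma pext_surj y : exists x, pext x = y.
Proof. by have [x hx] := pgraph_surj y; exists x; exact: pgraph_uniq (pextP x) hx. Qed.
Lemma pext_th p : proj p -> pext p = th p.
Proof.
move=> pp; apply: pgraph_uniq (pextP p) _ => e e0; exists (1 *: p + 0), (1 *: th p + 0).
have -> : p - (1 *: p + 0) = 0 by linear_eq R.
have -> : th p - (1 *: th p + 0) = 0 by linear_eq R.
by rewrite !normr0; split => //; apply: pspan_proj => //; exact: pspan0.
Qed.
Lemma pext0 : pext 0 = 0. Proof. by rewrite -th0 pext_th //; exact: proj0. Qed.
Lemma pextD x y : pext (x + y) = pext x + pext y.
Proof. by have := pext_lin 1 x y; rewrite !scale1r. Qed.
Lemma pextZ k x : pext (k *: x) = k *: pext x.
Proof. by have := pext_lin k x 0; rewrite pext0 !addr0. Qed.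
Lemma pextB x y : pext (x - y) = pext x - pext y.
Proof. by rewrite -scaleN1r pextD pextZ scaleN1r. Qed.
Lemma pext_inj x y : pext x = pext y -> x = y.
Proof.
move=> h; apply/eqP; rewrite -subr_eq0 -normr_eq0 -pext_norm pextB h subrr.
by rewrite normr0.
Qed.

Lemma pext_spfam x : let M := closure (lspan (spfam x)) in
  forall y z, M y -> M z -> pext (y ** z) = pext y ** pext z.
Proof.
move=> M; have ext (C : set A) z : (forall y, C y -> pext (y ** z) = pext y ** pext z) ->
    forall y, closure (lspan C) y -> pext (y ** z) = pext y ** pext z.
  move=> h y Cy; apply/eqP; rewrite -subr_eq0; apply/eqP.
  apply: (@closure_ker _ _ _ (fun y => pext (y ** z) - pext y ** pext z) (`|z| + `|z|) (lspan C)) => //.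
  - by move=> u v; rewrite opBl !pextB opBl; linear_eq R.
  - move=> u; rewrite (le_trans (ler_normB _ _)) // mulrDl lerD //.
      by rewrite pext_norm mulrC op_norm.
    by rewrite (le_trans (op_norm _ _)) // !pext_norm mulrC.
  - move=> u; elim=> [|k v w Cv _ IH]; first by rewrite op0l pext0 op0l subrr.
    have {}IH : pext (w ** z) = pext w ** pext z by apply/eqP; rewrite -subr_eq0 IH.
    by rewrite opDl opZl !pext_lin opDl opZl IH h // subrr.
move=> y z My Mz; apply: (ext _ _ _ _ My) => p Fp.
rewrite opC (opC (pext p)); apply: (ext _ _ _ _ Mz) => q Fq.
have pp := spfam_proj Fp; have pq := spfam_proj Fq; have c := spfam_comm Fq Fp.
by rewrite !pext_th ?thM //; exact: proj_mul.
Qed.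

Lemma pextM x y : pext (x ** y) = pext x ** pext y.
Proof.
have sq z : pext (z ** z) = pext z ** pext z by apply: (@pext_spfam z); exact: spfam_dense.
have h : x ** y = 2^-1 *: ((x + y) ** (x + y) - x ** x - y ** y).
  by rewrite !opDl !opDr (opC y x); linear_eq R.
by rewrite h pextZ !pextB !sq pextD !opDl !opDr (opC (pext y) (pext x)); linear_eq R.
Qed.

Lemma pext_bij : bijective pext.
Proof.
pose g y := xget 0 [set x | pext x = y].
have gK y : pext (g y) = y.
  by rewrite /g; case: xgetP => [x -> //|h]; case: (pext_surj y) => x /h.
by exists g => // x; apply: pext_inj; rewrite gK.
Qed.
End Extension.

(** * Minimal associative subalgebras *)

Section Rays.
Variables (R : realType) (A : jbwAlg R).
Implicit Types (p q x y z d : A) (k : R) (C D : set A).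

Definition ray p : set A := [set x | exists k, x = k *: p].

Lemma ray_id p : ray p p. Proof. by exists 1; rewrite scale1r. Qed.

Lemma ray_AS p : proj p -> is_AS (jb_op A) (ray p).
Proof.
move=> pp; split.
- by exists 0; rewrite scale0r.
- by move=> k _ _ [l ->] [m ->]; exists (k * l + m); linear_eq R.
- by move=> _ _ [l ->] [m ->]; exists (l * m); rewrite opZl opZr pp scalerA.
- apply/closed_normP => x hx; have [p0|p0] := pselect (p = 0).
    suff -> : x = 0 by exists 0; rewrite scale0r.
    apply/normr0_eq0/eqP; rewrite eq_le normr_ge0 andbT; apply/ler_addgt0Pr => e e0.
    by have [_ [k ->]] := hx e e0; rewrite p0 scaler0 subr0 add0r => /ltW.
  (* A state with value 1 at [p] reads off the coefficient continuously, so the line is the kernel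
     of a bounded map. *)
  have [w hw wp] := state_proj pp p0; exists (w x).
  apply/eqP; rewrite -subr_eq0; apply/eqP.
  apply: (@closure_ker _ _ _ (fun x => x - w x *: p) (1 + `|p|) (ray p)).
  + by move=> u v; rewrite (stateB hw); linear_eq R.
  + move=> u; rewrite (le_trans (ler_normB _ _)) // mulrDl mul1r lerD // normrZ mulrC.
    by rewrite ler_wpM2l // state_norm.
  + by move=> _ [k ->]; rewrite (stateZ hw) wp mulr1 subrr.
  + exact/closure_normP.
- by move=> _ _ _ [k ->] [l ->] [m ->]; rewrite !(opZl, opZr) !pp; linear_eq R.
Qed.

Lemma ray_inj p q : proj p -> proj q -> ray p = ray q -> p = q.
Proof.
move=> pp pq e; have [p0|p0] := pselect (p = 0).
  have : ray p q by rewrite e; exact: ray_id.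
  by case=> k ->; rewrite p0 scaler0.
have [k pE] : ray q p by rewrite -e; exact: ray_id.
have : (k * k - k) *: q = 0.
  by have := pp; rewrite /proj pE opZl opZr pq => h; linear_from R h.
move/eqP; rewrite scaler_eq0 => /orP[|/eqP q0]; last by exfalso; apply: p0; rewrite pE q0 scaler0.
have -> : k * k - k = k * (k - 1) by ring.
rewrite mulf_eq0 => /orP[/eqP k0|]; first by exfalso; apply: p0; rewrite pE k0 scale0r.
by rewrite subr_eq0 => /eqP k1; rewrite pE k1 scale1r.
Qed.

Lemma ray_orth p q : orth (jb_op A) (ray p) (ray q) <-> p ** q = 0.
Proof.
split=> [h|h _ _ [k ->] [l ->]]; last by rewrite opZl opZr h !scaler0.
by apply: h; exact: ray_id.
Qed.

Definition nontriv C := exists2 x, C x & x <> 0.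
Definition atom D := [/\ is_AS (jb_op A) D, nontriv D &
  forall C, is_AS (jb_op A) C -> C `<=` D -> nontriv C -> D `<=` C].

Lemma ray_atom p : proj p -> p <> 0 -> atom (ray p).
Proof.
move=> pp p0; split; [exact: ray_AS|by exists p; first exact: ray_id|].
move=> C hC sub [x Cx x0] _ [l ->]; have [k xE] := sub x Cx.
have k0 : k != 0 by apply/eqP => k0; apply: x0; rewrite xE k0 scale0r.
have -> : l *: p = (l / k) *: x by rewrite xE scalerA divfK.
exact: (ASZ hC).
Qed.

(* A state attaining the norm of a positive [x] in a minimal subalgebra is multiplicative at
   [x], hence kills the ideal of [x - x ** x]; so this ideal is zero. *)
Lemma atom_ray D : atom D -> exists p, [/\ proj p, p <> 0 & D = ray p].
Proof.
move=> [hD [y Dy y0] minD].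
have yy0 : `|y ** y| != 0 by rewrite norm_sq expf_neq0 // normr_eq0; apply/eqP.
have yyp : 0 < `|y ** y| by rewrite lt_def yy0 normr_ge0.
pose x := `|y ** y|^-1 *: (y ** y).
have Dx : D x by apply: (ASZ hD); exact: (ASM hD).
have px : pos x by apply: posZ; [rewrite invr_ge0|exact: pos_sq].
have nx : `|x| = 1 by rewrite normrZ normfV normr_id mulVf.
have n0 : \one != 0 :> A by apply/eqP => h; apply: y0; rewrite -(op1l y) h op0l.
have x1 : x <== \one by have := jle_norm x; rewrite nx scale1r.
clearbody x.
pose z := x - x ** x; have Dz : D z by apply: (ASB hD) => //; exact: (ASM hD).
have pz : pos z.
  have -> : z = x ** (\one - x) by rewrite opBr op1r.
  have hg := geno_AS x; apply: (posM hg) => //; [exact: geno1|exact: geno_id|].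
  by apply: (ASB hg); [exact: geno1|exact: geno_id].
have z0 : z = 0.
  apply: contrapT => zn; pose S : set A := [set u | exists2 d, D d & u = z ** d].
  have SD : closure (lspan S) `<=` D.
    move=> u /closure_normP hu; apply: (ASlim hD) => e e0; have [v Sv uv] := hu e e0.
    exists v => //; elim: Sv => [|k _ t [d Dd ->] _ IH]; first exact: (AS0 hD).
    by apply: (ASD hD) => //; apply: (ASZ hD); exact: (ASM hD).
  have hS : is_AS (jb_op A) (closure (lspan S)).
    split.
    - by apply: subset_closure; exact: lspan0.
    - exact: closure_lspan_lin.
    - move=> u v; apply: closureM_gen; apply: lspanM => _ _ [d Dd ->] [d' Dd' ->].
      exists (d ** (z ** d')); first by apply: (ASM hD) => //; exact: (ASM hD).
      by rewrite (ASA hD) //; exact: (ASM hD).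
    - exact: closed_closure.
    - by move=> a b c /SD Da /SD Db /SD Dc; exact: (ASA hD).
  have : D `<=` closure (lspan S).
    apply: minD => //; exists (z ** z); last by move/sq_eq0.
    by apply: subset_closure; apply: lspan_gen; exists z.
  move/(_ x Dx); have [w [hw xw]] := state_max x n0.
  have wx : w x = 1.
    apply/eqP; rewrite eq_le; apply/andP; split.
      by have := state_le hw x1; rewrite (state1 hw).
    have w0 := state_pos hw px; have := norm_mono px xw; rewrite nx normrZ ger0_norm // => h.
    by apply: (le_trans h); rewrite ler_piMr // norm_one.
  have wz : w z = 0.
    have p1x : pos (\one - x) by exact: x1.
    have := @state_null _ _ w (\one - x) x hw p1x; rewrite (stateB hw) (state1 hw) wx subrr.
    by rewrite opBr op1r; exact.
  move=> hx; have : w x = 0; last by rewrite wx => /eqP; rewrite oner_eq0.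
  apply: (@closure_ker R A R^o w 1 (lspan S) _ _ _ x hx).
  - by move=> u v; exact: stateB.
  - by move=> u; rewrite mul1r; exact: state_norm.
  - move=> u; elim=> [|k _ t [d Dd ->] _ IH]; first exact: state0.
    by rewrite (stateD hw) (stateZ hw) IH addr0 (opC z d) state_null ?mulr0.
have pjx : proj x by rewrite /proj; apply/esym/eqP; rewrite -subr_eq0 -/z z0.
have xn : x <> 0 by move=> e; move: nx; rewrite e normr0 => /esym/eqP; rewrite oner_eq0.
have sub : ray x `<=` D by move=> _ [k ->]; exact: (ASZ hD).
exists x; split => //; apply/seteqP; split => //.
by apply: minD => //; [exact: ray_AS|exists x => //; exact: ray_id].
Qed.
End Rays.

(** * The bijection of projections induced by the isomorphism of posets *)

Section OrthoIsomorphism.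
Variables (R : realType) (A B : jbwAlg R) (phi : set A -> set B).
Hypothesis phi_AS : forall C, is_AS (jb_op A) C -> is_AS (jb_op B) (phi C).
Hypothesis phi_surj : forall D, is_AS (jb_op B) D -> exists2 C, is_AS (jb_op A) C & phi C = D.
Hypothesis phi_sub : forall C D, is_AS (jb_op A) C -> is_AS (jb_op A) D ->
  (C `<=` D <-> phi C `<=` phi D).
Hypothesis phi_orth : forall C D, is_AS (jb_op A) C -> is_AS (jb_op A) D ->
  (orth (jb_op A) C D <-> orth (jb_op B) (phi C) (phi D)).

Lemma ray0 (C : jbwAlg R) : ray (0 : C) = [set 0].
Proof.
apply/seteqP; split => [_ [k ->]|x ->] /=; first by rewrite scaler0.
by exists 0; rewrite scaler0.
Qed.

Lemma AS_ge0 (C : jbwAlg R) (D : set C) : is_AS (jb_op C) D -> ray (0 : C) `<=` D.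
Proof. by rewrite ray0 => hD _ ->; exact: (AS0 hD). Qed.

Lemma phi_ray0 : phi (ray 0) = ray 0.
Proof.
apply/seteqP; split; last by apply: AS_ge0; exact/phi_AS/ray_AS/proj0.
have [C hC <-] := phi_surj (ray_AS (proj0 B)).
by apply/phi_sub => //; [exact/ray_AS/proj0|exact: AS_ge0].
Qed.

Lemma nontrivP (C : jbwAlg R) (D : set C) : nontriv D <-> ~ (D `<=` ray 0).
Proof.
split=> [[x Dx x0] h|h]; first by have [k] := h x Dx; rewrite scaler0.
apply: contrapT => n; apply: h => x Dx; rewrite ray0; apply: contrapT => x0.
by apply: n; exists x.
Qed.

Lemma phi_nontriv C : is_AS (jb_op A) C -> nontriv C <-> nontriv (phi C).
Proof.
move=> hC; rewrite !nontrivP -phi_ray0.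
have h := phi_sub hC (ray_AS (proj0 A)); tauto.
Qed.

Lemma phi_atom C : is_AS (jb_op A) C -> atom C <-> atom (phi C).
Proof.
move=> hC; split=> [[_ nC minC]|[_ nC minC]].
  split; [exact: phi_AS|exact/phi_nontriv|move=> D hD].
  have [E hE <-] := phi_surj hD => /phi_sub sub /phi_nontriv nE.
  by apply/phi_sub => //; apply: minC => //; [exact: sub|exact: nE].
split => //; first exact/phi_nontriv.
move=> E hE sub nE; apply/phi_sub => //; apply: minC; [exact: phi_AS|exact/phi_sub|].
exact/phi_nontriv.
Qed.

Lemma phi_ray_ex p : proj p -> exists q, proj q /\ phi (ray p) = ray q.
Proof.
move=> pp; have [->|p0] := pselect (p = 0).
  by exists 0; rewrite phi_ray0; split => //; exact: proj0.
have := ray_atom pp p0; rewrite (phi_atom (ray_AS pp)) => /atom_ray[q [pq _ e]].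
by exists q.
Qed.

Definition phi_proj p : B := xget 0 [set q | proj q /\ phi (ray p) = ray q].

Lemma phi_projP p : proj p -> proj (phi_proj p) /\ phi (ray p) = ray (phi_proj p).
Proof.
move=> pp; rewrite /phi_proj; case: xgetP => [q -> //|h].
by case: (phi_ray_ex pp) => q /h.
Qed.

Lemma phi_proj_orth p q : proj p -> proj q -> (p ** q = 0 <-> phi_proj p ** phi_proj q = 0).
Proof.
move=> pp pq; rewrite -!ray_orth; have [_ <-] := phi_projP pp; have [_ <-] := phi_projP pq.
by apply: phi_orth; exact: ray_AS.
Qed.

Lemma phi_proj_surj q : proj q -> exists2 p, proj p & phi_proj p = q.
Proof.
move=> pq; have [q0|q0] := pselect (q = 0).
  exists 0; first exact: proj0.
  have [p0 e] := phi_projP (proj0 A); apply: ray_inj => //.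
  by rewrite -e phi_ray0 q0.
have [C hC e] := phi_surj (ray_AS pq).
have := ray_atom pq q0; rewrite -e => /(phi_atom hC)/atom_ray[p [pp _ CE]].
exists p => //; have [p1 e1] := phi_projP pp; apply: ray_inj => //.
by rewrite -e1 -CE e.
Qed.
End OrthoIsomorphism.

(** * Subalgebras generated by one element *)

Section NonunitalCalculus.
Variables (R : realType) (A : jbwAlg R).
Implicit Types (p q x y z d w : A) (k c a h : R) (C D : set A).

(** Functions of [x] divisible by [x] belong to the subalgebra generated without the unit; this is
    how membership in [gen x] is checked below. *)
Lemma gen_mul_geno x g : geno x g -> gen x (x ** g).
Proof.
move=> hg; apply: (ASlim (gen_AS x)) => e e0.
have x1 : 0 < `|x| + 1 by rewrite ltr_wpDl.
have [s Ss gs] := (closure_normP _ _).1 hg _ (divr_gt0 e0 x1).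
exists (x ** s); last first.
  rewrite -opBr (le_lt_trans (op_norm _ _)) //.
  apply: (@le_lt_trans _ _ ((`|x| + 1) * `|g - s|)); first by rewrite ler_wpM2r // lerDl.
  by rewrite mulrC -ltr_pdivlMr.
elim: Ss => [|k u v Fu _ IH]; first by rewrite op0r; exact: (AS0 (gen_AS x)).
rewrite opDr opZr; apply: (ASD (gen_AS x)) => //; apply: (ASZ (gen_AS x)).
case: Fu => [->|[n _ <-]]; first by rewrite op1r; exact: gen_id.
by apply: (ASM (gen_AS x)); [exact: gen_id|exact: gen_pw].
Qed.

(** w = (x - c)_+ vanishes near 0, hence is divisible by [x]: from x w = w (w + c) one gets w = x (w
    / (w + c)). *)
Lemma jplus_sub_gen x c : 0 < c -> gen x (jplus (x - c *: \one)).
Proof.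
move=> c0; set w := jplus _; have hg := geno_AS x.
have Cw : geno x w by apply: (@jplus_AS _ _ (geno x)) => //; [exact: geno1|exact: geno_k].
have pw : pos w by exact: jplus_pos.
have Cwc : geno x (w + c *: \one) by apply: (ASD hg) => //; apply: (ASZ hg); exact: geno1.
have cw : c *: \one <== w + c *: \one by rewrite /jle addrK.
have [z [Cz _ wz]] := pos_inv hg (geno1 x) Cwc c0 cw.
have wx : x ** w = w ** (w + c *: \one).
  have h0 : w ** jminus (x - c *: \one) = 0 by exact: jplusM.
  have h1 : x = w - jminus (x - c *: \one) + c *: \one by rewrite jplusB subrK.
  rewrite (opC x); move: (jminus _) h0 h1 => m h0 ->.
  by rewrite opDr opBr h0 subr0 opDr.
have -> : w = x ** (w ** z).
  by rewrite -(ASA hg) //; [rewrite wx (ASA hg) // wz op1r|exact: geno_id].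
by apply: gen_mul_geno; exact: (ASM hg).
Qed.

Lemma jplus_gen x : gen x (jplus x).
Proof.
apply: (ASlim (gen_AS x)) => e e0; have e2 : 0 < e / 2 by rewrite divr_gt0.
exists (jplus (x - (e / 2) *: \one)); first exact: jplus_sub_gen.
have hg := geno_AS x; have g1 := geno1 x; have gx := geno_id x.
set w := jplus (x - _); have Cw : geno x w by apply: (@jplus_AS _ _ (geno x)) => //; exact: geno_k.
have pw : pos w by exact: jplus_pos.
have h1 : w <== jplus x.
  apply: (jplus_mono hg) => //; first exact: geno_k.
  by have := @posk _ A _ (ltW e2); rewrite /jle; congr pos; linear_eq R.
have h2 : jplus x <== w + (e / 2) *: \one.
  apply: (jplus_le hg) => //.
  - by apply: (ASD hg) => //; exact: (ASZ hg).
  - by apply: posD => //; apply: posk; exact: ltW.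
  - by have := jplus_ge (x - (e / 2) *: \one); rewrite -/w /jle; congr pos; linear_eq R.
apply: (@le_lt_trans _ _ (e / 2)); last by lra.
apply: norm_le; first exact: ltW.
- have := posD h1 (@posk _ A _ (ltW e2)); rewrite /jle; congr pos; linear_eq R.
- by move: h2; rewrite /jle; congr pos; linear_eq R.
Qed.

Lemma jminus_gen x : gen x (jminus x).
Proof.
have h : gen x (- x) by apply: (ASN (gen_AS x)); exact: gen_id.
by rewrite jminusN; apply: (@gen_min _ _ (gen x) (- x) (gen_AS x) h); exact: jplus_gen.
Qed.

Lemma proj_sub p q : proj p -> proj q -> q ** p = p -> proj (q - p).
Proof. by move=> pp pq h; rewrite /proj !opBl !opBr pq (opC p q) h pp; linear_eq R. Qed.

Lemma sp_mono x k l : k <= l -> sp x l <== sp x k.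
Proof.
by move=> kl; apply/proj_pos/proj_sub; [exact: sp_proj|exact: sp_proj|exact: sp_le].
Qed.

Section Tents.
Variables (x : A) (h : R).
Hypothesis h0 : 0 < h.
Local Notation J c := (jplus (x - c *: \one)).

Lemma sp_J_lo c c' : c <= c' -> sp x c ** J c' = J c'.
Proof.
move=> cc; apply: (@peirce1_le _ _ (sp x c')); [exact: sp_proj|exact: sp_le| |exact: sp_proj].
by apply: rp_id; exact: jplus_pos.
Qed.

Lemma sp_J_hi c c' : c' <= c -> sp x c ** J c' = J c + (c - c') *: sp x c.
Proof.
move=> cc; have h1 : sp x c' ** jminus (x - c' *: \one) = 0 by exact: rp_jminus.
have h2 : sp x c ** jminus (x - c' *: \one) = 0.
  by apply: (peirce10 (sp_proj x c') _ h1); exact: sp_le.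
have h3 : sp x c ** (x - c *: \one) = J c by exact: rp_jplus.
have -> : J c' = (x - c *: \one) + (c - c') *: \one + jminus (x - c' *: \one).
  by have := jplusB (x - c' *: \one) => e; rewrite -[LHS](subrK (jminus (x - c' *: \one))) e; linear_eq R.
by rewrite 2!opDr h3 h2 opZr op1r addr0.
Qed.

(** The hat function of height [h] supported between c - h and c + h, applied to [x]. *)
Definition tent c : A := J (c - h) - 2 *: J c + J (c + h).

Lemma tent_pos c : pos (tent c).
Proof. by have := jplus_convex x h0 (c - h); rewrite !subrK. Qed.

Lemma sp_tent_lo c a : c <= a - h -> sp x c ** tent a = tent a.
Proof.
move=> ca; have h0' := h0; rewrite /tent opDr opBr (opZr 2) !sp_J_lo //; lra.
Qed.

Lemma sp_tent_hi c a : a + h <= c -> sp x c ** tent a = 0.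
Proof.
move=> ca; have h0' := h0; rewrite /tent opDr opBr (opZr 2) !sp_J_hi; [linear_eq R|lra..].
Qed.

Lemma tent_gen a : h < a -> gen x (tent a).
Proof.
move=> ha; have h0' := h0; have hg := gen_AS x; rewrite /tent.
apply: (ASD hg); last by apply: (@jplus_sub_gen x (a + h)); lra.
apply: (ASB hg); first by apply: (@jplus_sub_gen x (a - h)); lra.
by apply: (ASZ hg); apply: (@jplus_sub_gen x a); lra.
Qed.

Variable N : nat.
Definition tents_odd : A := \sum_(i < N) tent (i.*2.+1%:R * h).
Definition tents_even : A := \sum_(i < N) tent (i.*2%:R * h).

Lemma doubleR i : i.*2%:R = 2 * i%:R :> R.
Proof. by rewrite -muln2 natrM mulrC. Qed.
Lemma doubleSR i : i.*2.+1%:R = 2 * i%:R + 1 :> R.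
Proof. by rewrite -natr1 doubleR. Qed.

(** A partition of unity, up to the factor [h]: the second differences telescope to the two ends 0
    and (2N - 1) h of the interval containing the spectrum. *)
Lemma tents_sum : pos x -> x <== ((2 * N%:R - 1) * h) *: \one -> tents_odd + tents_even = h *: \one.
Proof.
move=> px xN; have h0' := h0; have -> : tents_odd + tents_even =
    J (- h) - J 0 - J ((2 * N%:R - 1) * h) + J (2 * N%:R * h).
  rewrite /tents_odd /tents_even; elim: N => [|n IH].
    have e1 : (2 * 0%:R - 1) * h = - h by ring.
    have e2 : 2 * 0%:R * h = 0 by ring.
    by rewrite !big_ord0 e1 e2 addr0 addrAC subrK subrr.
  have en : n.+1%:R = n%:R + 1 :> R by rewrite natr1.
  rewrite !big_ord_recr /= addrACA IH /tent doubleR doubleSR en.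
  have e1 : (2 * n%:R + 1) * h - h = 2 * n%:R * h by ring.
  have e2 : (2 * n%:R + 1) * h + h = 2 * (n%:R + 1) * h by ring.
  have e3 : 2 * n%:R * h + h = (2 * n%:R + 1) * h by ring.
  have e4 : 2 * n%:R * h - h = (2 * n%:R - 1) * h by ring.
  have e5 : (2 * (n%:R + 1) - 1) * h = (2 * n%:R + 1) * h by ring.
  have H (a b c d e f : A) : a - b - c + d + (d - 2 *: e + f + (c - 2 *: d + e)) = a - b - e + f.
    by linear_eq R.
  by rewrite e1 e2 e3 e4 e5 H.
have j1 : J (- h) = x + h *: \one.
  rewrite scaleNr opprK jplus_id //; apply: posD => //; apply: posk; exact: ltW.
have j0 : J 0 = x by rewrite scale0r subr0 jplus_id.
rewrite j1 j0.
have z c : x <== c *: \one -> J c = 0.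
  by move=> hx; apply: jplus_0; move: hx; rewrite /jle; congr pos; linear_eq R.
rewrite !z //; first by linear_eq R.
apply: (jle_trans xN); rewrite /jle -scalerBl; apply: posk; lra.
Qed.

Lemma tents_pos : pos tents_odd /\ pos tents_even.
Proof.
by split; rewrite /tents_odd /tents_even; elim/big_ind: _ => *;
  try exact: pos0; try exact: posD; exact: tent_pos.
Qed.

Lemma sum_gen (F : 'I_N -> A) : (forall i, gen x (F i)) -> gen x (\sum_i F i).
Proof.
move=> hF; have hg := gen_AS x; elim/big_ind: _ => //; first exact: (AS0 hg).
by move=> *; exact: (ASD hg).
Qed.

Lemma op_sum (y : A) (F : 'I_N -> A) : y ** (\sum_i F i) = \sum_i y ** F i.
Proof.
by elim/big_rec2: _ => [|i u v _ <-]; rewrite ?op0r // opDr.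
Qed.

(** The jump at an even grid point falls between the supports of odd hats, so whole hats are kept or
    removed. As [0 < k], those kept are centred beyond [h], as [tent_gen] requires. *)
Lemma sp_tents_odd (k : nat) : (0 < k)%N -> gen x (sp x (k.*2%:R * h) ** tents_odd).
Proof.
move=> k0; have h0' := h0; rewrite /tents_odd op_sum; apply: sum_gen => i; rewrite doubleR doubleSR.
have k1 : 1 <= k%:R :> R by rewrite ler1n.
have [ki|ik] := leqP k i.
  have kiR : k%:R <= i%:R :> R by rewrite ler_nat.
  rewrite sp_tent_lo; last by nra.
  by apply: tent_gen; nra.
have ikR : i%:R + 1 <= k%:R :> R by rewrite natr1 ler_nat.
by rewrite sp_tent_hi; [exact: (AS0 (gen_AS x))|nra].
Qed.

Lemma sp_tents_even (k : nat) : gen x (sp x (k.*2.+1%:R * h) ** tents_even).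
Proof.
have h0' := h0; rewrite /tents_even op_sum; apply: sum_gen => i; rewrite doubleR doubleSR.
have k1 : 0 <= k%:R :> R by rewrite ler0n.
have [ki|ik] := ltnP k i.
  have kiR : k%:R + 1 <= i%:R :> R by rewrite natr1 ler_nat.
  rewrite sp_tent_lo; last by nra.
  by apply: tent_gen; nra.
have ikR : i%:R <= k%:R :> R by rewrite ler_nat.
by rewrite sp_tent_hi; [exact: (AS0 (gen_AS x))|nra].
Qed.
End Tents.

(* Interpolating a step function [s] on the even grid and a step function [t] on the odd grid,
   both close to [z], linearly between the grid points gives a function continuous in [x]. *)
Lemma interpolate x z s t h N (e : R) : 0 < h -> pos x -> x <== ((2 * N%:R - 1) * h) *: \one ->
  `|z - s| <= e -> `|z - t| <= e ->
  `|z - h^-1 *: (s ** tents_odd x h N + t ** tents_even x h N)| <= 2 * e.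
Proof.
move=> h0 px xN zs zt; have := tents_sum h0 px xN; have [po pe] := tents_pos x h0 N.
move: (tents_odd x h N) (tents_even x h N) po pe => d d' pd pd' dd.
have e0 : 0 <= e by apply: le_trans zs.
have hn : h != 0 by rewrite gt_eqF.
have nh : `|h *: (\one : A)| <= h.
  by rewrite normrZ gtr0_norm // ler_piMr ?norm_one // ltW.
have nd : `|d| <= h.
  by apply: le_trans nh; apply: norm_mono => //; rewrite /jle -dd addrC addKr.
have nd' : `|d'| <= h.
  by apply: le_trans nh; apply: norm_mono => //; rewrite /jle -dd addrK.
have zE : z = h^-1 *: (z ** d + z ** d').
  by rewrite -opDr dd opZr op1r scalerA mulVf // scale1r.
rewrite {1}zE; have -> : h^-1 *: (z ** d + z ** d') - h^-1 *: (s ** d + t ** d') =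
    h^-1 *: ((z - s) ** d + (z - t) ** d') by rewrite !opBl; linear_eq R.
rewrite normrZ gtr0_norm ?invr_gt0 // mulrC ler_pdivrMr // (le_trans (ler_normD _ _)) //.
have -> : 2 * e * h = e * h + e * h by ring.
by apply: lerD; rewrite (le_trans (op_norm _ _)) // ler_pM.
Qed.

Section Grids.
Variable x : A.
(** The ratio is odd, so refining the grid preserves the parity of multiples: each of the two
    families of thresholds is increasing in [n], and they stay disjoint. *)
Definition third (n : nat) : R := 3^-1 ^+ n.

Lemma third_gt0 n : 0 < third n. Proof. by rewrite exprn_gt0 // invr_gt0. Qed.
Lemma thirdS n : third n = 3 * third n.+1.
Proof. by rewrite /third exprS mulrA divff ?mul1r. Qed.
Lemma third_small (e : R) : 0 < e -> exists n, third n < e.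
Proof. by move=> e0; apply: expr_small => //; lra. Qed.

Definition even_level n : set A := [set p | exists2 k : nat, (0 < k)%N & p = sp x (k.*2%:R * third n)].
Definition odd_level n : set A := [set p | exists k : nat, p = sp x (k.*2.+1%:R * third n)].
Definition even_fam : set A := [set p | exists n, even_level n p].
Definition odd_fam : set A := [set p | exists n, odd_level n p].

Lemma even_levelS n : even_level n `<=` even_level n.+1.
Proof.
move=> _ [k k0 ->]; exists (3 * k)%N; first by rewrite muln_gt0.
by rewrite thirdS !doubleR natrM; congr sp; ring.
Qed.
Lemma odd_levelS n : odd_level n `<=` odd_level n.+1.
Proof.
move=> _ [k ->]; exists (3 * k).+1.
have e : (3 * k).+1%:R = 3 * k%:R + 1 :> R by rewrite -natr1 natrM.
by rewrite thirdS !doubleSR e; congr sp; ring.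
Qed.

Lemma level_span (L : nat -> set A) : (forall n, L n `<=` L n.+1) ->
  forall s, lspan [set p | exists n, L n p] s -> exists n, forall m, (n <= m)%N -> lspan (L m) s.
Proof.
move=> LS s; have Lm n m : (n <= m)%N -> L n `<=` L m.
  move=> /subnK <-; elim: (m - n)%N => [|k IH] //.
  by apply: subset_trans IH _; exact: LS.
elim=> [|k u v [n Ln] _ [n' IH]]; first by exists 0%N => m _; exact: lspan0.
exists (maxn n n') => m; rewrite geq_max => /andP[nm n'm].
by apply: lspanS; [exact: (Lm n m)|exact: IH].
Qed.

Lemma fam_AS (F : set A) : (forall p, F p -> exists k, p = sp x k) ->
  (forall k l, F (sp x k) -> F (sp x l) -> F (sp x (Num.max k l))) ->
  is_AS (jb_op A) (closure (lspan F)).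
Proof.
move=> hF FM; apply: AS_closure_lspan.
  move=> p q Fp Fq; have [k pE] := hF p Fp; have [l qE] := hF q Fq.
  by move: Fp Fq; rewrite pE qE sp_mul; exact: FM.
move=> p q Fp Fq; have [k ->] := hF p Fp; have [l ->] := hF q Fq.
by apply/(lcomm_proj _ (sp_proj x k)); exact: sp_sp_comm.
Qed.

Lemma even_AS : is_AS (jb_op A) (closure (lspan even_fam)).
Proof.
apply: fam_AS => [p [n [k _ ->]]|k l]; first by eexists.
by case: (leP k l).
Qed.
Lemma odd_AS : is_AS (jb_op A) (closure (lspan odd_fam)).
Proof.
apply: fam_AS => [p [n [k ->]]|k l]; first by eexists.
by case: (leP k l).
Qed.

Hypothesis px : pos x.

Lemma even_odd_gen z : closure (lspan even_fam) z -> closure (lspan odd_fam) z -> gen x z.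
Proof.
move=> /closure_normP hz /closure_normP hz'; apply: (ASlim (gen_AS x)) => e e0.
have e4 : 0 < e / 4 by rewrite divr_gt0.
have [s Ss zs] := hz _ e4; have [t St zt] := hz' _ e4.
have [n hn] := level_span even_levelS Ss; have [n' hn'] := level_span odd_levelS St.
(* Both approximants are brought to one mesh, so that each jumps only where the hats it is
   multiplied by vanish. *)
pose m := maxn n n'; have {}hn := hn m (leq_maxl _ _); have {}hn' := hn' m (leq_maxr _ _).
pose h := third m; have h0 : 0 < h by exact: third_gt0.
pose N := (Num.truncn (`|x| / h)).+1.
have xN : x <== ((2 * N%:R - 1) * h) *: \one.
  apply: (jle_trans (jle_norm x)); rewrite /jle -scalerBl; apply: posk; rewrite subr_ge0.
  have : `|x| <= N%:R * h by rewrite -ler_pdivrMr // ltW // truncnS_gt.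
  have : 1 <= N%:R :> R by rewrite ler1n.
  nra.
have hi := interpolate h0 px xN (ltW zs) (ltW zt).
exists (h^-1 *: (s ** tents_odd x h N + t ** tents_even x h N)); last by apply: (le_lt_trans hi); lra.
have hg := gen_AS x; apply: (ASZ hg); apply: (ASD hg).
  elim: hn => [|k u v [i i0 ->] _ IH]; first by rewrite op0l; exact: (AS0 hg).
  rewrite opDl opZl; apply: (ASD hg) => //; apply: (ASZ hg); exact: sp_tents_odd.
elim: hn' => [|k u v [i ->] _ IH]; first by rewrite op0l; exact: (AS0 hg).
rewrite opDl opZl; apply: (ASD hg) => //; apply: (ASZ hg); exact: sp_tents_even.
Qed.

Lemma even_odd_approx (e : R) : 0 < e -> exists s t,
  [/\ lspan even_fam s, lspan odd_fam t, `|x - s| < e & `|x - t| < e].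
Proof.
move=> e0; have e5 : 0 < e / 5 by rewrite divr_gt0.
have [n hn] := third_small e5; set h := third n in hn.
have h0 : 0 < h by exact: third_gt0.
have h2 : 0 < 2 * h by lra.
pose N := (Num.truncn (`|x| / (2 * h))).+1.
have xN : x <== (N%:R * (2 * h)) *: \one.
  apply: (jle_trans (jle_norm x)); rewrite /jle -scalerBl; apply: posk; rewrite subr_ge0.
  by rewrite -ler_pdivrMr // ltW // truncnS_gt.
have := spectral_chain h2 px xN.
pose s := \sum_(i < N) sp x (i.+1.*2%:R * h); pose t := \sum_(i < N) sp x (i.*2.+1%:R * h).
have -> : \sum_(i < N) sp x (i.+1%:R * (2 * h)) = s.
  by apply: eq_bigr => i _; rewrite doubleR; congr sp; ring.
have ls (F : set A) (G : 'I_N -> A) : (forall i, F (G i)) -> lspan F (\sum_i G i).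
  move=> hF; elim/big_ind: _ => [|u v|i _]; [exact: lspan0|exact: lspanD|exact: lspan_gen].
(* The thresholds of [s] and [t] interlace, so t - s is a sum of disjoint spectral pieces. Hence [x]
   is within 2 h of 2 h s and within 4 h of 2 h t. *)
have st : `|t - s| <= 1.
  have p1 : pos (t - s).
    rewrite /s /t -sumrB; elim/big_ind: _ => [|u v|i _]; [exact: pos0|exact: posD|].
    apply: sp_mono; rewrite doubleR doubleSR -natr1; nra.
  have p2 : t - s <== sp x 0 - sp x (2 * N%:R * h).
    rewrite /s /t -sumrB; have h0' := h0; pose G (i : nat) := sp x (i.*2.+1%:R * h) - sp x (i.+1.*2%:R * h).
    suff H (m : nat) : \sum_(i < m) G i <== sp x 0 - sp x (2 * m%:R * h) by exact: H.
    elim: m => [|m IH]; first by rewrite big_ord0 mulr0 mul0r subrr; exact: jle_refl.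
    have q1 : sp x (m.*2.+1%:R * h) <== sp x (2 * m%:R * h).
      by apply: sp_mono; rewrite doubleSR; nra.
    rewrite big_ord_recr /=; move: (\sum_(i < m) _) IH => S IH.
    by have := posD IH q1; rewrite /G (doubleR m.+1) /jle; congr pos; linear_eq R.
  have p3 : t - s <== \one.
    apply: (jle_trans p2).
    have := posD (proj_le1 (sp_proj x 0)) (proj_pos (sp_proj x (2 * N%:R * h))).
    by rewrite /jle; congr pos; linear_eq R.
  by apply: (le_trans (norm_mono p1 p3)); exact: norm_one.
move=> hs; exists ((2 * h) *: s), ((2 * h) *: t); split.
- by apply/lspanZ/ls => i; exists n, i.+1.
- by apply/lspanZ/ls => i; exists n, i.
- by apply: (le_lt_trans hs); lra.
have -> : x - (2 * h) *: t = (x - (2 * h) *: s) - (2 * h) *: (t - s) by linear_eq R.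
rewrite (le_lt_trans (ler_normB _ _)) // normrZ gtr0_norm //.
have : 2 * h * `|t - s| <= 2 * h by rewrite ler_piMr // ltW.
lra.
Qed.

Lemma gen_even_odd : gen x = closure (lspan even_fam) `&` closure (lspan odd_fam).
Proof.
apply/seteqP; split=> [z gz|z [h1 h2]]; last exact: even_odd_gen.
split; [apply: (gen_min even_AS) gz|apply: (gen_min odd_AS) gz];
  apply/closure_normP => e e0; have [s [t [h1 h2 h3 h4]]] := even_odd_approx e0.
  by exists s.
by exists t.
Qed.
End Grids.
End NonunitalCalculus.

(** * Reconstruction of the subalgebras *)

Section Reconstruction.
Variables (R : realType) (A B : jbwAlg R) (phi : set A -> set B) (psi : A -> B).
Hypothesis phi_AS : forall C, is_AS (jb_op A) C -> is_AS (jb_op B) (phi C).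
Hypothesis phi_surj : forall D, is_AS (jb_op B) D -> exists2 C, is_AS (jb_op A) C & phi C = D.
Hypothesis phi_sub : forall C D, is_AS (jb_op A) C -> is_AS (jb_op A) D ->
  (C `<=` D <-> phi C `<=` phi D).
Hypothesis psi_lin : forall k x y, psi (k *: x + y) = k *: psi x + psi y.
Hypothesis psi_mul : forall x y, psi (x ** y) = psi x ** psi y.
Hypothesis psi_norm : forall x, `|psi x| = `|x|.
Hypothesis psi_surj : forall y, exists x, psi x = y.
Hypothesis psi_ray : forall p, proj p -> phi (ray p) = psi @` ray p.

Lemma psiD x y : psi (x + y) = psi x + psi y.
Proof. by have := psi_lin 1 x y; rewrite !scale1r. Qed.
Lemma psi0 : psi 0 = 0.
Proof. by apply/normr0_eq0; rewrite psi_norm normr0. Qed.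
Lemma psiZ k x : psi (k *: x) = k *: psi x.
Proof. by have := psi_lin k x 0; rewrite psi0 !addr0. Qed.
Lemma psiB x y : psi (x - y) = psi x - psi y.
Proof. by rewrite -scaleN1r psiD psiZ scaleN1r. Qed.
Lemma psi_inj x y : psi x = psi y -> x = y.
Proof.
move=> h; apply/eqP; rewrite -subr_eq0 -normr_eq0 -psi_norm psiB h subrr.
by rewrite normr0.
Qed.

Lemma psi_AS C : is_AS (jb_op A) C -> is_AS (jb_op B) (psi @` C).
Proof.
move=> hC; split.
- by exists 0; [exact: (AS0 hC)|exact: psi0].
- move=> k _ _ [x Cx <-] [y Cy <-]; exists (k *: x + y) => //.
  by apply: (ASD hC) => //; exact: (ASZ hC).
- by move=> _ _ [x Cx <-] [y Cy <-]; exists (x ** y) => //; exact: (ASM hC).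
- apply/closed_normP => y hy; have [x xy] := psi_surj y; exists x => //.
  apply: (ASlim hC) => e e0; have [_ [z Cz <-] yz] := hy e e0; exists z => //.
  by rewrite -psi_norm psiB xy.
- by move=> _ _ _ [x Cx <-] [y Cy <-] [z Cz <-]; rewrite -!psi_mul (ASA hC).
Qed.

(** The closed span is the least associative subalgebra containing the lines of [F]. Both [phi] and
    the image under [psi] respect such least elements, and they agree on the lines. *)
Lemma phi_projgen (F : set A) : (forall p, F p -> proj p) -> is_AS (jb_op A) (closure (lspan F)) ->
  phi (closure (lspan F)) = psi @` closure (lspan F).
Proof.
move=> Fp hF; have Fsub p : F p -> ray p `<=` closure (lspan F).
  move=> h _ [k ->]; apply: (ASZ hF).
  by apply: subset_closure; exact: lspan_gen.
apply/seteqP; split.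
  have [C hC e] := phi_surj (psi_AS hF); rewrite -e; apply/phi_sub => //.
  move=> z /closure_normP hz; apply: (ASlim hC) => t t0; have [s Ss zs] := hz t t0.
  exists s => //; elim: Ss => [|k u v Fu _ IH]; first exact: (AS0 hC).
  apply: (ASD hC) => //; apply: (ASZ hC).
  have pu := Fp u Fu; suff h : ray u `<=` C by apply: h; exact: ray_id.
  apply/phi_sub => //; [exact: ray_AS|rewrite e psi_ray //].
  by apply: image_subset; exact: Fsub.
move=> _ [z /closure_normP hz <-]; apply: (ASlim (phi_AS hF)) => t t0.
have [s Ss zs] := hz t t0; exists (psi s); last by rewrite -psiB psi_norm.
elim: Ss => [|k u v Fu _ IH]; first by rewrite psi0; exact: (AS0 (phi_AS hF)).
rewrite psi_lin; apply: (ASD (phi_AS hF)) => //; apply: (ASZ (phi_AS hF)).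
have pu := Fp u Fu.
have /(phi_sub (ray_AS pu) hF) h := Fsub u Fu; apply: h; rewrite psi_ray //.
by exists u => //; exact: ray_id.
Qed.

(** By [gen_even_odd] this subalgebra is the meet of two that are generated by projections, and
    meets are preserved. *)
Lemma phi_gen_pos x : pos x -> phi (gen x) = psi @` gen x.
Proof.
move=> px; have hg := gen_AS x; have he := even_AS x; have ho := odd_AS x.
have ee : phi (closure (lspan (even_fam x))) = psi @` closure (lspan (even_fam x)).
  by apply: phi_projgen => // p [n [k _ ->]]; exact: sp_proj.
have eo : phi (closure (lspan (odd_fam x))) = psi @` closure (lspan (odd_fam x)).
  by apply: phi_projgen => // p [n [k ->]]; exact: sp_proj.
have gE := gen_even_odd px; apply/seteqP; split.
  move=> y hy.
  have [z he1 zy] : (psi @` closure (lspan (even_fam x))) y.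
    by rewrite -ee; apply: (phi_sub hg he).1 hy; rewrite gE => w [].
  have [z' ho1 zy'] : (psi @` closure (lspan (odd_fam x))) y.
    by rewrite -eo; apply: (phi_sub hg ho).1 hy; rewrite gE => w [].
  exists z => //; rewrite gE; split => //.
  by have -> : z = z' by apply: psi_inj; rewrite zy.
have [C hC e] := phi_surj (psi_AS hg); rewrite -e; apply/phi_sub => //.
rewrite gE => z Cz; split.
  move: z Cz; apply/phi_sub => //; rewrite e ee; apply: image_subset.
  by rewrite gE => w [].
move: z Cz; apply/phi_sub => //; rewrite e eo; apply: image_subset.
by rewrite gE => w [].
Qed.

Lemma AS_jplus C x : is_AS (jb_op A) C -> C x ->
  [/\ C (jplus x), C (jminus x), gen (jplus x) `<=` C & gen (jminus x) `<=` C].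
Proof.
move=> hC Cx; have h1 : C (jplus x) by apply: (@gen_min _ _ C x hC Cx); exact: jplus_gen.
have h2 : C (jminus x) by apply: (@gen_min _ _ C x hC Cx); exact: jminus_gen.
by split => //; apply: gen_min.
Qed.

(** [C] is determined by the subalgebras generated by the positive and negative parts of its
    elements, which lie in [C] although [\one] need not. *)
Lemma phi_psi C : is_AS (jb_op A) C -> phi C = psi @` C.
Proof.
move=> hC; have gp x : is_AS (jb_op A) (gen x) by exact: gen_AS.
have [D hD e] := phi_surj (psi_AS hC).
apply/seteqP; split.
  rewrite -e; apply/phi_sub => // x Cx; have [_ _ h1 h2] := AS_jplus hC Cx.
  have sub y : pos y -> gen y `<=` C -> D y.
    move=> py hy; suff h : gen y `<=` D by apply: h; exact: gen_id.
    apply/phi_sub => //; rewrite e phi_gen_pos //; exact: image_subset.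
  by rewrite -(jplusB x); apply: (ASB hD); apply: sub => //; [exact: jplus_pos|exact: jminus_pos].
move=> _ [x Cx <-]; have [_ _ h1 h2] := AS_jplus hC Cx.
have sub y : pos y -> gen y `<=` C -> phi C (psi y).
  move=> py /(phi_sub (gp y) hC) h; apply: h; rewrite phi_gen_pos //.
  by exists y => //; exact: gen_id.
rewrite -(jplusB x) psiB; apply: (ASB (phi_AS hC)); apply: sub => //.
  exact: jplus_pos.
exact: jminus_pos.
Qed.
End Reconstruction.

(** * Uniqueness of the Jordan isomorphism *)

Section Uniqueness.
Variables (R : realType) (A B : jbwAlg R) (psi psi' : A -> B).

Lemma jordan_iso_one (f : A -> B) : Jordan_iso (jb_op A) (jb_op B) f -> f \one = \one.
Proof.
case=> [[g fK gK] fl fM]; have := fM \one (g \one).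
by rewrite op1l gK op1r.
Qed.

(** Continuity is automatic: [f] preserves squares and the unit, hence the order interval that
    defines the norm. *)
Lemma jordan_iso_norm (f : A -> B) x : Jordan_iso (jb_op A) (jb_op B) f -> `|f x| <= `|x|.
Proof.
move=> hf; have f1 := jordan_iso_one hf; case: hf => _ fl fM.
have fD u v : f (u + v) = f u + f v by have := fl 1 u v; rewrite !scale1r.
have f0 : f 0 = 0 by apply: (@addrI _ (f 0)); rewrite -fD !addr0.
have fZ k u : f (k *: u) = k *: f u by have := fl k u 0; rewrite f0 !addr0.
have fp u : pos u -> pos (f u).
  move=> pu; have [w [_ _ <-]] := pos_sqrt (geno_AS u) (geno1 u) (geno_id u) pu.
  by rewrite fM; exact: pos_sq.
apply: norm_le => //.
  by have := fp _ (jle_normN x); rewrite fD opprK fZ f1 /jle opprK.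
have := fp _ (jle_norm x); rewrite fD fZ f1 -scaleN1r fZ /jle; congr pos; linear_eq R.
Qed.

Lemma jordan_iso_ray_eq : Jordan_iso (jb_op A) (jb_op B) psi -> Jordan_iso (jb_op A) (jb_op B) psi' ->
  (forall p, proj p -> psi @` ray p = psi' @` ray p) -> psi = psi'.
Proof.
move=> h h' hr; have nn := fun x => jordan_iso_norm x h; have nn' := fun x => jordan_iso_norm x h'.
case: (h) => _ l m; case: (h') => _ l' m'.
have im (f : A -> B) p : Jordan_iso (jb_op A) (jb_op B) f -> proj p -> f @` ray p = ray (f p).
  move=> [_ fl _] _; have f0 : f 0 = 0.
    by apply: (@addrI _ (f 0)); have := fl 1 0 0; rewrite !scale1r !addr0 => <-.
  have fZ k u : f (k *: u) = k *: f u by have := fl k u 0; rewrite f0 !addr0.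
  apply/seteqP; split=> [_ [_ [k ->] <-]|_ [k ->]]; first by exists k; rewrite fZ.
  by exists (k *: p); [exists k|rewrite fZ].
have eqp p : proj p -> psi p = psi' p.
  move=> pp; apply: ray_inj; [by rewrite /proj -m pp|by rewrite /proj -m' pp|].
  by rewrite -!im // hr.
apply/funext => x; apply/eqP; rewrite -subr_eq0; apply/eqP.
have lB (f : A -> B) u v : Jordan_iso (jb_op A) (jb_op B) f -> f (u - v) = f u - f v.
  by move=> [_ fl _]; have := fl (-1) v u; rewrite !scaleN1r addrC => ->; rewrite addrC.
have l0 (f : A -> B) : Jordan_iso (jb_op A) (jb_op B) f -> f 0 = 0.
  by move=> hf; have := lB f 0 0 hf; rewrite !subrr.
apply: (@closure_ker _ _ _ (fun x => psi x - psi' x) 2 (lspan (@proj R A))).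
- by move=> u v; rewrite !lB //; linear_eq R.
- move=> u; rewrite (le_trans (ler_normB _ _)) // mulr_natl mulr2n lerD //.
- move=> u; elim=> [|k v w pv _ IH]; first by rewrite !l0 // subrr.
  have {}IH : psi w = psi' w by apply/eqP; rewrite -subr_eq0 IH.
  by rewrite l l' IH eqp // subrr.
- exact: proj_dense.
Qed.
End Uniqueness.

Lemma jordan_iso_of_ortho_iso (R : realType) (A B : jbwAlg R) (phi : set A -> set B) :
  no_typeI2_summand (jb_op A) ->
  (forall C, is_AS (jb_op A) C -> is_AS (jb_op B) (phi C)) ->
  (forall D, is_AS (jb_op B) D -> exists2 C, is_AS (jb_op A) C & phi C = D) ->
  (forall C D, is_AS (jb_op A) C -> is_AS (jb_op A) D -> (C `<=` D <-> phi C `<=` phi D)) ->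
  (forall C D, is_AS (jb_op A) C -> is_AS (jb_op A) D ->
     (orth (jb_op A) C D <-> orth (jb_op B) (phi C) (phi D))) ->
  exists psi : A -> B,
    (Jordan_iso (jb_op A) (jb_op B) psi /\ forall C, is_AS (jb_op A) C -> phi C = psi @` C) /\
    (forall psi' : A -> B, Jordan_iso (jb_op A) (jb_op B) psi' ->
       (forall C, is_AS (jb_op A) C -> phi C = psi' @` C) -> psi' = psi).
Proof.
move=> nI2 pAS psurj psub porth; pose th := phi_proj phi.
have thP p : proj p -> proj (th p) /\ phi (ray p) = ray (th p).
  exact: (phi_projP pAS psurj psub).
have tp p (pp : proj p) : proj (th p) by have [] := thP p pp.
have to p q (pp : proj p) (pq : proj q) : p ** q = 0 <-> th p ** th q = 0.
  exact: (phi_proj_orth pAS psurj psub porth).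
have ts q (pq : proj q) : exists2 p, proj p & th p = q.
  exact: (phi_proj_surj pAS psurj psub).
pose psi := pext th.
have pl k x y : psi (k *: x + y) = k *: psi x + psi y by exact: pext_lin.
have pm x y : psi (x ** y) = psi x ** psi y by exact: pextM.
have pn x : `|psi x| = `|x| by exact: pext_norm.
have psj y : exists x, psi x = y by exact: pext_surj.
have pr p : proj p -> phi (ray p) = psi @` ray p.
  move=> pp; have [_ ->] := thP p pp; have pt : psi p = th p by exact: pext_th.
  have p0 : psi 0 = 0 by apply/normr0_eq0; rewrite pn normr0.
  apply/seteqP; split=> [_ [k ->]|_ [_ [k ->] <-]].
    by exists (k *: p); [exists k|have := pl k p 0; rewrite p0 !addr0 pt].
  by exists k; have := pl k p 0; rewrite p0 !addr0 pt.
have hJ : Jordan_iso (jb_op A) (jb_op B) psi by split => //; exact: pext_bij.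
exists psi; split; first by split => // C; exact: (phi_psi pAS psurj psub pl pm pn psj pr).
move=> psi' hJ' h'; apply: jordan_iso_ray_eq => // p pp.
by rewrite -pr // h' //; exact: ray_AS.
Qed.

Theorem theorem3p1 (R : realType) (A B : completeNormedModType R)
  (mA : A -> A -> A) (mB : B -> B -> B)
  (hA : is_JBW mA) (hB : is_JBW mB) (hI2 : no_typeI2_summand mA)
  (phi : set A -> set B)
  (phi_AS : forall C, is_AS mA C -> is_AS mB (phi C))
  (phi_inj : forall C D, is_AS mA C -> is_AS mA D -> phi C = phi D -> C = D)
  (phi_surj : forall D, is_AS mB D -> exists2 C, is_AS mA C & phi C = D)
  (phi_sub : forall C D, is_AS mA C -> is_AS mA D ->
               (C `<=` D <-> phi C `<=` phi D))
  (phi_orth : forall C D, is_AS mA C -> is_AS mA D ->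
               (orth mA C D <-> orth mB (phi C) (phi D))) :
  exists psi : A -> B,
    (Jordan_iso mA mB psi /\ forall C, is_AS mA C -> phi C = psi @` C) /\
    (forall psi' : A -> B,
       Jordan_iso mA mB psi' -> (forall C, is_AS mA C -> phi C = psi' @` C) ->
       psi' = psi).
Proof.
have [jA dA] := hA; have [jB dB] := hB.
(* The records only bundle the given products with the unit and the suprema obtained from duality,
   so the goal is convertible to the bundled statement. *)
have [eA uA] := @jb_unit R (JbAlg jA) dA; have [eB uB] := @jb_unit R (JbAlg jB) dB.
pose A' := JbwAlg (@dual_sup R (@JbuAlg R (JbAlg jA) eA uA) dA).
pose B' := JbwAlg (@dual_sup R (@JbuAlg R (JbAlg jB) eB uB) dB).
exact: (@jordan_iso_of_ortho_iso R A' B').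
Qed.
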